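(* Let $n\ge1$. For $0\le k\le w-1$, \[ \sum_{\substack{\lambda:\lambda_1 \le 2w\\ c(\lambda)=k}} s_{\lambda}(x_1,\dots,x_n) = \sum_{(T,S)\in \mathrm{MUD}^{e,e}_n(w;(1^k,0^{w-k})\to (0^w))} \omega(T), \qquad \sum_{\substack{\lambda:\lambda_1 \le 2w\\ c(\lambda)=2w-k}} s_{\lambda}(x_1,\dots,x_n) = \sum_{(T,S)\in \mathrm{MUD}^{e,o}_n(w;(1^k,0^{w-k})\to (0^w))} \omega(T), \] and for $k=w$, \[ \sum_{\substack{\lambda:\lambda_1 \le 2w\\ c(\lambda)=w}} s_{\lambda}(x_1,\dots,x_n) = \sum_{(T,S)\in \mathrm{MUD}^*_n(w;(1^w)\to (0^w))} \omega(T). \]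
   Context: $s_\lambda(x_1,\dots,x_n)$ is the Schur polynomial; $c(\lambda)$ is the number of columns of $\lambda$ of odd length. Partitions with at most $w$ rows are written as $w$-tuples; $(1^k,0^{w-k})$ has $k$ parts equal to $1$. A $w$-up-down tableau of length $2n$ from $\mu$ to $\nu$ is a sequence $T=(T_0,\dots,T_{2n})$ of partitions with $\mu=T_0\subseteq T_1\supseteq T_2\subseteq\cdots\subseteq T_{2n-1}\supseteq T_{2n}=\nu$, consecutive members differing by a vertical strip (at most one cell per row), each with at most $w$ rows; $\omega(T)=\prod_{i=1}^n x_i^{-|T_{2i-2}|+2|T_{2i-1}|-|T_{2i}|}$. $\ell(\cdot)$ is the number of nonzero parts. $2j-1$ ($1\le j\le n$) is a length-peak of $T$ if $\ell(T_{2j-2})<\ell(T_{2j-1})>\ell(T_{2j})$, full if $\ell(T_{2j-1})=w$; $p(T)$ is the number of length-peaks of $T$; $\widehat{\mathrm{UD}}_n(w;\mu\to\nu)$ consists of those $T$ all of whose length-peaks are full. $E_w(T)=\{j\in\{1,\dots,n\}:\ell(T_{2j-2})<\ell(T_{2j-1})=\ell(T_{2j})=w\}$. Define $\mathrm{MUD}^*_n(w;\mu\to\nu)=\{(T,S):T\in\widehat{\mathrm{UD}}_n(w;\mu\to\nu),\ S\subseteq E_w(T)\}$; $\mathrm{MUD}^1_n=\{(T,S):T\in\widehat{\mathrm{UD}}_n(w;\mu\to\nu),\ E_w(T)\ne\emptyset,\ S\subseteq E_w(T)\setminus\{\min E_w(T)\}\}$; $\mathrm{MUD}^{0,e}_n=\{(T,\emptyset):T\in\widehat{\mathrm{UD}}_n(w;\mu\to\nu),\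 E_w(T)=\emptyset,\ p(T)\text{ even}\}$; $\mathrm{MUD}^{0,o}_n$ the same with $p(T)$ odd; $\mathrm{MUD}^{e,e}_n=\mathrm{MUD}^1_n\cup\mathrm{MUD}^{0,e}_n$ and $\mathrm{MUD}^{e,o}_n=\mathrm{MUD}^1_n\cup\mathrm{MUD}^{0,o}_n$ (all with parameters $w;\mu\to\nu$). *)

(* Defs.v *)
From HB Require Import structures.
From mathcomp Require Import all_boot all_order all_algebra.
From mathcomp.multinomials Require Import mpoly.

Set Implicit Arguments.
Unset Strict Implicit.
Unset Printing Implicit Defensive.

Import GRing.Theory.
Local Open Scope ring_scope.

(* A partition is a weakly decreasing sequence of naturals; trailing zeros
   are allowed, so that a partition with at most w rows is one of size w. *)
Definition is_partition (l : seq nat) : bool := sorted geq l.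

Definition len (l : seq nat) : nat := count (fun a => 0 < a)%N l.

Definition col_len (l : seq nat) (j : nat) : nat := count (fun a => j < a)%N l.

Definition odd_cols (l : seq nat) : nat :=
  #|[set j : 'I_(head 0%N l) | odd (col_len l j)]|.

Section Schur.
Variables (n : nat) (l : seq nat).

Definition cell : finType :=
  {u : 'I_(size l) * 'I_(head 0%N l) | (u.2 < nth 0 l u.1)%N}.

Definition cell_row (u : cell) : nat := (val u).1.
Definition cell_col (u : cell) : nat := (val u).2.

Definition semistandard (t : {ffun cell -> 'I_n}) : bool :=
  [forall u, forall v,
     ((cell_row u == cell_row v) && (cell_col u < cell_col v)%N
        ==> (t u <= t v)%N) &&
     ((cell_col u == cell_col v) && (cell_row u < cell_row v)%N
        ==> (t u < t v)%N)].

Definition schur : {mpoly int[n]} :=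
  \sum_(t : {ffun cell -> 'I_n} | semistandard t) \prod_(u : cell) 'X_(t u).

(* If l has more than n nonzero rows there is no semistandard tableau: this is
   why sums of Schur polynomials in n variables need only range over
   partitions with at most n rows. *)
Lemma schur_eq0 : is_partition l -> (n < len l)%N -> schur = 0.
Proof.
move=> pl hn; rewrite /schur big_pred0 // => t; apply/negP => /forallP st.
have sz : (n < size l)%N by apply: leq_trans hn (count_size _ _).
have pos i : (i <= n)%N -> (0 < nth 0 l i)%N.
  move=> le_in; rewrite lt0n; apply/negP => /eqP li0.
  have : (len l <= i)%N.
    rewrite /len -(cat_take_drop i l) count_cat.
    rewrite (_ : count _ (drop i l) = 0%N) ?addn0.
      by apply: leq_trans (count_size _ _) _; rewrite size_take; case: ltnP.
    apply/eqP; rewrite -leqn0 leqNgt -has_count.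
    apply/hasPn => a /(nthP 0%N) [j]; rewrite size_drop nth_drop => hj <-.
    have geq_tr : transitive geq by move=> x y z /= yx xz; apply: leq_trans xz yx.
    have := @sorted_leq_nth _ geq geq_tr leqnn 0%N l pl i (i + j)%N.
    rewrite !inE /= li0 -leqNgt; apply; last exact: leq_addr.
      exact: leq_ltn_trans le_in sz.
    by rewrite -ltn_subRL.
  by move=> h; have := leq_trans hn h; rewrite ltnNge le_in.
have hd : (0 < head 0%N l)%N by rewrite -nth0; apply: pos.
have cP (i : 'I_n.+1) :
    ((Ordinal hd : nat) < nth 0 l (Ordinal (leq_ltn_trans (ltn_ord i : i <= n)%N sz)))%N.
  by apply: (pos i); rewrite -ltnS.
pose c i : cell := Sub (_, _) (cP i).
have tinj : injective (fun i : 'I_n.+1 => t (c i)).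
  have lt_t (i j : 'I_n.+1) : (i < j)%N -> (t (c i) < t (c j))%N.
    move=> ij; have /forallP/(_ (c j))/andP[_ /implyP] := st (c i).
    by apply; rewrite /cell_col /cell_row /=.
  move=> i j /= /(congr1 val) /= e; apply: val_inj => /=.
  by case: (ltngtP i j) => // /lt_t; rewrite e ltnn.
by have := leq_card _ tinj; rewrite !card_ord ltnn.
Qed.

End Schur.

(* The sum of s_l(x_1, .., x_n) over the l with l_1 <= 2w and c(l) = c; the
   partitions with more than n rows contribute 0 (schur_eq0). *)
Definition schur_sum (n w c : nat) : {mpoly int[n]} :=
  \sum_(l : n.-tuple 'I_(2 * w).+1 |
          is_partition (map val l) && (odd_cols (map val l) == c))
    schur n (map val l).

(* a is contained in b and b / a has at most one cell in each row. *)
Definition vstrip (w : nat) (a b : seq nat) : bool :=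
  [forall i : 'I_w, (nth 0 a i <= nth 0 b i <= (nth 0 a i).+1)%N].

Definition updown (n w : nat) (mu nu : seq nat) (T : seq (seq nat)) : bool :=
  [&& size T == (2 * n).+1,
      all (fun l => (size l == w) && is_partition l) T,
      nth [::] T 0 == mu,
      nth [::] T (2 * n) == nu
    & [forall j : 'I_n,
         vstrip w (nth [::] T (2 * j)) (nth [::] T (2 * j).+1) &&
         vstrip w (nth [::] T (2 * j).+2) (nth [::] T (2 * j).+1)]].

Record udtab (n w : nat) (mu nu : seq nat) : Type :=
  UDTab { udseq : seq (seq nat); _ : updown n w mu nu udseq }.

HB.instance Definition _ n w mu nu := [isSub for @udseq n w mu nu].
HB.instance Definition _ n w mu nu := [Countable of udtab n w mu nu by <:].

Section UDFinite.
Variables (n w : nat) (mu nu : seq nat).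
Let B := (sumn mu + 2 * n)%N.
Let box : finType := {ffun 'I_(2 * n).+1 * 'I_w -> 'I_B.+1}.

Let to_box (T : udtab n w mu nu) : box :=
  [ffun ij : 'I_(2 * n).+1 * 'I_w => inord (nth 0%N (nth [::] (udseq T) ij.1) ij.2)].

Let of_box (b : box) : option (udtab n w mu nu) :=
  insub [seq [seq val (b (i, j)) | j <- enum 'I_w] | i <- enum 'I_(2 * n).+1].

Lemma updown_bound T i r : updown n w mu nu T -> (i <= 2 * n)%N -> (r < w)%N ->
  (nth 0 (nth [::] T i) r <= B)%N.
Proof.
case/and5P => _ _ /eqP T0 _ /forallP st hi hr.
suff : (nth 0 (nth [::] T i) r <= sumn mu + i)%N.
  by move=> h; apply: leq_trans h _; rewrite leq_add2l.
elim: i hi => [_|i IH hi].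
  rewrite T0 addn0; elim: (mu) (r) => [|a s IHs] [|k] //=.
    exact: leq_addr.
  exact: leq_trans (IHs k) (leq_addl _ _).
have {}IH := IH (ltnW hi).
have hj : (i./2 < n)%N by rewrite ltn_half_double -mul2n.
have /andP[/forallP/(_ (Ordinal hr))/andP[/= _ up]
           /forallP/(_ (Ordinal hr))/andP[/= dn _]] := st (Ordinal hj).
rewrite addnS; have := odd_double_half i; rewrite -mul2n.
case: (odd i) => e; rewrite -e /= ?add1n ?add0n in IH *.
- by apply: leq_trans dn _; apply: leqW.
- by apply: leq_trans up _; rewrite ltnS.
Qed.

Lemma to_boxK : pcancel to_box of_box.
Proof.
move=> T; rewrite /of_box; set s := map _ _.
have hT := valP T; have /and5P[/eqP szT /allP aT _ _ _] := hT.
have -> : s = val T.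
  have szs : size s = (2 * n).+1 by rewrite size_map size_enum_ord.
  apply: (@eq_from_nth _ [::]) => [|i]; rewrite szs ?szT // => hi.
  have szr : size (nth [::] (val T) i) = w.
    have /aT/andP[/eqP //] : nth [::] (val T) i \in val T.
    by apply: mem_nth; rewrite szT.
  rewrite (nth_map ord0) ?size_enum_ord //.
  apply: (@eq_from_nth _ 0%N) => [|r]; rewrite size_map size_enum_ord ?szr // => hr.
  rewrite (nth_map (Ordinal hr)) ?size_enum_ord // ffunE /= !nth_enum_ord //.
  by rewrite inordK // ltnS (updown_bound hT).
exact: valK.
Qed.

HB.instance Definition _ : isFinite (udtab n w mu nu) := PCanIsFinite to_boxK.
End UDFinite.

Section Statistics.
Variables (n w : nat) (mu nu : seq nat).
Implicit Type T : udtab n w mu nu.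

Definition tab T (i : nat) : seq nat := nth [::] (udseq T) i.
Definition ell T (i : nat) : nat := len (tab T i).

(* Indices in {1, .., n} are shifted to 'I_n: j : 'I_n stands for j + 1, whose
   associated triple (T_{2(j+1)-2}, T_{2(j+1)-1}, T_{2(j+1)}) is
   (T_{2j}, T_{2j+1}, T_{2j+2}). *)

(* Since T_{2i} and T_{2i+2} are contained in T_{2i+1}, the natural-number
   subtractions below are not truncated. *)
Definition omega T : {mpoly int[n]} :=
  \prod_(i < n) 'X_i ^+ (2 * sumn (tab T (2 * i).+1)
                         - sumn (tab T (2 * i)) - sumn (tab T (2 * i).+2))%N.

Definition length_peak T (j : 'I_n) : bool :=
  (ell T (2 * j) < ell T (2 * j).+1)%N && (ell T (2 * j).+2 < ell T (2 * j).+1)%N.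

Definition npeaks T : nat := #|[set j | length_peak T j]|.

Definition UDhat : {set udtab n w mu nu} :=
  [set T | [forall j, length_peak T j ==> (ell T (2 * j).+1 == w)]].

Definition Eset T : {set 'I_n} :=
  [set j : 'I_n | [&& (ell T (2 * j) < ell T (2 * j).+1)%N,
                      ell T (2 * j).+1 == ell T (2 * j).+2
                    & ell T (2 * j).+2 == w]].

(* {min E} when E is nonempty. *)
Definition min_set (E : {set 'I_n}) : {set 'I_n} :=
  [set j in E | [forall i in E, (j <= i)%N]].

Definition marked : finType := (udtab n w mu nu * {set 'I_n})%type.

Definition MUDstar : {set marked} :=
  [set TS : marked | (TS.1 \in UDhat) && (TS.2 \subset Eset TS.1)].

Definition MUD1 : {set marked} :=
  [set TS : marked | [&& TS.1 \in UDhat, Eset TS.1 != set0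
              & TS.2 \subset Eset TS.1 :\: min_set (Eset TS.1)]].

Definition MUD0e : {set marked} :=
  [set TS : marked | [&& TS.1 \in UDhat, Eset TS.1 == set0, ~~ odd (npeaks TS.1)
              & TS.2 == set0]].

Definition MUD0o : {set marked} :=
  [set TS : marked | [&& TS.1 \in UDhat, Eset TS.1 == set0, odd (npeaks TS.1)
              & TS.2 == set0]].

Definition MUDee : {set marked} := MUD1 :|: MUD0e.
Definition MUDeo : {set marked} := MUD1 :|: MUD0o.

End Statistics.

Definition colpart (k w : nat) : seq nat := nseq k 1%N ++ nseq (w - k) 0%N.

(* Main.v *)
Require Import Defs.
From HB Require Import structures.
From mathcomp Require Import all_boot all_order all_algebra all_fingroup all_field.
From mathcomp.multinomials Require Import mpoly.
From mathcomp Require Import ring zify.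

Set Implicit Arguments.
Unset Strict Implicit.
Unset Printing Implicit Defensive.

Import GRing.Theory.
Local Open Scope ring_scope.

(** By column reading, a semistandard tableau with at most [2w] columns is a
chain of vertical strips in [2w] rows. A last strip of weight [t] makes all
rows even, or all rows odd, in exactly one way, so the generating function of
the sums with [c(l) = c] in [t^c + t^(2w-c)], or in [t^c - t^(2w-c)], is the
value on [E(t) E(x_1) .. E(x_n)], where [E(x) = prod_k (1 + x z_k)], of the
linear form sending [s_nu] to [1] if all rows of [nu] are even, to [1] or [-1]
if all are odd, and to [0] otherwise. This form is integration over one of the
two components of [O(2w)]: the eigenvalues [z] are [w] pairs [(y, 1/y)], one of
which is replaced by [(1, -1)] on the second component. The integrals become
finite sums over points [y] with [y^M = -1], [M] large and even. Expanding the
same product over the orthogonal characters one factor at a time gives a sum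
over up-down tableaux. A local bijection (adding a cell below the last row of
the middle partition) turns the coefficients into
[1 - [non-full length peak] + [j in E]] on the first component and
[[l(T_(2j-1)) < w] - [length peak]] on the second; half the sum and half the
difference of the two weights are the indicator weights of [MUDee] and
[MUDeo]. *)

(** The Vandermonde determinant of all [2w] eigenvalues is, up to a constant, the Weyl density times
    [prod (y_i - 1/y_i)] over the free pairs, so an integral of [s_nu] is a sum of its bare
    alternant against the product weight [1/(y_i - 1/y_i)]. Such a sum splits into moments of single
    pairs, which see only the parities and the order of two exponents; hence the test on all rows
    even or all odd. On the second component the sign for odd rows is the determinant [-1], carried
    by the pair [(1, -1)]. The points [y^M = -1] with [M] even are closed under inversion, avoid the
    poles [1] and [-1] of the weight, and sum every power of nonzero exponent below [M] in absolute
    value to 0, so the sums are exact once [M] is large. All this takes place in a field of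
    characteristic 0 with roots of unity, into which integral polynomials are embedded. The variable
    [t] packs all values of [c] into one polynomial identity. On the tableau side it is the first
    up-down step from the empty partition, which can only reach a column [(1^k)], and the
    coefficient of [t^k] isolates the tableaux that start there. *)

Definition alt (R : comNzRingType) w (f : 'I_w -> nat -> R) (v : 'I_w -> nat) : R :=
  \det (\matrix_(i, j) f i (v j)).

(** * Alternants: expansions by columns and sums over points *)

Section Alternants.
Variable R : comNzRingType.
Implicit Types (w : nat) (x : R).

Lemma eq_alt w (f g : 'I_w -> nat -> R) u v :
  (forall i j, f i (u j) = g i (v j)) -> alt f u = alt g v.
Proof. by move=> e; rewrite /alt; congr (\det _); apply/matrixP=> i j; rewrite !mxE. Qed.

Lemma alt_perm w (f : 'I_w -> nat -> R) v (s : 'S_w) :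
  alt f (v \o s) = (-1) ^+ s * alt f v.
Proof.
rewrite /alt -det_tr -[in RHS]det_tr -det_perm -det_mulmx -row_permE.
by congr (\det _); apply/matrixP=> i j; rewrite !mxE.
Qed.

Lemma alt_eq0 w (f : 'I_w -> nat -> R) v (j k : 'I_w) :
  j != k -> v j = v k -> alt f v = 0.
Proof.
move=> jk e; rewrite /alt -det_tr; apply: (determinant_alternate jk) => i.
by rewrite !mxE e.
Qed.

Lemma alt_col0 w (f : 'I_w -> nat -> R) v (j : 'I_w) :
  (forall i, f i (v j) = 0) -> alt f v = 0.
Proof.
move=> e; rewrite /alt (expand_det_col _ j) big1 // => i _.
by rewrite mxE e mul0r.
Qed.

(** Every column is a sum of two, and [S] records the chosen summand; in the Pieri rules [S j] says
    whether row [j] gains or loses a cell. *)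
Lemma alt_multilinear w (F : bool -> 'I_w -> 'I_w -> R) :
  \det (\matrix_(i, j) (F true i j + F false i j)) =
  \sum_(S : {ffun 'I_w -> bool}) \det (\matrix_(i, j) F (S j) i j).
Proof.
have E (G : 'I_w -> 'I_w -> R) :
    \det (\matrix_(i, j) G i j) = \sum_(s : 'S_w) (-1) ^+ s * \prod_j G (s j) j.
  rewrite -det_tr /determinant; apply: eq_bigr => s _.
  by congr (_ * _); apply: eq_bigr => j _; rewrite !mxE.
rewrite E; under [RHS]eq_bigr do rewrite E.
rewrite exchange_big; apply: eq_bigr => s _; rewrite -big_distrr /=; congr (_ * _).
rewrite -(bigA_distr_bigA (fun j b => F b (s j) j)); apply: eq_bigr => j _.
by rewrite big_bool.
Qed.

Lemma det_scale_cols w (c : 'I_w -> R) (F : 'I_w -> 'I_w -> R) :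
  \det (\matrix_(i, j) (c j * F i j)) = (\prod_j c j) * \det (\matrix_(i, j) F i j).
Proof.
rewrite -det_tr -[in RHS]det_tr /determinant big_distrr /=; apply: eq_bigr => s _.
rewrite mulrCA; congr (_ * _); rewrite -big_split /=.
by apply: eq_bigr => j _; rewrite !mxE.
Qed.

Lemma det_scale_rows w (c : 'I_w -> R) (F : 'I_w -> 'I_w -> R) :
  \det (\matrix_(i, j) (c i * F i j)) = (\prod_i c i) * \det (\matrix_(i, j) F i j).
Proof.
rewrite /determinant big_distrr /=; apply: eq_bigr => s _.
rewrite mulrCA; congr (_ * _); rewrite -big_split /=.
by apply: eq_bigr => j _; rewrite !mxE.
Qed.

Lemma alt_pieri w (e : 'I_w -> R) x (f h : 'I_w -> nat -> R) v :
  (forall i j, e i * f i (v j) = h i (v j) + x * h i (v j).+1) ->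
  (\prod_i e i) * alt f v =
  \sum_(S : {ffun 'I_w -> bool}) x ^+ (\sum_j S j) * alt h (fun j => v j + S j)%N.
Proof.
move=> H; rewrite /alt -det_scale_rows.
rewrite (_ : \matrix_(i, j) _ = \matrix_(i, j) ((fun b i j =>
    x ^+ b * h i (v j + b)%N) true i j + (fun b i j => x ^+ b * h i (v j + b)%N) false i j)).
  rewrite (alt_multilinear (fun b i j => x ^+ b * h i (v j + b)%N)).
  by apply: eq_bigr => S _; rewrite det_scale_cols prodrXr.
by apply/matrixP=> i j; rewrite !mxE H /= addn1 addn0 expr1 expr0 mul1r addrC.
Qed.

(** The coefficient [c j] depends on the column so that a removal at exponent 0 can be switched
    off. *)
Lemma alt_down w (c : 'I_w -> R) (f h : 'I_w -> nat -> R) u :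
  (forall i j, h i (u j) = f i (u j) + c j * f i (u j).-1) ->
  alt h u =
  \sum_(S : {ffun 'I_w -> bool}) (\prod_(j | S j) c j) * alt f (fun j => u j - S j)%N.
Proof.
move=> H; rewrite /alt.
pose F (b : bool) i j := (if b then c j else 1) * f i (u j - b)%N.
rewrite (_ : \matrix_(i, j) _ = \matrix_(i, j) (F true i j + F false i j)).
  rewrite alt_multilinear; apply: eq_bigr => S _; rewrite /F det_scale_cols.
  by congr (_ * _); rewrite [RHS]big_mkcond.
by apply/matrixP=> i j; rewrite !mxE H /F subn1 subn0 mul1r addrC.
Qed.

Lemma sum_det_rows w (X : finType) (G : 'I_w -> 'I_w -> X -> R) :
  \sum_(y : {ffun 'I_w -> X}) \det (\matrix_(i, j) G i j (y i)) =
  \det (\matrix_(i, j) \sum_y G i j y).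
Proof.
rewrite /determinant exchange_big; apply: eq_bigr => s _ /=.
rewrite -big_distrr /=; congr (_ * _).
under eq_bigr do under eq_bigr do rewrite mxE.
rewrite -(bigA_distr_bigA (fun i y => G i (s i) y)).
by apply: eq_bigr => i _; rewrite mxE.
Qed.

(* Andreief's identity *)
Lemma sum_alt_alt w (X : finType) (f g : X -> nat -> R) (u v : 'I_w -> nat) :
  \sum_(y : {ffun 'I_w -> X}) alt (fun i => f (y i)) u * alt (fun i => g (y i)) v =
  w`!%:R * \det (\matrix_(i, j) \sum_y f y (u i) * g y (v j)).
Proof.
pose G (s : 'S_w) := \sum_(y : {ffun 'I_w -> X})
    \det (\matrix_(i, j) (f (y i) (u (s i)) * g (y i) (v j))).
transitivity (\sum_(s : 'S_w) (-1) ^+ s * G s).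
  under [RHS]eq_bigr do rewrite /G big_distrr /=.
  rewrite exchange_big; apply: eq_bigr => y _ /=.
  rewrite {1}/alt {1}/determinant big_distrl /=; apply: eq_bigr => s _.
  rewrite -mulrA; congr (_ * _).
  rewrite (det_scale_rows (fun i => f (y i) (u (s i))) (fun i j => g (y i) (v j))); congr (_ * _).
  by apply: eq_bigr => i _; rewrite mxE.
(* [G s] is the determinant of the Gram matrix with its rows permuted by [s], so its sign cancels
   that of [s] and all terms agree. *)
rewrite (eq_bigr (fun=> \det (\matrix_(i, j) \sum_y f y (u i) * g y (v j)))).
  by rewrite sumr_const card_Sn mulr_natl.
move=> s _; rewrite /G (sum_det_rows (fun i j y => f y (u (s i)) * g y (v j))).
have -> : \matrix_(i, j) (\sum_y f y (u (s i)) * g y (v j)) =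
    row_perm s (\matrix_(i, j) \sum_y f y (u i) * g y (v j)).
  by apply/matrixP=> i j; rewrite !mxE.
by rewrite row_permE det_mulmx det_perm signrMK.
Qed.

End Alternants.

(** * Vertical strips and Pieri rules for alternants *)

Section Strips.
Implicit Types (w : nat) (a b c : seq nat).

Lemma partitionP a : reflect (forall j, nth 0 a j.+1 <= nth 0 a j)%N (is_partition a).
Proof.
apply: (iffP (sortedP 0%N)) => H j; last by move=> _; apply: H.
case: (ltnP j.+1 (size a)) => [/H //|le]; by rewrite (nth_default _ le).
Qed.

Lemma partition_le a i j : is_partition a -> (i <= j)%N -> (nth 0 a j <= nth 0 a i)%N.
Proof.
move/partitionP=> H; elim: j => [|j IH]; first by rewrite leqn0 => /eqP->.
rewrite leq_eqVlt => /orP[/eqP-> //|]; rewrite ltnS => /IH; exact: leq_trans (H j).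
Qed.

Lemma ltn_col_len a k j : is_partition a -> (j < col_len a k)%N = (k < nth 0 a j)%N.
Proof.
elim: a j => [|x a IH] j pa; first by rewrite nth_nil.
have pa' : is_partition a by move: pa; rewrite /is_partition => /path_sorted.
have /partitionP H := pa; have -> : col_len (x :: a) k = ((k < x) + col_len a k)%N by [].
case: j => [|j] /=.
  case: (ltnP k x) => [//|le]; rewrite add0n IH //.
  by have := H 0%N; rewrite /=; lia.
case: (ltnP k x) => le; first by rewrite (_ : (true + _)%N = (col_len a k).+1) // ltnS IH.
rewrite (_ : (false + _)%N = col_len a k) // IH //; have /= h0 := partition_le pa (isT : (0 <= j.+1)%N).
have /= h1 := partition_le pa (isT : (0 <= j.+2)%N); lia.
Qed.

Lemma ltn_len a j : is_partition a -> (j < len a)%N = (0 < nth 0 a j)%N.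
Proof. exact: ltn_col_len. Qed.

Lemma len_size a : (len a <= size a)%N.
Proof. exact: count_size. Qed.

Definition fseq w (F : 'I_w -> nat) : seq nat := [seq F i | i <- enum 'I_w].

Lemma size_fseq w (F : 'I_w -> nat) : size (fseq F) = w.
Proof. by rewrite size_map size_enum_ord. Qed.

Lemma nth_fseq w (F : 'I_w -> nat) (j : 'I_w) : nth 0%N (fseq F) j = F j.
Proof. by rewrite (nth_map j) ?size_enum_ord // nth_ord_enum. Qed.

Lemma sumn_fseq w (F : 'I_w -> nat) : sumn (fseq F) = (\sum_j F j)%N.
Proof. by rewrite sumnE big_map big_enum. Qed.

Lemma fseq_nth w a : size a = w -> fseq (fun j : 'I_w => nth 0%N a j) = a.
Proof.
move=> sa; apply: (@eq_from_nth _ 0%N); rewrite size_fseq // => j hj.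
by rewrite -[j]/(val (Ordinal hj)) nth_fseq.
Qed.

Lemma sumn_nth w a : size a = w -> sumn a = (\sum_(j < w) nth 0 a j)%N.
Proof. by move=> sa; rewrite -{1}(fseq_nth sa) sumn_fseq. Qed.

Lemma fseq_partitionPn w (F : 'I_w -> nat) : ~~ is_partition (fseq F) ->
  exists j k : 'I_w, k = j.+1 :> nat /\ (F j < F k)%N.
Proof.
move=> np; suff /existsP[j /existsP[k /andP[/eqP ? ?]]] :
    [exists j : 'I_w, exists k : 'I_w, (k == j.+1 :> nat) && (F j < F k)%N].
  by exists j, k.
apply: contraR np => /existsPn H; apply/partitionP => j.
case: (ltnP j.+1 w) => hj; last by rewrite nth_default ?size_fseq.
have := H (Ordinal (ltnW hj)); move/existsPn/(_ (Ordinal hj)); rewrite eqxx /= -leqNgt.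
by rewrite -[j.+1]/(val (Ordinal hj)) nth_fseq -[j in nth _ _ j]/(val (Ordinal (ltnW hj))) nth_fseq.
Qed.

Definition up w a : seq (seq nat) :=
  [seq b <- [seq fseq (fun j => nth 0 a j + s j)%N | s : {ffun 'I_w -> bool}] | is_partition b].

(** The condition on [s] keeps the subtraction untruncated, so that different [s] give different
    sequences. *)
Definition down w b : seq (seq nat) :=
  [seq c <- [seq fseq (fun j => nth 0 b j - s j)%N
             | s : {ffun 'I_w -> bool} <- enum {ffun 'I_w -> bool} & [forall j, s j <= nth 0 b j]%N] | is_partition c].

Lemma mem_up w a b : (b \in up w a) = [&& size b == w, is_partition b & vstrip w a b].
Proof.
rewrite mem_filter andbCA; congr (_ && _); apply/mapP/andP => [[S _ ->]|[/eqP sb /forallP H]].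
  rewrite size_fseq; split=> //; apply/forallP=> j; rewrite nth_fseq.
  by case: (S j); lia.
exists [ffun j : 'I_w => nth 0 a j < nth 0 b j]%N; first by rewrite mem_enum.
rewrite -{1}(fseq_nth sb); apply: eq_map => j; rewrite ffunE; have := H j; lia.
Qed.

Lemma mem_down w b c : (c \in down w b) = [&& size c == w, is_partition c & vstrip w c b].
Proof.
rewrite mem_filter andbCA; congr (_ && _); apply/mapP/andP => [[S]|[/eqP sc /forallP H]].
  rewrite mem_filter => /andP[/forallP H _] ->.
  rewrite size_fseq; split=> //; apply/forallP=> j; rewrite nth_fseq.
  by have := H j; case: (S j); lia.
exists [ffun j : 'I_w => nth 0 c j < nth 0 b j]%N.
  by rewrite mem_filter mem_enum andbT; apply/forallP=> j; rewrite ffunE; lia.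
rewrite -{1}(fseq_nth sc); apply: eq_map => j; rewrite ffunE; have := H j; lia.
Qed.

Lemma uniq_up w a : uniq (up w a).
Proof.
apply: filter_uniq; rewrite map_inj_uniq ?enum_uniq // => S S' e; apply/ffunP=> j.
have := congr1 (fun s => nth 0%N s j) e; rewrite /= !nth_fseq.
by case: (S j); case: (S' j) => //; lia.
Qed.

Lemma uniq_down w b : uniq (down w b).
Proof.
apply: filter_uniq; rewrite map_inj_in_uniq; first exact: filter_uniq (enum_uniq _).
move=> S S'.
rewrite !mem_filter => /andP[/forallP H _] /andP[/forallP H' _] e; apply/ffunP=> j.
have := congr1 (fun s => nth 0%N s j) e; rewrite /= !nth_fseq.
by have := H j; have := H' j; case: (S j); case: (S' j) => //; lia.
Qed.

Lemma big_up (R : nmodType) w a (F : seq nat -> R) :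
  \sum_(b <- up w a) F b =
  \sum_(S : {ffun 'I_w -> bool})
     let b := fseq (fun j => nth 0 a j + S j)%N in if is_partition b then F b else 0.
Proof. by rewrite big_filter big_map big_enum_cond big_mkcond. Qed.

Lemma big_down (R : nmodType) w b (F : seq nat -> R) :
  \sum_(c <- down w b) F c =
  \sum_(S : {ffun 'I_w -> bool})
     let c := fseq (fun j => nth 0 b j - S j)%N in
     if [forall j, S j <= nth 0 b j]%N && is_partition c then F c else 0.
Proof.
rewrite big_filter big_map big_filter_cond big_enum_cond big_mkcond; apply: eq_bigr => S _.
by rewrite inE.
Qed.

(* The exponents of the alternant of a; the offset o is 0 for the alternants in
   [csum] and 1 for those in [cdiff]. *)
Definition shv o w a (j : 'I_w) : nat := (nth 0 a j + (w - j.+1) + o)%N.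

Variable R : comNzRingType.

(** If [S] does not give a partition, some row grows while the equal row above it does not; the two
    exponents then collide and the alternant vanishes. *)
Lemma alt_up o w a x (h : 'I_w -> nat -> R) : size a = w -> is_partition a ->
  \sum_(S : {ffun 'I_w -> bool}) x ^+ (\sum_j S j) * alt h (fun j => shv o a j + S j)%N =
  \sum_(b <- up w a) x ^+ (sumn b - sumn a) * alt h (shv o b).
Proof.
move=> sa /partitionP pa; rewrite big_up; apply: eq_bigr => S _ /=.
case: ifPn => [pb|/fseq_partitionPn[j [k [kj lt]]]].
  rewrite sumn_fseq big_split /= -(sumn_nth sa) addKn; congr (_ * _).
  by apply: eq_alt => i j; rewrite /shv nth_fseq; congr (h i _); lia.
rewrite (@alt_eq0 _ _ _ _ j k) ?mulr0 //; first by apply/eqP => e; move: kj; rewrite e; lia.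
rewrite /shv; have := pa j; rewrite -kj; have := ltn_ord k; move: lt.
by case: (S j); case: (S k); lia.
Qed.

(** Removals that do not leave a partition contribute 0: either two adjacent exponents collide, or a
    cell is taken from an empty last row. The latter has coefficient 0 when [o = 0], and meets the
    vanishing column [f i o.-1] when [o > 0]. *)
Lemma alt_down_strip o w b x (f h : 'I_w -> nat -> R) : size b = w -> is_partition b ->
  (forall i (j : 'I_w), h i (shv o b j) = f i (shv o b j) +
      (if shv o b j == 0%N then 0 else x) * f i (shv o b j).-1) ->
  ((0 < o)%N -> forall i, f i o.-1 = 0) ->
  alt h (shv o b) = \sum_(c <- down w b) x ^+ (sumn b - sumn c) * alt f (shv o c).
Proof.
move=> sb /partitionP pb Hh Ho; rewrite (alt_down Hh) big_down; apply: eq_bigr => S _ /=.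
(* Row [j] loses a cell while the next row has the same length and loses none; after the last row,
   [nth] supplies a row of length 0. *)
pose B (j : 'I_w) := [&& S j, nth 0 b j.+1 == nth 0 b j &
                       ~~ [exists k : 'I_w, (k == j.+1 :> nat) && S k]]%N.
case: ifPn => [/andP[/forallP HS pc]|nv].
  have -> : \prod_(j | S j) (if shv o b j == 0%N then 0 else x) = x ^+ (\sum_j S j).
    rewrite -prodrXr [RHS](bigID S) /= [X in _ * X]big1 ?mulr1.
      apply: eq_bigr => j Sj; rewrite Sj expr1; case: eqP => // /eqP.
      by rewrite /shv; have := HS j; rewrite Sj; lia.
    by move=> j /negbTE->; rewrite expr0.
  congr (x ^+ _ * _).
    apply/esym/eqP; rewrite sumn_fseq -(eqn_add2r (\sum_(j < w) (nth 0 b j - S j))) subnK.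
      rewrite (sumn_nth sb) -big_split /=; apply/eqP; apply: eq_bigr => j _.
      by rewrite subnKC.
    by rewrite (sumn_nth sb) leq_sum // => j _; rewrite leq_subr.
  by apply: eq_alt => i j; rewrite /shv nth_fseq; congr (f i _); have := HS j; lia.
have /existsP[j /and3P[Sj /eqP bj nS]] : [exists j, B j].
  apply: contraR nv => /existsPn NB.
  have HS j : (S j <= nth 0 b j)%N.
    (* Without a [B], a cell taken from an empty row forces one to be taken from the next row, which
       is empty too, and so on past the last row. *)
    elim: {j}_.+1 {-2}j (ltnSn (w - j)) => // d IH j hd.
    case Sj: (S j) => //; rewrite lt0n; apply/eqP => bj.
    have := NB j; rewrite /B Sj /= negb_and bj; have := pb j; rewrite bj leqn0 => /eqP bj1.
    rewrite bj1 eqxx /= negbK => /existsP[k /andP[/eqP kj Sk]].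
    by have := IH k; rewrite Sk kj bj1; have := ltn_ord k; lia.
  apply/andP; split; first exact/forallP.
  apply: contraT => /fseq_partitionPn[j [k [kj lt]]].
  have := pb j; rewrite -kj => le; have := NB j; rewrite /B -kj.
  have Sj : S j by move: lt; case: (S j); case: (S k); lia.
  have Sk : S k = false by move: lt; case: (S j); case: (S k); lia.
  rewrite Sj /=; have -> /= : (nth 0 b k == nth 0 b j)%N by move: lt; rewrite Sj Sk; lia.
  rewrite negbK => /existsP[k' /andP[/eqP ek Sk']].
  by have ekk : k' = k; [apply: val_inj | rewrite ekk Sk in Sk'].
case: (ltnP j.+1 w) => hj.
  rewrite (@alt_eq0 _ _ _ _ j (Ordinal hj)) ?mulr0 //.
    by apply/eqP=> /(congr1 val) /=; lia.
  move/existsPn: nS => /(_ (Ordinal hj)); rewrite eqxx /= => /negbTE->.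
  by rewrite /shv Sj /= bj; lia.
have b0 : nth 0%N b j = 0%N by rewrite -bj nth_default // sb.
case: (posnP o) => [o0|o0].
  by rewrite (bigD1 j) //= /shv b0 (_ : _ == _) ?mul0r //; lia.
rewrite (@alt_col0 _ _ _ _ j) ?mulr0 // => i.
by rewrite /shv b0 Sj (_ : _ - _ = o.-1)%N ?Ho //; lia.
Qed.

End Strips.

Lemma det_col_linear (R : comNzRingType) w (k : 'I_w) (F G H : 'I_w -> 'I_w -> R) b c :
  (forall i, F i k = b * G i k + c * H i k) ->
  (forall i j, j != k -> G i j = F i j) -> (forall i j, j != k -> H i j = F i j) ->
  \det (\matrix_(i, j) F i j) = b * \det (\matrix_(i, j) G i j) + c * \det (\matrix_(i, j) H i j).
Proof.
move=> e eG eH; rewrite -(det_tr (\matrix_(i, j) F i j)) -(det_tr (\matrix_(i, j) G i j)).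
rewrite -(det_tr (\matrix_(i, j) H i j)); apply: (@determinant_multilinear _ _ _ _ _ k).
- by apply/rowP=> i; rewrite !mxE.
- by apply/matrixP=> i j; rewrite !mxE eG // eq_sym neq_lift.
- by apply/matrixP=> i j; rewrite !mxE eH // eq_sym neq_lift.
Qed.

(** * Length peaks *)

Definition inc (b : seq nat) : seq nat := set_nth 0%N b (len b) 1%N.
(** Inverts [inc] only on partitions whose last nonzero row is a single cell. *)
Definition dec (b : seq nat) : seq nat := set_nth 0%N b (len b).-1 0%N.
Definition peak (a b c : seq nat) : bool := (len a < len b)%N && (len c < len b)%N.
Definition full_rise w (a b c : seq nat) : bool :=
  [&& len a < len b, len b == len c & len c == w]%N.
Definition wt (R : comNzRingType) (x : R) (a b c : seq nat) : R :=
  x ^+ (2 * sumn b - sumn a - sumn c).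

Section Peaks.
Implicit Types (w : nat) (a b c : seq nat).

Lemma leq_len a b : is_partition a -> is_partition b ->
  (forall j, 0 < nth 0 a j -> 0 < nth 0 b j)%N -> (len a <= len b)%N.
Proof.
move=> pa pb H; case: (posnP (len a)) => [-> //|la].
rewrite -(prednK la) ltn_len // H // -ltn_len //; lia.
Qed.

Lemma vstripP w a b : size a = w -> size b = w ->
  reflect (forall j, nth 0 a j <= nth 0 b j <= (nth 0 a j).+1)%N (vstrip w a b).
Proof.
move=> sa sb; apply: (iffP forallP) => H j; last exact: H.
case: (ltnP j w) => hj; first exact: (H (Ordinal hj)).
by rewrite !nth_default ?sa ?sb.
Qed.

Lemma vstrip_len w a b : size a = w -> size b = w -> is_partition a -> is_partition b ->
  vstrip w a b -> (len a <= len b)%N.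
Proof.
by move=> sa sb pa pb /(vstripP sa sb) H; apply: leq_len => // j; have := H j; lia.
Qed.

Lemma vstrip_sumn w a b : size a = w -> size b = w -> vstrip w a b -> (sumn a <= sumn b)%N.
Proof.
move=> sa sb /forallP H; rewrite (sumn_nth sa) (sumn_nth sb); apply: leq_sum => j _.
by have := H j; lia.
Qed.

Lemma nth_len b : is_partition b -> nth 0%N b (len b) = 0%N.
Proof. by move=> pb; have := ltn_len (len b) pb; rewrite ltnn; lia. Qed.

Lemma nth_inc b j : nth 0%N (inc b) j = if j == len b then 1%N else nth 0%N b j.
Proof. by rewrite nth_set_nth. Qed.

Lemma nth_dec b j : nth 0%N (dec b) j = if j == (len b).-1 then 0%N else nth 0%N b j.
Proof. by rewrite nth_set_nth. Qed.

Lemma size_inc w b : size b = w -> (len b < w)%N -> size (inc b) = w.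
Proof. by move=> <- /maxn_idPr; rewrite size_set_nth. Qed.

Lemma size_dec b : (0 < len b)%N -> size (dec b) = size b.
Proof.
by move=> h; rewrite size_set_nth; apply/maxn_idPr; rewrite prednK // len_size.
Qed.

Lemma partition_inc b : is_partition b -> is_partition (inc b).
Proof.
move=> pb; apply/partitionP=> j; rewrite !nth_inc; have /partitionP/(_ j) := pb.
have := ltn_len j pb; have := ltn_len j.+1 pb; have := nth_len pb.
by case: eqP => [->|]; case: eqP; lia.
Qed.

Lemma len_inc b : is_partition b -> len (inc b) = (len b).+1.
Proof.
move=> pb; have pi := partition_inc pb; apply/eqP; rewrite eqn_leq ltn_len // nth_inc eqxx andbT.
by rewrite leqNgt ltn_len // nth_inc gtn_eqF // -ltn_len // ltnNge leqnSn.
Qed.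

Lemma sumn_inc w b : size b = w -> is_partition b -> (len b < w)%N -> sumn (inc b) = (sumn b).+1.
Proof.
move=> sb pb h; rewrite (sumn_nth (size_inc sb h)) (sumn_nth sb) (bigD1 (Ordinal h)) //=.
rewrite nth_inc eqxx [in RHS](bigD1 (Ordinal h)) //= nth_len // add1n add0n; congr _.+1.
apply: eq_bigr => j /negbTE hj; rewrite nth_inc; case: eqP => // e.
by move: hj; rewrite -val_eqE /= e eqxx.
Qed.

(** A middle partition longer than [a] ends in a single cell, in a row where [a] is empty; removing
    this cell leaves a vertical strip over [a]. [Q] carries a side condition on the shorter
    length. *)
Lemma perm_up_inc w a (Q : pred nat) : size a = w -> is_partition a ->
  perm_eq [seq inc b | b <- up w a & (len b < w)%N && Q (len b)]
          [seq b <- up w a | (len a < len b)%N && Q (len b).-1].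
Proof.
move=> sa pa; apply: uniq_perm; last 1 first.
- move=> b; apply/mapP/idP => [[b0] | ].
    rewrite mem_filter mem_up => /and3P[/andP[h Qb] /eqP sb /andP[pb vs]] ->.
    rewrite mem_filter len_inc // ltnS (vstrip_len sa sb) // Qb mem_up (size_inc sb h) eqxx.
    rewrite partition_inc //=; apply/(vstripP sa (size_inc sb h)) => j.
    have := vstripP sa sb vs j; rewrite nth_inc; have := nth_len pb.
    by case: eqP => [->|]; lia.
  rewrite mem_filter mem_up => /and3P[/andP[h Qb] /eqP sb /andP[pb vs]].
  have lb : (0 < len b)%N by lia.
  have V := vstripP sa sb vs.
  have a0 : nth 0%N a (len b).-1 = 0%N by have := ltn_len (len b).-1 pa; lia.
  have b1 : nth 0%N b (len b).-1 = 1%N.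
    by have := ltn_len (len b).-1 pb; have := V (len b).-1; rewrite a0; lia.
  have pd : is_partition (dec b).
    apply/partitionP=> j; rewrite !nth_dec; have /partitionP/(_ j) := pb.
    by have := ltn_len j.+1 pb; case: eqP; case: eqP; lia.
  have ld : len (dec b) = (len b).-1.
    apply/eqP; rewrite eqn_leq; apply/andP; split.
      by rewrite leqNgt ltn_len // nth_dec eqxx.
    case: (posnP (len b).-1) => [-> //|h1]; rewrite -{1}(prednK h1) ltn_len // nth_dec.
    by rewrite ltn_eqF ?prednK // -ltn_len //; lia.
  exists (dec b).
    rewrite mem_filter ld Qb mem_up size_dec // sb eqxx pd /= !andbT; apply/andP; split.
      by have := len_size b; rewrite sb; lia.
    apply/(vstripP sa); rewrite ?size_dec // => j; rewrite nth_dec; have := V j.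
    by case: eqP => [->|]; lia.
  apply: (@eq_from_nth _ 0%N) => [|j _].
    by rewrite (size_inc (w := w)) ?size_dec // ld; have := len_size b; rewrite sb; lia.
  by rewrite nth_inc nth_dec ld; case: eqP => [->|].
- rewrite map_inj_in_uniq; first exact: filter_uniq (uniq_up _ _).
  move=> b c.
  rewrite mem_filter => /andP[_]; rewrite mem_up => /and3P[/eqP sb pb _].
  rewrite mem_filter => /andP[_]; rewrite mem_up => /and3P[/eqP sc pc _] e.
  have l : len b = len c by have := congr1 len e; rewrite !len_inc // => -[].
  apply: (@eq_from_nth _ 0%N) => [|j _]; first by rewrite sb sc.
  have := congr1 (fun s => nth 0%N s j) e; rewrite !nth_inc l; case: eqP => // -> _.
  by rewrite -{1}l !nth_len.
- exact: filter_uniq (uniq_up _ _).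
Qed.

(** A partition contained in [inc b] and no longer than [b] misses the added cell. *)
Lemma perm_down_inc w b : size b = w -> is_partition b -> (len b < w)%N ->
  perm_eq (down w b) [seq c <- down w (inc b) | (len c <= len b)%N].
Proof.
move=> sb pb h; apply: uniq_perm; [exact: uniq_down | exact: filter_uniq (uniq_down _ _) | move=> c].
rewrite [RHS]mem_filter !mem_down; case: (size c =P w) => //= sc; last by rewrite andbF.
case pc: (is_partition c) => //=; last by rewrite andbF.
have si := size_inc sb h; have b0 := nth_len pb.
apply/idP/andP => [vs|[l vs]].
  split; first exact: (vstrip_len sc sb).
  apply/(vstripP sc si) => j; have := vstripP sc sb vs j; rewrite nth_inc.
  by case: eqP => [->|]; lia.
apply/(vstripP sc sb) => j; have := vstripP sc si vs j; rewrite nth_inc.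
have := ltn_len j pc; case: eqP => [->|]; lia.
Qed.

Variable R : comNzRingType.

Lemma wt_split w a b c (x : R) : size a = w -> b \in up w a -> c \in down w b ->
  wt x a b c = x ^+ (sumn b - sumn a) * x ^+ (sumn b - sumn c).
Proof.
rewrite mem_up mem_down => sa /and3P[/eqP sb _ v1] /and3P[/eqP sc _ v2].
have h1 := vstrip_sumn sa sb v1; have h2 := vstrip_sumn sc sb v2.
by rewrite /wt -exprD; congr (_ ^+ _); lia.
Qed.

(* Adding a cell below the last row of b, while keeping a and c, makes b a
   length peak, and every length peak arises in this way exactly once. *)
Lemma sum_peaks w a (L : nat) (x : R) (G : seq nat -> R) :
  size a = w -> is_partition a -> (L <= w)%N ->
  \sum_(b <- up w a) \sum_(c <- down w b) (len b < L)%N%:R * (x ^+ 2 * wt x a b c) * G c =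
  \sum_(b <- up w a) \sum_(c <- down w b) (peak a b c && (len b <= L)%N)%:R * wt x a b c * G c.
Proof.
move=> sa pa Lw.
(* [P] restricts the middle partition and [Q] the last one, which brings both sides to the filtered
   lists matched by [perm_up_inc] and [perm_down_inc]. *)
have E (P : pred (seq nat)) (Q : seq nat -> pred (seq nat)) (F : seq nat -> seq nat -> R) :
  (\sum_(b <- up w a) \sum_(c <- down w b) (P b && Q b c)%:R * F b c) =
  \sum_(b <- [seq b <- up w a | P b]) \sum_(c <- down w b | Q b c) F b c.
  rewrite [RHS]big_filter [RHS]big_mkcond; apply: eq_bigr => b _; case: (P b) => /=.
    by rewrite [RHS]big_mkcond; apply: eq_bigr => c _; case: (Q b c); rewrite ?mul1r ?mul0r.
  by rewrite big1 // => c _; rewrite mul0r.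
transitivity (\sum_(b <- up w a) \sum_(c <- down w b)
    (((len b < w)%N && (len b < L)%N) && true)%:R * (x ^+ 2 * wt x a b c * G c)).
  apply: eq_bigr => b _; apply: eq_bigr => c _; rewrite -mulrA; congr (_%:R * _).
  by congr nat_of_bool; lia.
transitivity (\sum_(b <- up w a) \sum_(c <- down w b)
    (((len a < len b)%N && ((len b).-1 < L)%N) && (len c <= (len b).-1)%N)%:R * (wt x a b c * G c));
  last first.
  apply: eq_bigr => b _; apply: eq_bigr => c _; rewrite -mulrA; congr (_%:R * _).
  by congr nat_of_bool; rewrite /peak; lia.
rewrite (E (fun b => (len b < w)%N && (len b < L)%N) (fun _ _ => true)).
rewrite (E (fun b => (len a < len b)%N && ((len b).-1 < L)%N) (fun b c => len c <= (len b).-1)%N).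
rewrite -(perm_big _ (perm_up_inc (fun l => (l < L)%N) sa pa)) /= big_map.
rewrite big_seq [RHS]big_seq; apply: eq_bigr => b; rewrite mem_filter => /andP[/andP[h hL] bu].
have := bu; rewrite mem_up => /and3P[/eqP sb pb vs].
rewrite len_inc //= -[RHS]big_filter -[RHS](perm_big _ (perm_down_inc sb pb h)).
apply: eq_big_seq => c cd; congr (_ * _).
move: cd; rewrite mem_down => /and3P[/eqP sc _ v2].
have h1 := vstrip_sumn sa sb vs; have h2 := vstrip_sumn sc sb v2.
(* The middle size enters the exponent twice, so the added cell accounts for [x ^+ 2]. *)
by rewrite /wt (sumn_inc sb) // -exprD; congr (_ ^+ _); lia.
Qed.

End Peaks.

(** * One-step kernels for the two families of orthogonal alternants *)

Section Kernels.
Variable K : fieldType.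
Implicit Types (x : K) (a b c : seq nat).

(** Up to a factor, [alt (csum y)] at shift 0 is the numerator of a character of [O(2w)], and
    [alt (cdiff y)] at shift 1 that of a character of [Sp(2w)]. The symplectic characters are the
    values of orthogonal characters on the second component of [O(2w+2)]. *)
Definition csum w (y : 'I_w -> K) (i : 'I_w) (v : nat) : K := y i ^+ v + (y i)^-1 ^+ v.
Definition cdiff w (y : 'I_w -> K) (i : 'I_w) (v : nat) : K := y i ^+ v - (y i)^-1 ^+ v.
Definition efac w (y : 'I_w -> K) x : K := \prod_i ((1 + x * y i) * (1 + x / y i)).

Definition kplus w x a b c : K :=
  (1 - (peak a b c && (len b < w)%N)%:R + (full_rise w a b c)%:R) * wt x a b c.
Definition kminus w x a b c : K := ((len b < w)%N%:R - (peak a b c)%:R) * wt x a b c.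

(** [csum] is even in the exponent, so at [v = 0] the lowered exponent is reflected to 1. This
    boundary term is the source of the corrections in [kplus]. *)
Lemma csum_mul w (y : 'I_w -> K) x i v : y i != 0 ->
  (1 + x * y i) * (1 + x / y i) * csum y i v =
  (csum y i v + x * csum y i (if v == 0%N then 1%N else v.-1)) +
  x * (csum y i v.+1 + x * csum y i v).
Proof.
move=> y0; rewrite /csum; set z := (y i)^-1; have yz : y i * z - 1 = 0 by rewrite divff ?subrr.
case: v => [|v] /=; rewrite ?exprS ?expr0.
  apply/eqP; rewrite -subr_eq0; apply/eqP; transitivity ((y i * z - 1) * (x ^+ 2 *+ 2)).
    by ring.
  by rewrite yz mul0r.
apply/eqP; rewrite -subr_eq0; apply/eqP.
transitivity ((y i * z - 1) * (x * (y i ^+ v + z ^+ v) + x ^+ 2 * (y i * y i ^+ v + z * z ^+ v))).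
  by ring.
by rewrite yz mul0r.
Qed.

(** [cdiff] vanishes at exponent 0, so no reflection occurs when exponents start at 1. *)
Lemma cdiff_mul w (y : 'I_w -> K) x i v : y i != 0 ->
  (1 + x * y i) * (1 + x / y i) * cdiff y i v.+1 =
  (cdiff y i v.+1 + x * cdiff y i v) + x * (cdiff y i v.+2 + x * cdiff y i v.+1).
Proof.
move=> y0; rewrite /cdiff; set z := (y i)^-1; have yz : y i * z - 1 = 0 by rewrite divff ?subrr.
apply/eqP; rewrite -subr_eq0; apply/eqP; rewrite !exprS.
transitivity ((y i * z - 1) * (x * (y i ^+ v - z ^+ v) + x ^+ 2 * (y i * y i ^+ v - z * z ^+ v))).
  by ring.
by rewrite yz mul0r.
Qed.

Lemma shv0_gt0 w b (j : 'I_w) : is_partition b -> (j.+1 < w)%N || (len b == w) -> (0 < shv 0 b j)%N.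
Proof.
move=> pb /orP[|/eqP l]; rewrite /shv; first by lia.
by have := ltn_len j pb; rewrite l ltn_ord; lia.
Qed.

Section PlusStep.
Variables (w : nat) (y : 'I_w -> K) (x : K) (b : seq nat).
Hypotheses (sb : size b = w) (pb : is_partition b).
Let f := csum y.
(** [h] reflects the exponent at 0 and [h0] drops it. They differ only at [u = 0], which occurs only
    in the last column and only if the last row is empty. *)
Let h i u : K := f i u + x * f i (if u == 0%N then 1%N else u.-1).
Let h0 i u : K := f i u + (if u == 0%N then 0 else x) * f i u.-1.
Let G (g : seq nat -> K) d := \sum_(c <- down w d) x ^+ (sumn d - sumn c) * g c.

Let hh0 i u : (0 < u)%N -> h i u = h0 i u.
Proof. by rewrite /h /h0; case: u. Qed.

Let alt_h0 : alt h0 (shv 0 b) = G (fun c => alt f (shv 0 c)) b.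
Proof. by apply: alt_down_strip. Qed.

(* With two empty rows the last two columns are h(1) and h(0), and
   h(0) = (1 - x^2) f(0) + x h(1). With one empty row the extra term x f(1) of h(0)
   is a term of [inc b]. *)
Lemma alt_plus_step :
  alt h (shv 0 b) = (1 - (len b < w.-1)%N%:R * x ^+ 2) * G (fun c => alt f (shv 0 c)) b +
    ((len b < w) && (len b == w.-1))%N%:R *
      (x * G (fun c => (len c == w)%:R * alt f (shv 0 c)) (inc b)).
Proof.
have lb : (len b <= w)%N by rewrite -sb len_size.
rewrite -alt_h0; case: (ltngtP (len b) w) lb => // [lt|e] _; last first.
  rewrite /= mul0r addr0 (_ : _ < _ = false)%N ?mul0r ?subr0 ?mul1r; last by lia.
  by apply: eq_alt => i j; rewrite hh0 // shv0_gt0 // e eqxx orbT.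
have hw : (w.-1 < w)%N by lia.
pose k := Ordinal hw.
have bk : shv 0 b k = 0%N.
  by rewrite /shv /=; have := ltn_len w.-1 pb; lia.
have nk j : j != k -> (0 < shv 0 b j)%N.
  move=> jk; apply: shv0_gt0 => //; have := ltn_ord j; move: jk; rewrite -val_eqE /=; lia.
case: (ltngtP (len b) w.-1) => [l|?|l]; last 2 first.
- by exfalso; lia.
- have -> : alt h (shv 0 b) = 1 * alt h0 (shv 0 b) +
      x * \det (\matrix_(i, j) if j == k then f i 1%N else h i (shv 0 b j)).
    rewrite /alt -(@det_col_linear _ _ k (fun i j => h i (shv 0 b j))
        (fun i j => h0 i (shv 0 b j)) (fun i j => if j == k then f i 1%N else h i (shv 0 b j))) //.
    + by move=> i; rewrite bk eqxx /h /h0 /= mul0r addr0 mul1r.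
    + by move=> i j jk; rewrite hh0 // nk.
    + by move=> i j /negbTE->.
  rewrite mul0r subr0 /= !mul1r; congr (_ + x * _).
  (* The determinant with last column [f i 1] is a down-step from [inc b] for the functions [f1]. As
     [f1] kills exponent 0, only partitions [c] without an empty row survive. *)
  pose f1 i u : K := if u == 0%N then 0 else f i u.
  pose h1 i u : K := f1 i u + (if u == 0%N then 0 else x) * f1 i u.-1.
  have si := size_inc sb lt; have pi := partition_inc pb.
  have sk : shv 0 (inc b) k = 1%N by rewrite /shv nth_inc /= l eqxx; lia.
  transitivity (alt h1 (shv 0 (inc b))).
    rewrite /alt; congr (\det _); apply/matrixP=> i j; rewrite !mxE; case: eqP => [->|/eqP jk].
      by rewrite sk /h1 /f1 /= mulr0 addr0.
    have -> : shv 0 (inc b) j = shv 0 b j.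
      rewrite /shv nth_inc; case: eqP => // e; move/eqP: jk; case; apply: val_inj.
      by rewrite /= e l.
    have : (1 < shv 0 b j)%N.
      have /= := ltn_len j pb; have := ltn_ord j; move: jk.
      by rewrite /shv -val_eqE /=; lia.
    by rewrite /h /h1 /f1; case: (shv 0 b j) => [|[|u]].
  rewrite (@alt_down_strip _ 0 w (inc b) x f1 h1) //; apply: eq_big_seq => c.
  rewrite mem_down => /and3P[/eqP sc pc _]; congr (_ * _).
  have /= := ltn_len w.-1 pc; have := len_size c; have [l1|l1] := eqVneq (len c) w.
    move=> _ _; rewrite mul1r; apply: eq_alt => i j; rewrite /f1 gtn_eqF //.
    by rewrite shv0_gt0 // l1 eqxx orbT.
  move=> l2 l3; rewrite mul0r (@alt_col0 _ _ _ _ k) // => i.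
  rewrite /f1 (_ : shv 0 c k = 0%N) //= /shv /=.
  by rewrite sc in l2; lia.
- rewrite andbF mul0r addr0.
  have -> : alt h (shv 0 b) = (1 - x ^+ 2) * alt h0 (shv 0 b) +
      x * \det (\matrix_(i, j) if j == k then h i 1%N else h i (shv 0 b j)).
    rewrite /alt -(@det_col_linear _ _ k (fun i j => h i (shv 0 b j))
        (fun i j => h0 i (shv 0 b j)) (fun i j => if j == k then h i 1%N else h i (shv 0 b j))) //.
    + by move=> i; rewrite bk eqxx /h /h0 /=; ring.
    + by move=> i j jk; rewrite hh0 // nk.
    + by move=> i j /negbTE->.
  have hk : (w.-2 < w)%N by lia.
  (* Row [w.-2] is empty too, so its column is also [h i 1]. *)
  rewrite -det_tr (@determinant_alternate _ _ _ k (Ordinal hk)); last 2 first.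
  + by rewrite -val_eqE /=; lia.
  + move=> i; rewrite !mxE eqxx -val_eqE /= ifF; last by lia.
    congr (h i _); rewrite /shv /=; have := ltn_len w.-2 pb; lia.
  by rewrite mulr0 addr0 mul1r.
Qed.

End PlusStep.

(** [efac] raises and then lowers exponents. Of the two corrections in [alt_plus_step], the [x ^+ 2]
    terms become non-full peaks by [sum_peaks] with bound [w.-1], and the [inc b] terms become full
    rises once [inc b] is taken as the middle partition. *)
Lemma plus_kernel w (y : 'I_w -> K) x a :
  (forall i, y i != 0) -> size a = w -> is_partition a ->
  efac y x * alt (csum y) (shv 0 a) =
  \sum_(b <- up w a) \sum_(c <- down w b) kplus w x a b c * alt (csum y) (shv 0 c).
Proof.
move=> y0 sa pa; set A := fun c => alt (csum y) (shv 0 c).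
rewrite /efac (alt_pieri (x := x) (h := fun i u =>
   csum y i u + x * csum y i (if u == 0%N then 1%N else u.-1))); last first.
  by move=> i j; rewrite csum_mul.
rewrite alt_up //.
transitivity (\sum_(b <- up w a) \sum_(c <- down w b) wt x a b c * A c
   - \sum_(b <- up w a) \sum_(c <- down w b) (len b < w.-1)%N%:R * (x ^+ 2 * wt x a b c) * A c
   + \sum_(b <- up w a | (len b < w)%N && (len b == w.-1)) x ^+ (sumn (inc b) - sumn a) *
     \sum_(c <- down w (inc b)) x ^+ (sumn (inc b) - sumn c) * ((len c == w)%:R * A c)).
  rewrite -sumrB [X in _ + X]big_mkcond -big_split /=; apply: eq_big_seq => b bu.
  have := bu; rewrite mem_up => /and3P[/eqP sb pb vs].
  rewrite (alt_plus_step y x sb pb) mulrDr; congr (_ + _).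
    rewrite -sumrB [X in _ * (_ * X)](_ : _ = \sum_(c <- down w b) x ^+ (sumn b - sumn c) * A c) //.
    rewrite !mulr_sumr; apply: eq_big_seq => c cd.
    by rewrite (wt_split x sa bu cd); ring.
  case: ifP => [/andP[h _]|_]; last by rewrite mul0r mulr0.
  rewrite (sumn_inc sb pb h) mul1r mulrA -exprSr; congr (_ ^+ _ * _).
  by have := vstrip_sumn sa sb vs; lia.
rewrite sum_peaks //; last exact: leq_pred.
pose Phi b := x ^+ (sumn b - sumn a) *
     \sum_(c <- down w b) x ^+ (sumn b - sumn c) * ((len c == w)%:R * A c).
have -> : \sum_(b <- up w a | (len b < w)%N && (len b == w.-1)) Phi (inc b) =
    \sum_(b <- up w a) if (len a < len b)%N && ((len b).-1 == w.-1) then Phi b else 0.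
  rewrite -[LHS]big_filter -(big_map inc predT Phi).
  by rewrite (perm_big _ (perm_up_inc (fun l => l == w.-1) sa pa)) [LHS]big_filter big_mkcond.
rewrite -sumrB -big_split /=; apply: eq_big_seq => b bu.
have := bu; rewrite mem_up => /and3P[/eqP sb pb vs].
have -> : (if (len a < len b)%N && ((len b).-1 == w.-1) then Phi b else 0) =
   \sum_(c <- down w b) (full_rise w a b c)%:R * wt x a b c * A c.
  case: ifPn => h.
    rewrite /Phi mulr_sumr; apply: eq_big_seq => c cd; rewrite (wt_split x sa bu cd).
    move: cd; rewrite mem_down => /and3P[/eqP sc pc v2].
    have l1 := vstrip_len sc sb pc pb v2; have := len_size b; rewrite sb => l2.
    have -> : full_rise w a b c = (len c == w) by rewrite /full_rise; lia.
    by ring.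
  rewrite big1_seq // => c /andP[_]; rewrite mem_down => /and3P[/eqP sc pc v2].
  have -> : full_rise w a b c = false by rewrite /full_rise; lia.
  by rewrite !mul0r.
rewrite -sumrB -big_split /=; apply: eq_bigr => c _; rewrite /kplus.
have -> : peak a b c && (len b <= w.-1)%N = peak a b c && (len b < w)%N by rewrite /peak; lia.
by rewrite -/(A c); ring.
Qed.

Lemma minus_kernel w (y : 'I_w -> K) x a :
  (forall i, y i != 0) -> size a = w -> is_partition a ->
  efac y x * alt (cdiff y) (shv 1 a) =
  \sum_(b <- up w a) \sum_(c <- down w b) wt x a b c * alt (cdiff y) (shv 1 c).
Proof.
move=> y0 sa pa.
rewrite /efac (alt_pieri (x := x) (h := fun i u => cdiff y i u + x * cdiff y i u.-1)); last first.
  by move=> i j; rewrite /shv addn1 cdiff_mul.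
rewrite alt_up //; apply: eq_big_seq => b bu.
have := bu; rewrite mem_up => /and3P[/eqP sb pb _].
rewrite (@alt_down_strip _ 1 w b x (cdiff y)) //.
- rewrite mulr_sumr; apply: eq_big_seq => c cd.
  by rewrite (wt_split x sa bu cd) mulrA.
- by move=> i j; rewrite (_ : (shv 1 b j == 0%N) = false) // /shv addn1.
- by move=> _ i; rewrite /cdiff !expr0 subrr.
Qed.

Lemma nth_rcons0 a j : nth 0%N (rcons a 0%N) j = nth 0%N a j.
Proof. by rewrite nth_rcons; case: ltnP => // h; rewrite (nth_default _ h) if_same. Qed.

Lemma partition_rcons0 a : is_partition (rcons a 0%N) = is_partition a.
Proof. by apply/partitionP/partitionP => H j; have := H j; rewrite !nth_rcons0. Qed.

Lemma len_rcons0 a : len (rcons a 0%N) = len a.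
Proof. by rewrite /len -cats1 count_cat addn0. Qed.

Lemma sumn_rcons0 a : sumn (rcons a 0%N) = sumn a.
Proof. by rewrite sumn_rcons addn0. Qed.

Lemma vstrip_rcons0 w a b : size a = w -> size b = w ->
  vstrip w.+1 (rcons a 0%N) (rcons b 0%N) = vstrip w a b.
Proof.
move=> sa sb; apply/(vstripP (w := w.+1))/(vstripP sa sb); rewrite ?size_rcons ?sa ?sb // => H j.
  by have := H j; rewrite !nth_rcons0.
by rewrite !nth_rcons0.
Qed.

Lemma rcons0P w b : size b = w.+1 -> is_partition b -> (len b < w.+1)%N ->
  exists2 b', b = rcons b' 0%N & size b' = w.
Proof.
move=> sb pb lb; have : nth 0%N b w = 0%N by have := ltn_len w pb; lia.
case/lastP: b sb {pb lb} => // b' z; rewrite size_rcons => -[sb].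
by rewrite nth_rcons sb ltnn eqxx => ->; exists b'.
Qed.

Lemma perm_up_rcons0 w a : size a = w ->
  perm_eq [seq rcons b 0%N | b <- up w a] [seq b <- up w.+1 (rcons a 0%N) | (len b < w.+1)%N].
Proof.
move=> sa; apply: uniq_perm.
- by rewrite map_inj_uniq ?uniq_up // => b c /rcons_inj[].
- exact: filter_uniq (uniq_up _ _).
move=> b; rewrite [RHS]mem_filter; apply/mapP/andP => [[b' bu ->]|[lb]].
  move: bu; rewrite !mem_up size_rcons partition_rcons0 => /and3P[/eqP sb -> vs].
  by rewrite vstrip_rcons0 // vs sb eqxx len_rcons0 ltnS -sb len_size.
rewrite mem_up => /and3P[/eqP sb pb vs]; have [b' eb sb'] := rcons0P sb pb lb.
exists b' => //; move: pb vs; rewrite eb partition_rcons0 vstrip_rcons0 // mem_up sb' eqxx.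
by move=> -> ->.
Qed.

Lemma perm_down_rcons0 w b : size b = w ->
  perm_eq [seq rcons c 0%N | c <- down w b] (down w.+1 (rcons b 0%N)).
Proof.
move=> sb; apply: uniq_perm.
- by rewrite map_inj_uniq ?uniq_down // => c d /rcons_inj[].
- exact: uniq_down.
move=> c; apply/mapP/idP => [[c' cd ->]|].
  move: cd; rewrite !mem_down size_rcons partition_rcons0 => /and3P[/eqP sc -> vs].
  by rewrite vstrip_rcons0 // vs sc eqxx.
rewrite mem_down => /and3P[/eqP sc pc vs].
have sb1 : size (rcons b 0%N) = w.+1 by rewrite size_rcons sb.
have lc : (len c < w.+1)%N.
  rewrite ltnNge; apply/negP => l; have := ltn_len w pc; have := vstripP sc sb1 vs w.
  by rewrite nth_rcons sb ltnn eqxx; lia.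
have [c' ec sc'] := rcons0P sc pc lc.
exists c' => //; move: pc vs; rewrite ec partition_rcons0 vstrip_rcons0 // mem_down sc' eqxx.
by move=> -> ->.
Qed.

(** [1 - x ^+ 2] is the factor of the eigenvalue pair [(1, -1)]. Partitions with [w] rows are read
    as partitions with [w.+1] rows and an empty last one; the terms with [- x ^+ 2] then become all
    length peaks in [w.+1] rows, full ones included. *)
Lemma minus_kernel_rcons0 w x a (G : seq nat -> K) : size a = w -> is_partition a ->
  (1 - x ^+ 2) * (\sum_(b <- up w a) \sum_(c <- down w b) wt x a b c * G (rcons c 0%N)) =
  \sum_(b <- up w.+1 (rcons a 0%N)) \sum_(c <- down w.+1 b) kminus w.+1 x (rcons a 0%N) b c * G c.
Proof.
move=> sa pa.
have E : \sum_(b <- up w a) \sum_(c <- down w b) wt x a b c * G (rcons c 0%N) =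
    \sum_(b <- up w.+1 (rcons a 0%N)) \sum_(c <- down w.+1 b)
      (len b < w.+1)%N%:R * wt x (rcons a 0%N) b c * G c.
  transitivity (\sum_(b <- up w.+1 (rcons a 0%N) | (len b < w.+1)%N) \sum_(c <- down w.+1 b)
      wt x (rcons a 0%N) b c * G c); last first.
    rewrite [LHS]big_mkcond; apply: eq_bigr => b _; case: ifP => _.
      by apply: eq_bigr => c _; rewrite mul1r.
    by rewrite big1 // => c _; rewrite !mul0r.
  rewrite -[RHS]big_filter -[RHS](perm_big _ (perm_up_rcons0 sa)) big_map.
  apply: eq_big_seq => b; rewrite mem_up => /and3P[/eqP sb _ _].
  rewrite -[RHS](perm_big _ (perm_down_rcons0 sb)) big_map.
  by apply: eq_bigr => c _; rewrite /wt !sumn_rcons0.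
rewrite mulrBl mul1r {1}E E mulr_sumr.
transitivity (\sum_(b <- up w.+1 (rcons a 0%N)) \sum_(c <- down w.+1 b)
      (len b < w.+1)%N%:R * wt x (rcons a 0%N) b c * G c -
   \sum_(b <- up w.+1 (rcons a 0%N)) \sum_(c <- down w.+1 b)
      (len b < w.+1)%N%:R * (x ^+ 2 * wt x (rcons a 0%N) b c) * G c).
  congr (_ - _); apply: eq_bigr => b _; rewrite mulr_sumr; apply: eq_bigr => c _.
  by ring.
rewrite sum_peaks ?size_rcons ?sa ?partition_rcons0 // -sumrB; apply: eq_big_seq => b.
rewrite mem_up => /and3P[/eqP sb _ _]; rewrite -sumrB; apply: eq_bigr => c _.
by rewrite /kminus -sb len_size andbT; ring.
Qed.

End Kernels.

(** * Transfer along up-down tableaux *)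

Section Transfer.
Implicit Types (n w : nat) (a b c nu : seq nat) (T : seq (seq nat)).

Lemma forall_ordS n (P : pred nat) :
  [forall j : 'I_n.+1, P j] = P 0%N && [forall j : 'I_n, P j.+1].
Proof.
apply/forallP/andP => [H|[H0 /forallP H] j].
  by split; [exact: (H ord0) | apply/forallP => j; exact: (H (lift ord0 j))].
by case: (unliftP ord0 j) => [k ->|->] //; exact: (H k).
Qed.

Lemma updown_cons n w a nu a0 b T :
  updown n.+1 w a nu (a0 :: b :: T) =
  [&& a0 == a, (size a0 == w) && is_partition a0, (size b == w) && is_partition b,
      vstrip w a0 b, vstrip w (nth [::] T 0) b & updown n w (nth [::] T 0) nu T].
Proof.
rewrite /updown mulnS (forall_ordS n (fun j =>
  vstrip w (nth [::] (a0 :: b :: T) (2 * j)) (nth [::] (a0 :: b :: T) (2 * j).+1) &&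
  vstrip w (nth [::] (a0 :: b :: T) (2 * j).+2) (nth [::] (a0 :: b :: T) (2 * j).+1))) /=.
rewrite muln0 !eqSS eqxx /=.
have -> : [forall j : 'I_n, vstrip w (nth [::] (a0 :: b :: T) (2 * j.+1)) (nth [::] (b :: T) (2 * j.+1)) &&
    vstrip w (nth [::] T (2 * j.+1)) (nth [::] (b :: T) (2 * j.+1))] =
  [forall j : 'I_n, vstrip w (nth [::] T (2 * j)) (nth [::] T (2 * j).+1) &&
         vstrip w (nth [::] T (2 * j).+2) (nth [::] T (2 * j).+1)].
  by apply: eq_forallb => j; rewrite mulnS.
case: (a0 == a); rewrite /= ?andbF //.
case: (size a0 == w); rewrite /= ?andbF //; case: (is_partition a0); rewrite /= ?andbF //.
case: (size b == w); rewrite /= ?andbF //; case: (is_partition b); rewrite /= ?andbF //.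
case: (vstrip w a0 b); rewrite /= ?andbF //.
by case: (vstrip w (nth [::] T 0) b); rewrite /= ?andbF.
Qed.

Lemma udtabP n w mu nu (T : udtab n w mu nu) : updown n w mu nu (udseq T).
Proof. exact: valP T. Qed.

Variable R : comNzRingType.
Implicit Type k : nat -> seq nat -> seq nat -> seq nat -> R.

Definition tab_weight n w mu nu k (T : udtab n w mu nu) : R :=
  \prod_(i < n) k i (tab T (2 * i)) (tab T (2 * i).+1) (tab T (2 * i).+2).

Lemma big_seq_pick (X : eqType) (s : seq X) (z : X) (F : X -> R) :
  uniq s -> z \in s -> \sum_(x <- s) (if z == x then F x else 0) = F z.
Proof.
move=> us zs; rewrite (bigD1_seq z) //= eqxx big1 ?addr0 // => x.
by rewrite eq_sym => /negbTE->.
Qed.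

Lemma sum_updown0 w a nu k : size a = w -> is_partition a ->
  \sum_(T : udtab 0 w a nu) tab_weight k T = (a == nu)%:R.
Proof.
move=> sa pa; case: eqP => [e|ne]; last first.
  rewrite big1 // => T _; have := udtabP T; rewrite /updown => /and5P[_ _ /eqP e /eqP e' _].
  by case: ne; exact: etrans (esym e) e'.
have h : updown 0 w a nu [:: a].
  by rewrite /updown /= sa eqxx pa e eqxx /=; apply/forallP => -[].
rewrite (big_pred1 (UDTab h)) ?/tab_weight ?big_ord0 // => T.
apply/esym/eqP; apply: val_inj => /=.
by have /and5P[/eqP] := udtabP T; case: (udseq T) => [|t [|]] //= _ _ /eqP -> _ _.
Qed.

(** Exactly one pair [(b, c)] picks up a given tableau, and dropping its first two entries leaves a
    tableau starting at [c]. *)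
Lemma sum_updownS n w a nu k : size a = w -> is_partition a ->
  \sum_(T : udtab n.+1 w a nu) tab_weight k T =
  \sum_(b <- up w a) \sum_(c <- down w b)
     k 0%N a b c * \sum_(T : udtab n w c nu) tab_weight (fun i => k i.+1) T.
Proof.
move=> sa pa.
have uT (T : udtab n.+1 w a nu) : exists b T', udseq T = [:: a, b & T'] /\
    [/\ b \in up w a, nth [::] T' 0 \in down w b & updown n w (nth [::] T' 0) nu T'].
  have := udtabP T; have := udtabP T; rewrite {1}/updown => /and5P[/eqP].
  rewrite mulnS; case: (udseq T) => [|a0 [|b T']] // _ _ _ _ _.
  rewrite updown_cons => /and5P[/eqP -> /andP[_ _] /andP[/eqP sb pb] vs /andP[vs' uT']].
  exists b, T'; split=> //; split=> //; first by rewrite mem_up sb eqxx pb.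
  rewrite mem_down vs'; have /and5P[/eqP sT /allP aT _ _ _] := uT'.
  by have /aT/andP[-> ->] : nth [::] T' 0 \in T' by rewrite mem_nth ?sT.
transitivity (\sum_(T : udtab n.+1 w a nu) \sum_(b <- up w a) \sum_(c <- down w b)
   if (tab T 1 == b) && (tab T 2 == c) then tab_weight k T else 0).
  apply: eq_bigr => T _; have [b [T' [e [bu cd _]]]] := uT T.
  rewrite (eq_bigr (fun b' => if tab T 1 == b' then
      \sum_(c <- down w b') (if tab T 2 == c then tab_weight k T else 0) else 0)).
    by rewrite big_seq_pick ?uniq_up /tab ?e //= (big_seq_pick _ (uniq_down w b) cd).
  move=> b' _; case: (tab T 1 == b') => //=.
  by rewrite big1.
rewrite exchange_big; apply: eq_big_seq => b bu /=.
rewrite exchange_big; apply: eq_big_seq => c cd /=.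
rewrite -big_mkcond /=.
move: (bu) (cd); rewrite mem_up mem_down => /and3P[sb pb vs] /and3P[sc pc vs'].
have hP (T : udtab n w c nu) : updown n.+1 w a nu [:: a, b & udseq T].
  have e : nth [::] (udseq T) 0 = c by have /and5P[_ _ /eqP] := udtabP T.
  by rewrite updown_cons eqxx sa eqxx pa sb pb vs e vs' /= udtabP.
pose h (T : udtab n w c nu) := UDTab (hP T).
pose h' (T : udtab n.+1 w a nu) : option (udtab n w c nu) := insub (drop 2 (udseq T)).
rewrite (reindex_omap h h') => [|T /andP[]]; last first.
  have [b1 [T' [e [_ _ uT']]]] := uT T; rewrite /tab e /= => /eqP eb /eqP ec.
  rewrite /h' e /= drop0 insubT; first by rewrite -ec.
  by move=> p; congr Some; apply: val_inj; rewrite /= e eb.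
rewrite mulr_sumr; apply: eq_big => [T|T _].
  have e : nth [::] (udseq T) 0 = c by have /and5P[_ _ /eqP] := udtabP T.
  rewrite /tab /= e !eqxx /= /h' /= drop0.
  by apply/eqP; exact: valK.
have e : nth [::] (udseq T) 0 = c by have /and5P[_ _ /eqP] := udtabP T.
rewrite /tab_weight big_ord_recl; congr (_ * _); first by rewrite /tab /= e.
by apply: eq_bigr => i _; rewrite lift0 mulnS.
Qed.

(** The tableau sum as a recursion over the variables, the form in which it is matched with repeated
    multiplication of characters by [efac]. *)
Fixpoint transfer w (k : R -> seq nat -> seq nat -> seq nat -> R) (xs : seq R) a : R :=
  if xs is x :: xs' then
    \sum_(b <- up w a) \sum_(c <- down w b) k x a b c * transfer w k xs' c
  else (a == nseq w 0%N)%:R.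

Lemma sum_updown w (k : R -> seq nat -> seq nat -> seq nat -> R) xs a :
  size a = w -> is_partition a ->
  \sum_(T : udtab (size xs) w a (nseq w 0%N)) tab_weight (fun i => k (nth 0 xs i)) T =
  transfer w k xs a.
Proof.
elim: xs a => [|x xs IH] a sa pa; first exact: sum_updown0.
rewrite sum_updownS //=; apply: eq_bigr => b _; apply: eq_big_seq => c.
by rewrite mem_down => /and3P[/eqP sc pc _]; rewrite -IH.
Qed.

End Transfer.

(** * Quadrature on pairs of inverse points *)

Section Quadrature.
Variable K : fieldType.

(** Exactness below degree [M] is what orthogonality rests on; [quad_regular] allows division by
    [y - 1/y], and [quad_rev] says that the set of points is closed under inversion. *)
Record quadrature M (y : 'I_M -> K) : Prop := Quadrature {
  quad_neq0 : forall j, y j != 0;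
  quad_regular : forall j, y j - (y j)^-1 != 0;
  quad_rev : forall j, y (rev_ord j) = (y j)^-1;
  quad_sum : forall d, (d < M)%N -> \sum_j y j ^+ d = (d == 0%N)%:R * M%:R;
  quad_char : M%:R != 0 :> K }.

Hypothesis char0 : forall n, n.+1%:R != 0 :> K.

Lemma eqN0 (z : K) : z = - z -> z = 0.
Proof.
move/eqP; rewrite -subr_eq0 opprK -mulr2n -mulr_natl mulf_eq0 (negbTE (char0 1)) /=.
by move/eqP.
Qed.

Section Fixed.
Variables (M : nat) (y : 'I_M -> K).
Hypothesis Q : quadrature y.

Lemma quad_sum_inv d : (d < M)%N -> \sum_j (y j)^-1 ^+ d = (d == 0%N)%:R * M%:R.
Proof.
move=> h; rewrite -(quad_sum Q h) [RHS](reindex_inj rev_ord_inj).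
by apply: eq_bigr => j _; rewrite (quad_rev Q).
Qed.

(** The product-to-sum formula for cosines; the bound keeps both frequencies below [M]. At exponent
    0 the value doubles because the two exponentials coincide. *)
Lemma quad_csum a b : (a + b < M)%N ->
  \sum_j (y j ^+ a + (y j)^-1 ^+ a) * (y j ^+ b + (y j)^-1 ^+ b) =
  (a == b)%:R * (2 + 2 * (a == 0%N)%:R) * M%:R.
Proof.
move=> h; wlog le : a b h / (b <= a)%N.
  move=> H; case: (leqP b a) => l; first exact: H.
  have h' : (b + a < M)%N by rewrite addnC.
  rewrite (eq_bigr _ (fun j _ => mulrC _ _)) (H _ _ h' (ltnW l)).
  by rewrite (ltn_eqF l) (gtn_eqF l) !mul0r.
have E j : (y j ^+ a + (y j)^-1 ^+ a) * (y j ^+ b + (y j)^-1 ^+ b) =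
    (y j ^+ (a + b) + (y j)^-1 ^+ (a + b)) + (y j ^+ (a - b) + (y j)^-1 ^+ (a - b)).
  have yz : y j * (y j)^-1 = 1 by rewrite divff // (quad_neq0 Q).
  have yzb : y j ^+ b * (y j)^-1 ^+ b = 1 by rewrite -exprMn yz expr1n.
  have e (z : K) : z ^+ a = z ^+ (a - b) * z ^+ b by rewrite -exprD subnK.
  rewrite !exprD !e; set Y := y j ^+ b in yzb *; set Z := _ ^+ b in yzb *.
  have -> : forall U V : K, (U * Y + V * Z) * (Y + Z) =
     (U * Y * Y + V * Z * Z) + (U * (Y * Z) + V * (Y * Z)) by move=> U V; ring.
  by rewrite yzb !mulr1.
under eq_bigr do rewrite E; rewrite !big_split /= !quad_sum_inv ?(quad_sum Q) //; try lia.
rewrite addn_eq0 subn_eq0; case: (ltngtP a b) le => // [lt|->] _; rewrite ?andbF /=.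
- by rewrite (gtn_eqF (leq_ltn_trans (leq0n b) lt)) /=; ring.
- by rewrite andbb; ring.
Qed.

Lemma quad_cdiff a b : (a.+1 + b.+1 < M)%N ->
  \sum_j (y j ^+ a.+1 - (y j)^-1 ^+ a.+1) * (y j ^+ b.+1 - (y j)^-1 ^+ b.+1) =
  - ((a == b)%:R * 2 * M%:R).
Proof.
move=> h; wlog le : a b h / (b <= a)%N.
  move=> H; case: (leqP b a) => l; first exact: H.
  have h' : (b.+1 + a.+1 < M)%N by rewrite addnC.
  rewrite (eq_bigr _ (fun j _ => mulrC _ _)) (H _ _ h' (ltnW l)).
  by rewrite (ltn_eqF l) (gtn_eqF l) !mul0r.
have E j : (y j ^+ a.+1 - (y j)^-1 ^+ a.+1) * (y j ^+ b.+1 - (y j)^-1 ^+ b.+1) =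
    (y j ^+ (a.+1 + b.+1) + (y j)^-1 ^+ (a.+1 + b.+1)) - (y j ^+ (a - b) + (y j)^-1 ^+ (a - b)).
  have yz : y j * (y j)^-1 = 1 by rewrite divff // (quad_neq0 Q).
  have yzb : y j ^+ b.+1 * (y j)^-1 ^+ b.+1 = 1 by rewrite -exprMn yz expr1n.
  have e (z : K) : z ^+ a.+1 = z ^+ (a - b) * z ^+ b.+1 by rewrite -exprD addnS subnK.
  rewrite !exprD !e; set Y := y j ^+ b.+1 in yzb *; set Z := _ ^+ b.+1 in yzb *.
  have -> : forall U V : K, (U * Y - V * Z) * (Y - Z) =
     (U * Y * Y + V * Z * Z) - (U * (Y * Z) + V * (Y * Z)) by move=> U V; ring.
  by rewrite yzb !mulr1.
under eq_bigr do rewrite E; rewrite sumrB !big_split /= !quad_sum_inv ?(quad_sum Q) //; try lia.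
rewrite addSn /= subn_eq0; case: (ltngtP a b) le => // [lt|_] _.
- by ring.
- by ring.
Qed.

(* The factor 1 / (y - 1/y) is cancelled by the Vandermonde determinant, which
   contains each y - 1/y once. *)
Definition kap a b : K := \sum_j (y j - (y j)^-1)^-1 * (y j ^+ a * (y j)^-1 ^+ b).

Lemma kapC a b : kap a b = - kap b a.
Proof.
rewrite /kap (reindex_inj rev_ord_inj) -sumrN; apply: eq_bigr => j _.
by rewrite (quad_rev Q) invrK -opprB invrN mulNr [X in _ * X]mulrC.
Qed.

Lemma kapSS a b : kap a.+1 b.+1 = kap a b.
Proof.
apply: eq_bigr => j _; rewrite !exprS mulrACA divff ?mul1r //; exact: quad_neq0.
Qed.

(** Passing from [d] to [d + 2] adds the power sum of exponent [d + 1], which vanishes below [M].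
    Antisymmetry settles [d = 0] and, with the number of points, [d = 1]. *)
Lemma kap0 d : (d <= M)%N -> kap d 0 = (odd d)%:R * (M%:R / 2).
Proof.
have two : 2 != 0 :> K by exact: (char0 1).
have rec2 e : (e.+1 < M)%N -> kap e.+2 0 = kap e 0.
  move=> h; apply/eqP; rewrite -subr_eq0 -sumrB; apply/eqP.
  transitivity (\sum_j y j ^+ e.+1); last by rewrite (quad_sum Q) // mul0r.
  apply: eq_bigr => j _; rewrite -mulrBr !expr0 !mulr1.
  have y0 := quad_neq0 Q j; have r := quad_regular Q j.
  apply: (mulfI r); rewrite mulrA divff // mul1r mulrBl !exprS mulKf //.
elim: d {-2}d (leqnn d) => [|N IH] [|[|d]] h hM //.
- by rewrite mul0r; apply: eqN0; exact: kapC.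
- by rewrite mul0r; apply: eqN0; exact: kapC.
- have : kap 1 0 - kap 0 1 = M%:R.
    rewrite -sumrB (eq_bigr (fun=> 1)) ?sumr_const ?card_ord // => j _.
    by rewrite -mulrBr !expr0 mul1r mulr1 mulVf // (quad_regular Q).
  have E2 : kap 1 0 + kap 1 0 = kap 1 0 * 2 by ring.
  by rewrite (kapC 0 1) opprK E2 => <-; rewrite mul1r mulfK.
- by rewrite rec2 // IH; [rewrite /= negbK | lia | lia].
Qed.

Lemma kapE a b : (a <= M)%N -> (b <= M)%N ->
  kap a b = (odd (a + b))%:R * ((if (b < a)%N then 1 else -1) * (M%:R / 2)).
Proof.
have E d b' : kap (d + b') b' = kap d 0 by elim: b' => [|b' IH]; rewrite ?addn0 // addnS kapSS.
move=> hM hM'; case: (ltnP b a) => h.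
  rewrite -{1}(subnK (ltnW h)) E kap0; last by lia.
  by rewrite mul1r oddB ?oddD // ltnW.
rewrite kapC -{1}(subnK h) E kap0; last by lia.
by rewrite mulN1r mulrN oddB ?oddD // addbC.
Qed.

End Fixed.
End Quadrature.

(** * Quadrature points from a primitive root of unity *)

Section RootsOfUnity.
Variables (K : fieldType) (N : nat) (zeta : K).
Hypothesis char0 : forall n, n.+1%:R != 0 :> K.
Let M := (2 * N.+1)%N.
Hypothesis prim : (2 * M)%N.-primitive_root zeta.

(** Odd powers of a primitive [2M]-th root satisfy [y^M = -1]. As [M] is even, [y^2 = 1] would give
    [y^M = 1], so [y - 1/y] never vanishes. *)
Lemma root_quadrature : quadrature (fun j : 'I_M => zeta ^+ (2 * j).+1).
Proof.
have M2 : (0 < M)%N by [].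
have z0 : zeta != 0.
  apply/eqP => e; have := prim_expr_order prim; rewrite e expr0n => /eqP.
  by rewrite (_ : (_ == _ :> nat) = false) // eq_sym oner_eq0.
split=> [j|j|j|d hd|].
- exact: expf_neq0.
- have y0 : zeta ^+ (2 * j).+1 != 0 by exact: expf_neq0.
  rewrite subr_eq0 -(inj_eq (mulfI y0)) divff // -exprD.
  rewrite -(prim_order_dvd prim); have := ltn_ord j; rewrite /M.
  move=> hj; apply/negP => /dvdnP[q]; nia.
- apply: (mulfI (expf_neq0 (2 * j).+1 z0)); rewrite divff ?expf_neq0 // -exprD.
  rewrite -(prim_expr_order prim); congr (_ ^+ _); have := ltn_ord j; rewrite /= ; lia.
- case: d hd => [|d] hd.
    by rewrite (eq_bigr (fun=> 1)) ?sumr_const ?card_ord ?mul1r.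
  rewrite mul0r (eq_bigr (fun j : 'I_M => zeta ^+ d.+1 * (zeta ^+ (2 * d.+1)) ^+ j)); last first.
    by move=> j _; rewrite -!exprM -exprD; congr (_ ^+ _); lia.
  rewrite -mulr_sumr; apply/eqP; rewrite mulf_eq0 (negbTE (expf_neq0 _ z0)) /=.
  (* A geometric sum whose ratio differs from 1 and has [M]-th power 1. *)
  have r1 : zeta ^+ (2 * d.+1) - 1 != 0.
    rewrite subr_eq0 -(prim_order_dvd prim) dvdn_pmul2l //.
    by apply/negP => /dvdn_leq; lia.
  rewrite -(inj_eq (mulfI r1)) mulr0 -subrX1 subr_eq0.
  by rewrite -exprM -(prim_order_dvd prim) mulnAC dvdn_mulr.
- exact: char0.
Qed.

End RootsOfUnity.

(** * The orthogonal integral of alternants *)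

Section Functional.
Variables (K : fieldType) (w : nat) (X : finType).
Variables A B W : 'I_w -> X -> K.
Implicit Types (u v : 'I_(w + w) -> nat) (p : {ffun 'I_w -> X}) (xs : seq K).

Definition pairpt p (k : 'I_(w + w)) : K :=
  match split k with inl i => A i (p i) | inr i => B i (p i) end.

Definition pairmom i a b : K := \sum_x W i x * (A i x ^+ a * B i x ^+ b).

(** With the weights chosen later, [lam [::]] is up to a constant the integral of a Schur function
    over one component: [W] is the Weyl density divided by the Vandermonde determinant. *)
Definition lam xs u : K :=
  \sum_(p : {ffun 'I_w -> X}) (\prod_i W i (p i)) * ((\prod_(x <- xs) \prod_k (1 + x * pairpt p k)) *
     alt (fun k d => pairpt p k ^+ d) u).

Lemma pairpt_l p i : pairpt p (lshift w i) = A i (p i).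
Proof. by rewrite /pairpt (unsplitK (inl i)). Qed.

Lemma pairpt_r p i : pairpt p (rshift w i) = B i (p i).
Proof. by rewrite /pairpt (unsplitK (inr i)). Qed.

(** The Leibniz expansion assigns two exponents to each pair, so the sum over points factors into
    pair moments. *)
Lemma lam_expand u : lam [::] u = \sum_(s : 'S_(w + w)) (-1) ^+ s *
   \prod_i pairmom i (u (s (lshift w i))) (u (s (rshift w i))).
Proof.
rewrite /lam /alt /determinant.
transitivity (\sum_(p : {ffun 'I_w -> X}) \sum_(s : 'S_(w + w)) (-1) ^+ s * \prod_i (W i (p i) *
   (A i (p i) ^+ u (s (lshift w i)) * B i (p i) ^+ u (s (rshift w i))))).
  apply: eq_bigr => p _; rewrite big_nil mul1r mulr_sumr; apply: eq_bigr => s _.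
  rewrite mulrCA; congr (_ * _); rewrite big_split_ord /= big_split /= big_split /=.
  congr (_ * (_ * _)); apply: eq_bigr => i _; rewrite mxE ?pairpt_l ?pairpt_r //.
rewrite exchange_big; apply: eq_bigr => s _ /=; rewrite -mulr_sumr; congr (_ * _).
by rewrite bigA_distr_bigA.
Qed.

Lemma eq_lam u v (e : 'I_w -> K) :
  (forall i a b, a != b -> pairmom i (u a) (u b) = e i * pairmom i (v a) (v b)) ->
  lam [::] u = (\prod_i e i) * lam [::] v.
Proof.
move=> H; rewrite !lam_expand mulr_sumr; apply: eq_bigr => s _; rewrite mulrCA; congr (_ * _).
rewrite -big_split; apply: eq_bigr => i _ /=; apply: H.
by rewrite (inj_eq perm_inj) eq_lrshift.
Qed.

Hypothesis char0 : forall n, n.+1%:R != 0 :> K.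

Lemma lam_tperm_eq0 u (j k : 'I_(w + w)) : j != k ->
  (forall i a b, a != b ->
     pairmom i (u (tperm j k a)) (u (tperm j k b)) = pairmom i (u a) (u b)) ->
  lam [::] u = 0.
Proof.
move=> jk H; apply: (eqN0 char0).
transitivity (lam [::] (u \o tperm j k)).
  rewrite (@eq_lam (u \o tperm j k) u (fun=> 1)) ?big1 ?mul1r // => i a b ab.
  by rewrite mul1r H.
rewrite /lam -sumrN; apply: eq_bigr => p _.
by rewrite alt_perm odd_tperm jk expr1 mulN1r !mulrN.
Qed.

Lemma perm_lam xs ys u : perm_eq xs ys -> lam xs u = lam ys u.
Proof. by move=> e; apply: eq_bigr => p _; rewrite (perm_big _ e). Qed.

Fixpoint chain (m : nat) (Phi : seq nat -> K) xs a : K :=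
  if xs is x :: xs' then
    \sum_(b <- up m a) x ^+ (sumn b - sumn a) * chain m Phi xs' b
  else Phi a.

Lemma lam_chain xs a : size a = (w + w)%N -> is_partition a ->
  lam xs (shv 0 a) = chain (w + w) (fun b => lam [::] (shv 0 b)) xs a.
Proof.
elim: xs a => [//|x xs IH] a sa pa /=.
transitivity (\sum_(b <- up (w + w) a) x ^+ (sumn b - sumn a) * lam xs (shv 0 b)); last first.
  by apply: eq_big_seq => b; rewrite mem_up => /and3P[/eqP sb pb _]; rewrite IH.
rewrite /lam; under [RHS]eq_bigr do rewrite mulr_sumr.
rewrite exchange_big; apply: eq_bigr => p _ /=.
rewrite big_cons [X in _ * X](_ : _ = (\prod_(y <- xs) \prod_k (1 + y * pairpt p k)) *
   \sum_(b <- up (w + w) a) x ^+ (sumn b - sumn a) * alt (fun k d => pairpt p k ^+ d) (shv 0 b)).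
  rewrite !mulr_sumr; apply: eq_bigr => b _.
  by ring.
rewrite -mulrA mulrCA; congr (_ * _).
rewrite -alt_up // -(@alt_pieri _ _ (fun k => 1 + x * pairpt p k) x (fun k d => pairpt p k ^+ d)) //.
by move=> k j; rewrite exprS; ring.
Qed.

Lemma chain_rcons m Phi xs t a :
  chain m Phi (rcons xs t) a = chain m (chain m Phi [:: t]) xs a.
Proof. by elim: xs a => [//|x xs IH] a /=; apply: eq_bigr => b _; rewrite IH. Qed.

(** A strip adds at most one cell to a row, so agreement is needed only on shapes of bounded width;
    this keeps exponents in the range where the moments are known. *)
Lemma eq_chain m Phi Psi xs a N : size a = m -> is_partition a ->
  (forall j, nth 0 a j <= N)%N ->
  (forall b, size b = m -> is_partition b -> (forall j, nth 0 b j <= N + size xs)%N ->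
     Phi b = Psi b) ->
  chain m Phi xs a = chain m Psi xs a.
Proof.
elim: xs a N => [|x xs IH] a N sa pa hN H /=; first by apply: H => // j; rewrite addn0.
apply: eq_big_seq => b; rewrite mem_up => /and3P[/eqP sb pb vs]; congr (_ * _).
apply: (IH _ N.+1) => //; last by move=> c sc pc hc; apply: H => //= j; rewrite addnS.
by move=> j; have := vstripP sa sb vs j; have := hN j; lia.
Qed.

Lemma chain_scale m Phi c xs a : chain m (fun b => c * Phi b) xs a = c * chain m Phi xs a.
Proof.
elim: xs a => [//|x xs IH] a /=; rewrite mulr_sumr; apply: eq_bigr => b _.
by rewrite IH mulrCA.
Qed.

Section Parity.
Variables (N : nat) (e : 'I_w -> K).
Hypothesis w_gt0 : (0 < w)%N.
Hypothesis mom_parity : forall i a b a' b', (a < N)%N -> (b < N)%N -> (a' < N)%N -> (b' < N)%N ->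
  odd a = odd a' -> odd b = odd b' -> (odd a != odd b -> (a < b)%N = (a' < b')%N) ->
  pairmom i a b = pairmom i a' b'.
Hypothesis mom_shift : forall i a b, (a.+1 < N)%N -> (b.+1 < N)%N ->
  pairmom i a.+1 b.+1 = e i * pairmom i a b.
Let m := (w + w)%N.
Let delta := @shv 0 m (nseq m 0%N).

Let shv_lt (b : seq nat) (j k : 'I_m) : is_partition b -> (shv 0 b j < shv 0 b k)%N = (k < j)%N.
Proof.
move=> pb; rewrite /shv; have := ltn_ord j; have := ltn_ord k.
by case: (ltnP k j) => h; [have := partition_le pb (ltnW h) | have := partition_le pb h]; lia.
Qed.

Let deltaE (j : 'I_m) : delta j = (m - j.+1)%N.
Proof. by rewrite /delta /shv nth_nseq ltn_ord; lia. Qed.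

(* Adjacent exponents of equal parity have the same moments against all the others,
   so exchanging them changes the sign of the form but not its value. *)
Lemma lam_parity b : size b = m -> is_partition b -> (forall j, nth 0 b j + m < N)%N ->
  lam [::] (@shv 0 m b) =
  lam [::] delta * ((all (fun z => ~~ odd z) b)%:R + (\prod_i e i) * (all odd b)%:R).
Proof.
move=> sb pb hN.
have bN (j : 'I_m) : (shv 0 b j < N)%N by rewrite /shv; have := hN j; have := ltn_ord j; lia.
have dN (j : 'I_m) : ((delta j).+1 < N)%N.
  by rewrite deltaE; have := hN 0%N; have := ltn_ord j; lia.
have dp : is_partition (nseq m 0%N) by apply/partitionP => j; rewrite !nth_nseq !if_same.
have dlt j k : (delta j < delta k)%N = (k < j)%N by exact: shv_lt.
(* Even rows leave the parities and the order of the staircase [delta] unchanged, hence all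
   moments. *)
have [ae|nae] := boolP (all (fun z => ~~ odd z) b).
  have -> : all odd b = false.
    case: b sb ae {pb hN bN} => [|z b] /=; first by rewrite /m; lia.
    by move=> _ /andP[/negbTE->].
  rewrite mulr0 addr0 mulr1 (@eq_lam _ delta (fun=> 1)) ?big1 ?mul1r // => i j k jk.
  have od (l : 'I_m) : odd (shv 0 b l) = odd (delta l).
    rewrite /shv deltaE !oddD; have /(all_nthP 0%N)/(_ l) := ae.
    by rewrite sb ltn_ord => /(_ isT)/negbTE->; rewrite addbF.
  rewrite mul1r; apply: mom_parity; rewrite ?od ?bN ?(ltnW (dN _)) // => _.
  by rewrite shv_lt // dlt.
(* Odd rows give the parities of [delta] shifted by one, and the shift is paid for by the factors
   [e i]. *)
have [ao|nao] := boolP (all odd b).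
  rewrite add0r mulr1 mulrC; apply: eq_lam => i j k jk.
  have od (l : 'I_m) : odd (shv 0 b l) = odd (delta l).+1.
    rewrite /shv /= deltaE !oddD; have /(all_nthP 0%N)/(_ l) := ao.
    by rewrite sb ltn_ord => /(_ isT)->; rewrite addbF.
  rewrite -mom_shift //; apply: mom_parity; rewrite ?od ?bN ?dN // => _.
  by rewrite ltnS shv_lt // dlt.
rewrite mulr0 addr0 mulr0.
(* Consecutive entries of the staircase alternate in parity, so adjacent rows of different parity
   have exponents of equal parity. *)
have /existsP[j /existsP[k /andP[/eqP kj ne]]] :
    [exists j : 'I_m, exists k : 'I_m, (k == j.+1 :> nat) && (odd (nth 0%N b j) != odd (nth 0%N b k))].
  apply: contraR nae => /existsPn H; apply/(all_nthP 0%N).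
  have E j : (j < m)%N -> odd (nth 0%N b j) = odd (nth 0%N b 0).
    elim: j => // j IH hj; rewrite -IH; last by lia.
    have /existsPn/(_ (Ordinal hj)) := H (Ordinal (ltnW hj)).
    by rewrite eqxx /= negbK => /eqP.
  move=> j; rewrite sb => hj; rewrite E //; apply: contra nao => o0.
  by apply/(all_nthP 0%N) => l; rewrite sb => hl; rewrite E.
have jk : j != k by apply/eqP => e'; move: kj; rewrite e'; lia.
apply: (lam_tperm_eq0 jk) => i a c ac.
have E : odd (shv 0 b j) = odd (shv 0 b k).
  rewrite /shv kj !addn0 !oddD (_ : (m - j.+1)%N = (m - j.+2).+1); last first.
    by have := ltn_ord k; lia.
  by rewrite /=; move: ne; rewrite kj; case: (odd _); case: (odd _); case: (odd _).
have od (l : 'I_m) : odd (shv 0 b (tperm j k l)) = odd (shv 0 b l).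
  by case: tpermP => [->|->|].
have nv (p q : 'I_m) : p <> q -> (p : nat) <> q by move=> h /val_inj.
apply: mom_parity; rewrite ?od ?bN // => oac; rewrite !shv_lt //; move: oac ac.
case: tpermP => [->|->|/nv aj /nv ak]; case: tpermP => [->|->|/nv cj /nv ck];
  rewrite ?E ?eqxx // => _ _; lia.
Qed.

End Parity.
End Functional.

(** * Completing all rows to one parity *)

Section ParitySum.
Variable K : fieldType.

(** The one contributing strip adds a cell to precisely the rows that violate [P]; the result is a
    partition because equal rows grow together. *)
Lemma sum_up_all m (P : pred nat) (t : K) a : (forall z, P z.+1 = ~~ P z) ->
  size a = m -> is_partition a ->
  \sum_(b <- up m a) t ^+ (sumn b - sumn a) * (all P b)%:R = t ^+ count (predC P) a.
Proof.
move=> PS sa pa; pose g z := (z + ~~ P z)%N; pose b0 := map g a.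
have n0 j : (j < m)%N -> nth 0%N b0 j = g (nth 0%N a j) by move=> h; rewrite (nth_map 0%N) ?sa.
have nd s j : size s = m -> (m <= j)%N -> nth 0%N s j = 0%N by move=> <-; exact: nth_default.
have sb0 : size b0 = m by rewrite size_map.
have pb0 : is_partition b0.
  apply/partitionP => j; case: (ltnP j.+1 m) => h; last by rewrite (nd b0 j.+1).
  rewrite !n0 ?(ltnW h) // /g; have /partitionP/(_ j) := pa.
  rewrite leq_eqVlt => /orP[/eqP-> //|lt]; apply: leq_trans (leq_addr _ _).
  by case: (P _) => /=; lia.
have b0u : b0 \in up m a.
  rewrite mem_up sb0 eqxx pb0; apply/(vstripP sa sb0) => j.
  case: (ltnP j m) => h; last by rewrite !nd.
  by rewrite n0 // /g; case: (P _) => /=; lia.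
have Pg z : P (g z) by rewrite /g; case e: (P z); rewrite /= ?addn0 // addn1 PS e.
rewrite (bigD1_seq b0) ?uniq_up //= [all P b0](_ : _ = true) ?mulr1; last first.
  by apply/allP => z /mapP[z' _ ->].
rewrite [X in _ + X]big_seq_cond big1 ?addr0 => [|b /andP[bu ne]].
  congr (_ ^+ _); rewrite /b0 -sum1_count [X in (X - _)%N]sumnE big_map /g big_split /= -sumnE addKn.
  by rewrite [RHS]big_mkcond; apply: eq_bigr => z _ /=; case: (P z).
rewrite (_ : all P b = false) ?mulr0 //; apply: contraNF ne => /(all_nthP 0%N) Pb.
move: bu; rewrite mem_up => /and3P[/eqP sb pb /(vstripP sa sb) V].
apply/eqP/(@eq_from_nth _ 0%N) => [|j]; rewrite sb ?sb0 // => h.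
have := V j; have := Pb j; rewrite sb h n0 // /g => /(_ isT); set z := nth 0%N a j.
move=> Pj hj; have [e|e] : nth 0%N b j = z \/ nth 0%N b j = z.+1 by lia.
  by rewrite e in Pj *; rewrite Pj addn0.
by move: Pj; rewrite e PS => ->; rewrite addn1.
Qed.

End ParitySum.

(** * Weyl denominators *)

Section Denominators.
Variable K : fieldType.

Definition vdm w (z : 'I_w -> K) : K := \prod_(i < w) \prod_(j < w | (i < j)%N) (z j - z i).

Definition rev_sign w : K := (-1) ^+ (perm (@rev_ord_inj w)).

Lemma rev_sign_sqr w : rev_sign w * rev_sign w = 1.
Proof. by rewrite /rev_sign -signr_addb addbb. Qed.

Lemma alt_val w (z : 'I_w -> K) : alt (fun i d => z i ^+ d) (fun j => j) = vdm z.
Proof.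
rewrite /alt -det_tr (_ : _^T = Vandermonde w (\row_i z i)) ?det_Vandermonde.
  by apply: eq_bigr => i _; apply: eq_bigr => j _; rewrite !mxE.
by apply/matrixP => i j; rewrite !mxE.
Qed.

Lemma alt_rev w o (f : 'I_w -> nat -> K) :
  alt f (shv o (nseq w 0%N)) = rev_sign w * alt f (fun j => j + o)%N.
Proof.
rewrite -(alt_perm _ _ (perm (@rev_ord_inj w))); apply: eq_alt => i j.
by rewrite /shv nth_nseq if_same /= permE.
Qed.

(** Column [d] holds a polynomial of degree at most [d], so the change of basis from powers is
    triangular. *)
Lemma alt_poly w (Y : 'I_w -> K) (P : nat -> {poly K}) : (forall d, size (P d) <= d.+1)%N ->
  alt (fun i d => (P d).[Y i]) (fun j => j) = (\prod_(d < w) (P d)`_d) * vdm Y.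
Proof.
move=> sP; rewrite -alt_val mulrC /alt.
pose C := \matrix_(i < w, j < w) (P j)`_i.
have -> : \prod_(d < w) (P d)`_d = \det C.
  rewrite -det_tr det_trig; first by apply: eq_bigr => i _; rewrite !mxE.
  by apply/is_trig_mxP => i j h; rewrite !mxE nth_default // (leq_trans (sP _)).
rewrite -det_mulmx; congr (\det _); apply/matrixP => i j; rewrite !mxE.
rewrite (@horner_coef_wide _ w); last by apply: leq_trans (sP _) _.
by apply: eq_bigr => k _; rewrite !mxE mulrC.
Qed.

(** Chebyshev polynomials in [y + 1/y]: the start value 2 yields [y^d + y^-d], the start value 1
    yields the quotient of [y^(d+1) - y^-(d+1)] by [y - 1/y]. Carrying two consecutive terms makes
    the recursion structural. *)
Fixpoint cheb_pair (c : K) d : {poly K} * {poly K} :=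
  if d is d'.+1 then let: (p, q) := cheb_pair c d' in (q, 'X * q - p) else (c%:P, 'X).
Definition cheb c d : {poly K} := (cheb_pair c d).1.

Lemma chebSS c d : cheb c d.+2 = 'X * cheb c d.+1 - cheb c d.
Proof. by rewrite /cheb /=; case: (cheb_pair c d). Qed.

Lemma cheb1 c : cheb c 1 = 'X. Proof. by []. Qed.

Lemma cheb_lead c d : (size (cheb c d) <= d.+1)%N /\ (cheb c d)`_d = if d == 0%N then c else 1.
Proof.
elim: d {-2}d (leqnn d) => [|N IH] [|[|d]] h //.
- by rewrite /cheb /= size_polyC_leq1 coefC.
- by rewrite /cheb /= size_polyC_leq1 coefC.
- by rewrite cheb1 size_polyX coefX.
- have [s1 c1] := IH d.+1 h; have [s0 _] := IH d (ltnW h); rewrite chebSS; split.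
    apply: leq_trans (size_polyD _ _) _; rewrite size_polyN geq_max mulrC.
    rewrite (leq_trans s0) ?andbT //; last exact: leqW.
    by apply: leq_trans (size_polyMleq _ _) _; rewrite size_polyX addn2.
  by rewrite coefB coefXM /= c1 nth_default ?subr0 // (leq_trans s0).
Qed.

Lemma csum_cheb w (y : 'I_w -> K) i d : y i != 0 ->
  csum y i d = (cheb 2 d).[y i + (y i)^-1].
Proof.
move=> y0; elim: d {-2}d (leqnn d) => [|N IH] [|[|d]] h //.
- by rewrite /csum /cheb /= hornerC !expr0.
- by rewrite /csum /cheb /= hornerC !expr0.
- by rewrite /csum cheb1 hornerX !expr1.
- rewrite chebSS !hornerE -!IH //; last exact: ltnW.
  have yz : y i * (y i)^-1 = 1 by rewrite divff.
  rewrite /csum; set z := (y i)^-1 in yz *; rewrite !exprS.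
  transitivity (y i * (y i * y i ^+ d) + z * (z * z ^+ d) + (y i * z - 1) * (y i ^+ d + z ^+ d)).
    by rewrite yz subrr mul0r addr0.
  by ring.
Qed.

Lemma cdiff_cheb w (y : 'I_w -> K) i d : y i != 0 ->
  cdiff y i d.+1 = (y i - (y i)^-1) * (cheb 1 d).[y i + (y i)^-1].
Proof.
move=> y0; have yz : y i * (y i)^-1 = 1 by rewrite divff.
elim: d {-2}d (leqnn d) => [|N IH] [|[|d]] h //.
- by rewrite /cdiff /cheb /= hornerC !expr1 mulr1.
- by rewrite /cdiff /cheb /= hornerC !expr1 mulr1.
- by rewrite /cdiff cheb1 hornerX -subr_sqr.
- rewrite chebSS !hornerE mulrBr mulrCA -!IH //; last exact: ltnW.
  rewrite /cdiff; set z := (y i)^-1 in yz *; rewrite !exprS.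
  transitivity (y i * (y i * (y i * y i ^+ d)) - z * (z * (z * z ^+ d)) +
     (y i * z - 1) * (y i * y i ^+ d - z * z ^+ d)).
    by rewrite yz subrr mul0r addr0.
  by ring.
Qed.

Lemma alt_csum0 w (y : 'I_w -> K) : (forall i, y i != 0) ->
  alt (csum y) (shv 0 (nseq w 0%N)) =
  rev_sign w * (\prod_(d < w) (if d == 0%N :> nat then 2 else 1)) * vdm (fun i => y i + (y i)^-1).
Proof.
move=> y0; rewrite alt_rev -mulrA; congr (_ * _).
rewrite (@eq_alt _ _ _ (fun i d => (cheb 2 d).[y i + (y i)^-1]) _ (fun j => j)); last first.
  by move=> i j; rewrite addn0 csum_cheb.
rewrite alt_poly => [|d]; last by case: (cheb_lead 2 d).
by congr (_ * _); apply: eq_bigr => d _; case: (cheb_lead 2 d).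
Qed.

Lemma alt_cdiff0 w (y : 'I_w -> K) : (forall i, y i != 0) ->
  alt (cdiff y) (shv 1 (nseq w 0%N)) =
  rev_sign w * (\prod_i (y i - (y i)^-1)) * vdm (fun i => y i + (y i)^-1).
Proof.
move=> y0; rewrite alt_rev -mulrA; congr (_ * _).
rewrite -[vdm _]mul1r -[X in X * vdm _](_ : \prod_(d < w) (cheb 1 d)`_d = 1); last first.
  by apply: big1 => d _; case: (cheb_lead 1 d) => _ ->; case: ifP.
rewrite -alt_poly => [|d]; last by case: (cheb_lead 1 d).
rewrite /alt -det_scale_rows; congr (\det _); apply/matrixP => i j; rewrite !mxE.
by rewrite addn1 cdiff_cheb.
Qed.

(** The factors are grouped by pairs of pairs: for inverse pairs, each group of four becomes minus
    the square of a difference of two values [y + 1/y]. *)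
Lemma vdm_pairs w (z : 'I_(w + w) -> K) :
  vdm z = (\prod_i (z (rshift w i) - z (lshift w i))) *
    \prod_(i < w) \prod_(j < w | (i < j)%N)
      ((z (lshift w j) - z (lshift w i)) * (z (rshift w j) - z (rshift w i)) *
       ((z (rshift w j) - z (lshift w i)) * (z (rshift w i) - z (lshift w j)))).
Proof.
pose a i := z (lshift w i); pose b i := z (rshift w i).
have -> : vdm z = vdm a * vdm b * \prod_i \prod_j (b j - a i).
  rewrite /vdm big_split_ord /= mulrAC; congr (_ * _).
    rewrite -big_split; apply: eq_bigr => i _ /=; rewrite big_mkcond big_split_ord /=.
    congr (_ * _); first by rewrite [RHS]big_mkcond.
    by apply: eq_bigr => j _; rewrite /= ltn_addr.
  apply: eq_bigr => i _; rewrite big_mkcond big_split_ord /= big1 ?mul1r => [|j _].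
    by rewrite [RHS]big_mkcond; apply: eq_bigr => j _; rewrite /= ltn_add2l.
  by rewrite ifF //; have := ltn_ord j; lia.
have -> : \prod_i \prod_j (b j - a i) = (\prod_i (b i - a i)) *
    ((\prod_(i < w) \prod_(j < w | (i < j)%N) (b j - a i)) *
     (\prod_(i < w) \prod_(j < w | (i < j)%N) (b i - a j))).
  rewrite [X in _ = _ * (_ * X)](exchange_big_dep xpredT) //= -!big_split.
  apply: eq_bigr => i _ /=; rewrite (bigD1 i) //=; congr (_ * _).
  rewrite (bigID (fun j : 'I_w => (i < j)%N)) /=; congr (_ * _); apply: eq_bigl => j.
    by rewrite -val_eqE /=; lia.
  by rewrite -val_eqE /=; lia.
rewrite mulrCA; congr (_ * _); rewrite /vdm -!big_split; apply: eq_bigr => i _ /=.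
by rewrite -!big_split.
Qed.

End Denominators.

(** * Evaluating the sums by strips and by characters *)

Section Integration.
Variable K : fieldType.
Hypothesis char0 : forall n, n.+1%:R != 0 :> K.

Lemma partition_nseq0 m : is_partition (nseq m 0%N).
Proof. by apply/partitionP => j; rewrite !nth_nseq !if_same. Qed.

(** The product is symmetric in the variables, so [t] may be moved to the last strip, which the
    parity of the rows then forces. *)
Lemma lam_last w (X : finType) (A B W : 'I_w -> X -> K) N (e : 'I_w -> K) xs t :
  (0 < w)%N -> (size xs + (w + w) < N)%N ->
  (forall i a b a' b', (a <= N)%N -> (b <= N)%N -> (a' <= N)%N -> (b' <= N)%N ->
    odd a = odd a' -> odd b = odd b' -> (odd a != odd b -> (a < b)%N = (a' < b')%N) ->
    pairmom A B W i a b = pairmom A B W i a' b') ->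
  (forall i a b, pairmom A B W i a.+1 b.+1 = e i * pairmom A B W i a b) ->
  lam A B W (t :: xs) (shv 0 (nseq (w + w) 0%N)) =
  lam A B W [::] (shv 0 (nseq (w + w) 0%N)) *
  chain (w + w) (fun b => t ^+ count odd b + (\prod_i e i) * t ^+ count (predC odd) b)
    xs (nseq (w + w) 0%N).
Proof.
move=> w0 hN par sh.
have pm : perm_eq (t :: xs) (rcons xs t) by rewrite perm_sym perm_rcons.
rewrite (perm_lam _ _ _ _ pm) lam_chain ?size_nseq ?partition_nseq0 //.
rewrite chain_rcons -chain_scale; apply: (@eq_chain _ _ _ _ _ _ 0); rewrite ?size_nseq ?partition_nseq0 //.
  by move=> j; rewrite nth_nseq if_same.
move=> b sb pb hb /=.
transitivity (\sum_(c <- up (w + w) b) t ^+ (sumn c - sumn b) *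
   (lam A B W [::] (shv 0 (nseq (w + w) 0%N)) * ((all (predC odd) c)%:R + (\prod_i e i) * (all odd c)%:R))).
  apply: eq_big_seq => c; rewrite mem_up => /and3P[/eqP sc pc vs]; congr (_ * _).
  (* The strip of [t] can widen a row to [size xs + 1], hence the bound [N.+1]. *)
  rewrite (lam_parity char0 (N := N.+1) (e := e)) // => j.
  have := vstripP sb sc vs j; have := hb j; lia.
have -> : t ^+ count odd b =
    \sum_(c <- up (w + w) b) t ^+ (sumn c - sumn b) * (all (predC odd) c)%:R.
  by rewrite sum_up_all //; congr (_ ^+ _); apply: eq_count => z /=; rewrite negbK.
rewrite -(@sum_up_all _ (w + w) odd t b) //=.
rewrite mulrDr !mulr_sumr -big_split /=; apply: eq_bigr => c _.
by ring.
Qed.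

Variables (M : nat) (y : 'I_M -> K).
Hypothesis Q : quadrature y.

(** Each [efac] is one kernel step, and pairing with the alternant of the zero partition keeps only
    that partition at the end. The bound is preserved because a step uses up one variable and widens
    rows by at most one. *)
Lemma transfer_plus w xs a : size a = w -> is_partition a ->
  (forall j, nth 0 a j + size xs + (w + w) < M)%N ->
  \sum_(p : {ffun 'I_w -> 'I_M}) (\prod_(x <- xs) efac (y \o p) x) *
     (alt (csum (y \o p)) (shv 0 a) * alt (csum (y \o p)) (shv 0 (nseq w 0%N))) =
  transfer w (@kplus K w) xs a *
  \sum_(p : {ffun 'I_w -> 'I_M})
     alt (csum (y \o p)) (shv 0 (nseq w 0%N)) * alt (csum (y \o p)) (shv 0 (nseq w 0%N)).
Proof.
elim: xs a => [|x xs IH] a sa pa ha /=.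
  under eq_bigr do rewrite big_nil mul1r.
  case: eqP => [->|ne]; first by rewrite mul1r.
  rewrite mul0r; pose f j d : K := y j ^+ d + (y j)^-1 ^+ d.
  rewrite [LHS](sum_alt_alt f f).
  have w0 : (0 < w)%N.
    by rewrite lt0n; apply: contra_notN ne => /eqP w0; case: (a) sa; rewrite w0.
  have a0 : (0 < nth 0 a 0)%N.
    rewrite lt0n; apply: contra_notN ne => /eqP a0.
    apply/(@eq_from_nth _ 0%N) => [|j hj]; first by rewrite size_nseq.
    rewrite nth_nseq if_same; have := partition_le pa (leq0n j); lia.
  (* The first row of [a] is nonempty, so its exponent exceeds all exponents of the zero partition
     and this row of the Gram matrix is 0. *)
  rewrite (expand_det_row _ (Ordinal w0)) big1 ?mulr0 // => j _.
  have vj : shv 0 (nseq w 0%N) j = (w - j.+1)%N by rewrite /shv nth_nseq if_same addn0.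
  have := ha 0%N; have := ltn_ord j; rewrite mxE vj /shv /= => h1 h2.
  by rewrite quad_csum ?gtn_eqF ?mul0r //; lia.
rewrite mulr_suml.
transitivity (\sum_(p : {ffun 'I_w -> 'I_M}) \sum_(b <- up w a) \sum_(c <- down w b)
   kplus w x a b c * ((\prod_(x <- xs) efac (y \o p) x) *
     (alt (csum (y \o p)) (shv 0 c) * alt (csum (y \o p)) (shv 0 (nseq w 0%N))))).
  apply: eq_bigr => p _; rewrite big_cons -mulrA mulrCA [X in _ * X]mulrA plus_kernel //.
    rewrite mulr_suml mulr_sumr; apply: eq_bigr => b _; rewrite mulr_suml mulr_sumr.
    by apply: eq_bigr => c _; ring.
  by move=> i; exact: (quad_neq0 Q).
rewrite exchange_big; apply: eq_big_seq => b; rewrite mem_up => /and3P[/eqP sb pb v1] /=.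
rewrite exchange_big mulr_suml; apply: eq_big_seq => c; rewrite mem_down => /and3P[/eqP sc pc v2] /=.
rewrite -mulr_sumr IH ?mulrA // => j; have := ha j.
by have := vstripP sa sb v1 j; have := vstripP sc sb v2 j; rewrite /=; lia.
Qed.

(** The Gram matrix is diagonal by orthogonality, with entries [2M] or [4M]. *)
Lemma norm_plus w : (w + w < M)%N ->
  \sum_(p : {ffun 'I_w -> 'I_M})
     alt (csum (y \o p)) (shv 0 (nseq w 0%N)) * alt (csum (y \o p)) (shv 0 (nseq w 0%N)) != 0.
Proof.
move=> h; pose f j d : K := y j ^+ d + (y j)^-1 ^+ d.
rewrite [X in X != 0](sum_alt_alt f f) mulf_neq0 //.
  by have := fact_gt0 w; case: (w`!).
have E (i j : 'I_w) : \sum_x f x (shv 0 (nseq w 0%N) i) * f x (shv 0 (nseq w 0%N) j) =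
   (i == j)%:R * (2 + 2 * (shv 0 (nseq w 0%N) i == 0%N)%:R) * M%:R.
  rewrite quad_csum //; last by rewrite /shv !nth_nseq !if_same; lia.
  rewrite (_ : (_ == shv _ _ j) = (i == j)) // /shv !nth_nseq !if_same -val_eqE /=.
  by have := ltn_ord i; have := ltn_ord j; lia.
rewrite det_trig; last first.
  by apply/is_trig_mxP => i j ij; rewrite mxE E (_ : i == j = false) ?mul0r // -val_eqE ltn_eqF.
apply/prodf_neq0 => i _; rewrite mxE E eqxx mul1r mulf_neq0 ?(quad_char Q) //.
case: (shv _ _ _ == _); rewrite ?mulr1 ?mulr0 ?addr0; last exact: (char0 1).
by rewrite (_ : 2 + 2 = 4%:R :> K); [exact: (char0 3) | ring].
Qed.

(** The sum runs over the [w] free pairs, while the transfer takes place in [w.+1] rows, one for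
    each pair including [(1, -1)]. *)
Lemma transfer_minus w xs a : size a = w -> is_partition a ->
  (forall j, nth 0 a j + size xs + (w.+1 + w.+1) < M)%N ->
  \sum_(p : {ffun 'I_w -> 'I_M}) (\prod_(x <- xs) ((1 - x ^+ 2) * efac (y \o p) x)) *
     (alt (cdiff (y \o p)) (shv 1 a) * alt (cdiff (y \o p)) (shv 1 (nseq w 0%N))) =
  transfer w.+1 (@kminus K w.+1) xs (rcons a 0%N) *
  \sum_(p : {ffun 'I_w -> 'I_M})
     alt (cdiff (y \o p)) (shv 1 (nseq w 0%N)) * alt (cdiff (y \o p)) (shv 1 (nseq w 0%N)).
Proof.
elim: xs a => [|x xs IH] a sa pa ha.
  under eq_bigr do rewrite big_nil mul1r.
  have nS : nseq w.+1 0%N = rcons (nseq w 0%N) 0%N by rewrite -cats1 -(nseqD w 1) addn1.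
  rewrite [transfer _ _ _ _]/transfer nS eqseq_rcons eqxx andbT.
  case: eqP => [->|ne]; first by rewrite mul1r.
  rewrite mul0r; pose f j d : K := y j ^+ d - (y j)^-1 ^+ d.
  rewrite [LHS](sum_alt_alt f f).
  have w0 : (0 < w)%N.
    by rewrite lt0n; apply: contra_notN ne => /eqP w0; case: (a) sa; rewrite w0.
  have a0 : (0 < nth 0 a 0)%N.
    rewrite lt0n; apply: contra_notN ne => /eqP a0.
    apply/(@eq_from_nth _ 0%N) => [|j hj]; first by rewrite size_nseq.
    rewrite nth_nseq if_same; have := partition_le pa (leq0n j); lia.
  rewrite (expand_det_row _ (Ordinal w0)) big1 ?mulr0 // => j _.
  rewrite mxE /shv nth_nseq if_same !addn1 quad_cdiff //=; last first.
    by have := ha 0%N; have := ltn_ord j; rewrite /=; lia.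
  by rewrite gtn_eqF ?mul0r ?oppr0 ?mul0r //; have := ltn_ord j; lia.
pose I0 := \sum_(p : {ffun 'I_w -> 'I_M})
     alt (cdiff (y \o p)) (shv 1 (nseq w 0%N)) * alt (cdiff (y \o p)) (shv 1 (nseq w 0%N)).
transitivity ((1 - x ^+ 2) * (\sum_(b <- up w a) \sum_(c <- down w b)
   wt x a b c * (transfer w.+1 (@kminus K w.+1) xs (rcons c 0%N) * I0))); last first.
  rewrite (@minus_kernel_rcons0 _ w x a (fun c => transfer w.+1 (@kminus K w.+1) xs c * I0)) //.
  rewrite [transfer _ _ _ _]/= mulr_suml; apply: eq_bigr => b _; rewrite mulr_suml.
  by apply: eq_bigr => c _; rewrite mulrA.
transitivity ((1 - x ^+ 2) * \sum_(p : {ffun 'I_w -> 'I_M}) \sum_(b <- up w a) \sum_(c <- down w b)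
   wt x a b c * ((\prod_(x <- xs) ((1 - x ^+ 2) * efac (y \o p) x)) *
     (alt (cdiff (y \o p)) (shv 1 c) * alt (cdiff (y \o p)) (shv 1 (nseq w 0%N))))).
  rewrite mulr_sumr; apply: eq_bigr => p _; rewrite big_cons -!mulrA; congr (_ * _).
  rewrite mulrCA [X in _ * X]mulrA minus_kernel //.
    rewrite mulr_suml mulr_sumr; apply: eq_bigr => b _; rewrite mulr_suml mulr_sumr.
    by apply: eq_bigr => c _; ring.
  by move=> i; exact: (quad_neq0 Q).
congr (_ * _).
rewrite exchange_big; apply: eq_big_seq => b; rewrite mem_up => /and3P[/eqP sb pb v1] /=.
rewrite exchange_big; apply: eq_big_seq => c; rewrite mem_down => /and3P[/eqP sc pc v2] /=.
rewrite -mulr_sumr IH // => j; have := ha j.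
by have := vstripP sa sb v1 j; have := vstripP sc sb v2 j; rewrite /=; lia.
Qed.

Lemma norm_minus w : (w.+1 + w.+1 < M)%N ->
  \sum_(p : {ffun 'I_w -> 'I_M})
     alt (cdiff (y \o p)) (shv 1 (nseq w 0%N)) * alt (cdiff (y \o p)) (shv 1 (nseq w 0%N)) != 0.
Proof.
move=> h; pose f j d : K := y j ^+ d - (y j)^-1 ^+ d.
rewrite [X in X != 0](sum_alt_alt f f) mulf_neq0 //.
  by have := fact_gt0 w; case: (w`!).
have E (i j : 'I_w) : \sum_x f x (shv 1 (nseq w 0%N) i) * f x (shv 1 (nseq w 0%N) j) =
   - ((i == j)%:R * 2 * M%:R).
  rewrite /shv !nth_nseq !if_same !addn1 quad_cdiff //; last by lia.
  rewrite (_ : (_ == _ :> nat) = (i == j)) // -val_eqE /=.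
  by have := ltn_ord i; have := ltn_ord j; lia.
rewrite det_trig; last first.
  by apply/is_trig_mxP => i j ij; rewrite mxE E (_ : i == j = false) ?mul0r ?oppr0 // -val_eqE ltn_eqF.
apply/prodf_neq0 => i _; rewrite mxE E eqxx mul1r oppr_eq0 mulf_neq0 ?(quad_char Q) //.
Qed.

End Integration.

Definition fcons (X : finType) n (x : X) (p : {ffun 'I_n -> X}) : {ffun 'I_n.+1 -> X} :=
  [ffun i => oapp p x (unlift ord0 i)].

Lemma fcons0 (X : finType) n (x : X) (p : {ffun 'I_n -> X}) : fcons x p ord0 = x.
Proof. by rewrite ffunE unlift_none. Qed.

Lemma fconsS (X : finType) n (x : X) (p : {ffun 'I_n -> X}) i : fcons x p (lift ord0 i) = p i.
Proof. by rewrite ffunE liftK. Qed.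

Lemma sum_ffunS (R : nmodType) (X : finType) n (F : {ffun 'I_n.+1 -> X} -> R) :
  \sum_p F p = \sum_x \sum_(p : {ffun 'I_n -> X}) F (fcons x p).
Proof.
rewrite pair_bigA (reindex (fun q : X * {ffun 'I_n -> X} => fcons q.1 q.2)) //=.
exists (fun p : {ffun 'I_n.+1 -> X} => (p ord0, [ffun i => p (lift ord0 i)])) => [[x p] _|p _] /=.
  by rewrite fcons0; congr pair; apply/ffunP => i; rewrite ffunE fconsS.
apply/ffunP => i; case: (unliftP ord0 i) => [j ->|->]; first by rewrite fconsS ffunE.
by rewrite fcons0.
Qed.

(** * The generating identity on each component *)

Section Identities.
Variable K : fieldType.
Hypothesis char0 : forall n, n.+1%:R != 0 :> K.
Variables (M : nat) (y : 'I_M -> K).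
Hypothesis Q : quadrature y.

Let kap_parity a b a' b' : (a <= M)%N -> (b <= M)%N -> (a' <= M)%N -> (b' <= M)%N ->
  odd a = odd a' -> odd b = odd b' -> (odd a != odd b -> (a < b)%N = (a' < b')%N) ->
  kap y a b = kap y a' b'.
Proof.
move=> h1 h2 h3 h4 e1 e2 H; rewrite !kapE // !oddD -e1 -e2.
case: (boolP (odd a (+) odd b)) => o; last by rewrite !mul0r.
have ab : odd a != odd b by move: o; case: (odd a); case: (odd b).
have ne (c d : nat) : odd c != odd d -> (d < c)%N = ~~ (c < d)%N.
  by move=> o'; case: ltngtP => // e; rewrite e eqxx in o'.
by rewrite (ne a b) // H // (ne a' b') // -e1 -e2.
Qed.

Lemma pair_factor (a b : K) : a != 0 -> b != 0 ->
  (b - a) * (b^-1 - a^-1) * ((b^-1 - a) * (a^-1 - b)) =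
  - 1 * ((b + b^-1 - (a + a^-1)) * (b + b^-1 - (a + a^-1))).
Proof. by move=> a0 b0; field; rewrite a0 b0. Qed.

Lemma alt_delta m (z : 'I_m -> K) :
  alt (fun k d => z k ^+ d) (shv 0 (nseq m 0%N)) = rev_sign K m * vdm z.
Proof. by rewrite alt_rev -alt_val; congr (_ * _); apply: eq_alt => i j; rewrite addn0. Qed.

Definition pair_sign w : K := \prod_(i < w) \prod_(j < w | (i < j)%N) - 1.

Lemma pair_sign_neq0 w : pair_sign w != 0.
Proof. by apply/prodf_neq0 => i _; apply/prodf_neq0 => j _; rewrite oppr_eq0 oner_neq0. Qed.

Lemma rev_sign_neq0 m : rev_sign K m != 0.
Proof. by rewrite /rev_sign signr_eq0. Qed.

Lemma vdm_sqr w (Y : 'I_w -> K) :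
  \prod_(i < w) \prod_(j < w | (i < j)%N) (- 1 * ((Y j - Y i) * (Y j - Y i))) =
  pair_sign w * (vdm Y * vdm Y).
Proof.
rewrite /pair_sign /vdm -!big_split; apply: eq_bigr => i _ /=.
by rewrite -!big_split.
Qed.

Section Plus.
Variable w : nat.
Let A (i : 'I_w) j := y j.
Let B (i : 'I_w) j := (y j)^-1.
Let W (i : 'I_w) j := (y j - (y j)^-1)^-1.
Let D0 (p : {ffun 'I_w -> 'I_M}) := alt (csum (y \o p)) (shv 0 (nseq w 0%N)).

Let lead : K := \prod_(d < w) (if d == 0%N :> nat then 2 else 1).
(** The constant relating the weighted Vandermonde determinant to the square of the character
    denominator; it cancels in [plus_identity] once known to be nonzero. *)
Let C : K := rev_sign K (w + w) * (-1) ^+ w * pair_sign w / (lead * lead).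

Let lead_neq0 : lead != 0.
Proof. by apply/prodf_neq0 => d _; case: ifP => _; rewrite ?oner_neq0 //; exact: (char0 1). Qed.

Let C_neq0 : C != 0.
Proof.
by rewrite !mulf_neq0 ?invr_eq0 ?mulf_neq0 ?rev_sign_neq0 ?signr_eq0 ?pair_sign_neq0.
Qed.

(** The Vandermonde determinant of the inverse pairs is a constant times [prod (y - 1/y)] times the
    square of that of the [y + 1/y]. The weight cancels the first product, and the square is that of
    the denominator [D0]. *)
Lemma lam_plus xs : lam A B W xs (shv 0 (nseq (w + w) 0%N)) =
  C * \sum_(p : {ffun 'I_w -> 'I_M}) (\prod_(x <- xs) efac (y \o p) x) * (D0 p * D0 p).
Proof.
rewrite /lam mulr_sumr; apply: eq_bigr => p _.
have y0 i : (y \o p) i != 0 by exact: (quad_neq0 Q).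
have -> : \prod_(x <- xs) \prod_k (1 + x * pairpt A B p k) = \prod_(x <- xs) efac (y \o p) x.
  apply: eq_bigr => x _; rewrite big_split_ord /= -big_split; apply: eq_bigr => i _ /=.
  by rewrite pairpt_l pairpt_r.
rewrite alt_delta vdm_pairs.
have -> : \prod_i (pairpt A B p (rshift w i) - pairpt A B p (lshift w i)) =
    (-1) ^+ w * \prod_i (y (p i) - (y (p i))^-1).
  rewrite (eq_bigr (fun i => (-1) * (y (p i) - (y (p i))^-1))).
    by rewrite big_split /= prodr_const card_ord.
  by move=> i _; rewrite pairpt_l pairpt_r /A /B; ring.
have -> : \prod_(i < w) \prod_(j < w | (i < j)%N)
      ((pairpt A B p (lshift w j) - pairpt A B p (lshift w i)) *
       (pairpt A B p (rshift w j) - pairpt A B p (rshift w i)) *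
       ((pairpt A B p (rshift w j) - pairpt A B p (lshift w i)) *
        (pairpt A B p (rshift w i) - pairpt A B p (lshift w j)))) =
    pair_sign w * (vdm (fun i => y (p i) + (y (p i))^-1) * vdm (fun i => y (p i) + (y (p i))^-1)).
  rewrite -vdm_sqr; apply: eq_bigr => i _; apply: eq_bigr => j _.
  by rewrite !pairpt_l !pairpt_r pair_factor ?y0.
rewrite /D0 alt_csum0 // -/lead.
have WW : (\prod_i W i (p i)) * \prod_i (y (p i) - (y (p i))^-1) = 1.
  by rewrite -big_split big1 // => i _ /=; rewrite mulVf // (quad_regular Q).
rewrite -[vdm (fun i => (y \o p) i + ((y \o p) i)^-1)]/(vdm (fun i => y (p i) + (y (p i))^-1)).
set V := vdm _; set P := \prod_(x <- xs) _; rewrite /C.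
set r := rev_sign K (w + w); set s := pair_sign w; set e := (-1) ^+ w.
transitivity ((\prod_i W i (p i) * \prod_i (y (p i) - (y (p i))^-1)) * (P *
    (r * e * s * (V * V)))); first by ring.
rewrite WW.
transitivity ((rev_sign K w * rev_sign K w) * (lead * lead / (lead * lead)) *
   (P * (r * e * s * (V * V)))); last by ring.
by rewrite rev_sign_sqr divff ?mulf_neq0 // !mul1r.
Qed.

(** [lam] at [t :: xs] is evaluated by strips and by characters, and the common nonzero factor is
    cancelled. The bound is [M.-1] because [t] is one more variable. *)
Lemma plus_identity xs t : (0 < w)%N -> (size xs + (w + w) < M.-1)%N ->
  chain (w + w) (fun b => t ^+ count odd b + t ^+ count (predC odd) b) xs (nseq (w + w) 0%N) =
  transfer w (@kplus K w) (t :: xs) (nseq w 0%N).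
Proof.
move=> w0 hM; have hM' : (w + w < M)%N by lia.
have tr ys : (size ys + (w + w) < M)%N -> lam A B W ys (shv 0 (nseq (w + w) 0%N)) =
    C * (transfer w (@kplus K w) ys (nseq w 0%N) * \sum_p D0 p * D0 p).
  move=> h; rewrite lam_plus transfer_plus ?size_nseq ?partition_nseq0 // => j.
  by rewrite nth_nseq if_same.
have hM1 : (size xs + (w + w) < M)%N by lia.
have H := @lam_last K char0 w _ A B W M (fun=> 1) xs t w0 hM1 (fun _ => kap_parity)
  (fun _ a b => etrans (kapSS Q a b) (esym (mul1r _))).
have hM2 : (size (t :: xs) + (w + w) < M)%N by rewrite /=; lia.
rewrite (tr _ hM2) (tr [::] hM') [transfer _ _ [::] _]/transfer eqxx mul1r in H.
have nz : C * (\sum_p D0 p * D0 p) != 0 by rewrite mulf_neq0 // norm_plus.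
apply: (mulfI nz); rewrite -[RHS]mulrA [X in _ = _ * X]mulrC H; congr (_ * _).
apply: (@eq_chain _ _ _ _ _ _ 0) => [|||b _ _ _]; rewrite ?size_nseq ?partition_nseq0 //.
  by move=> j; rewrite nth_nseq if_same.
by rewrite big1_eq mul1r.
Qed.

End Plus.
Lemma prod_pairsS w (F : 'I_w.+1 -> 'I_w.+1 -> K) :
  \prod_(i < w.+1) \prod_(j < w.+1 | (i < j)%N) F i j =
  (\prod_(j < w) F ord0 (lift ord0 j)) *
  \prod_(i < w) \prod_(j < w | (i < j)%N) F (lift ord0 i) (lift ord0 j).
Proof.
rewrite big_ord_recl; congr (_ * _).
  by rewrite [LHS]big_mkcond [LHS]big_ord_recl /= mul1r.
apply: eq_bigr => i _; rewrite [LHS]big_mkcond [LHS]big_ord_recl /= mul1r.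
by rewrite [RHS]big_mkcond; apply: eq_bigr => j _; rewrite /= /bump !leq0n !add1n ltnS.
Qed.

(** Against the pair [(1, -1)] each inverse pair contributes an extra square of [y - 1/y]; this
    turns the even orthogonal density into the symplectic one. *)
Lemma pair_factor0 (b : K) : b != 0 ->
  (b - 1) * (b^-1 - -1) * ((b^-1 - 1) * (-1 - b)) = (b - b^-1) * (b - b^-1).
Proof. by move=> b0; field; rewrite b0. Qed.

Section Minus.
Variable w : nat.
(* The pair (1, -1) has index [ord0]. *)
Let A (i : 'I_w.+1) j := if i == ord0 then 1 else y j.
Let B (i : 'I_w.+1) j := if i == ord0 then -1 else (y j)^-1.
Let W (i : 'I_w.+1) j := if i == ord0 then 1 else (y j - (y j)^-1)^-1.
Let e (i : 'I_w.+1) : K := if i == ord0 then -1 else 1.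
Let D0 (p : {ffun 'I_w -> 'I_M}) := alt (cdiff (y \o p)) (shv 1 (nseq w 0%N)).
Let C : K := M%:R * (rev_sign K (w.+1 + w.+1) * (-1 - 1) * (-1) ^+ w * pair_sign w).

Let C_neq0 : C != 0.
Proof.
rewrite !mulf_neq0 ?(quad_char Q) ?rev_sign_neq0 ?signr_eq0 ?pair_sign_neq0 //.
by rewrite -opprD oppr_eq0; exact: (char0 1).
Qed.

(** The pair [(1, -1)] does not depend on the point attached to [ord0], so summing over that
    coordinate gives the factor [M] in [C]. *)
Lemma lam_minus xs : lam A B W xs (shv 0 (nseq (w.+1 + w.+1) 0%N)) =
  C * \sum_(p : {ffun 'I_w -> 'I_M})
        (\prod_(x <- xs) ((1 - x ^+ 2) * efac (y \o p) x)) * (D0 p * D0 p).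
Proof.
rewrite /lam sum_ffunS /C -mulrA mulr_natl; set Z := _ * _; transitivity (\sum_(j0 : 'I_M) Z).
  2: by rewrite sumr_const card_ord.
apply: eq_bigr => j0 _; rewrite /Z {Z}.
rewrite mulr_sumr; apply: eq_bigr => p _; set q := fcons j0 p.
have y0 i : (y \o p) i != 0 by exact: (quad_neq0 Q).
have l0 : pairpt A B q (lshift w.+1 ord0) = 1 by rewrite pairpt_l.
have r0 : pairpt A B q (rshift w.+1 ord0) = -1 by rewrite pairpt_r.
have lS i : pairpt A B q (lshift w.+1 (lift ord0 i)) = y (p i) by rewrite pairpt_l /q fconsS.
have rS i : pairpt A B q (rshift w.+1 (lift ord0 i)) = (y (p i))^-1 by rewrite pairpt_r /q fconsS.
have -> : \prod_(x <- xs) \prod_k (1 + x * pairpt A B q k) =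
    \prod_(x <- xs) ((1 - x ^+ 2) * efac (y \o p) x).
  apply: eq_bigr => x _; rewrite big_split_ord /= -big_split big_ord_recl /= l0 r0.
  congr (_ * _); first by ring.
  by apply: eq_bigr => i _; rewrite /= lS rS.
rewrite alt_delta vdm_pairs.
have -> : \prod_i (pairpt A B q (rshift w.+1 i) - pairpt A B q (lshift w.+1 i)) =
    (-1 - 1) * ((-1) ^+ w * \prod_i (y (p i) - (y (p i))^-1)).
  rewrite big_ord_recl l0 r0; congr (_ * _).
  rewrite (eq_bigr (fun i => (-1) * (y (p i) - (y (p i))^-1))).
    by rewrite big_split /= prodr_const card_ord.
  by move=> i _; rewrite lS rS; ring.
have -> : \prod_i W i (q i) = \prod_i (y (p i) - (y (p i))^-1)^-1.
  by rewrite big_ord_recl mul1r; apply: eq_bigr => i _; rewrite /q fconsS.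
have -> : \prod_(i < w.+1) \prod_(j < w.+1 | (i < j)%N)
      ((pairpt A B q (lshift w.+1 j) - pairpt A B q (lshift w.+1 i)) *
       (pairpt A B q (rshift w.+1 j) - pairpt A B q (rshift w.+1 i)) *
       ((pairpt A B q (rshift w.+1 j) - pairpt A B q (lshift w.+1 i)) *
        (pairpt A B q (rshift w.+1 i) - pairpt A B q (lshift w.+1 j)))) =
    ((\prod_i (y (p i) - (y (p i))^-1)) * (\prod_i (y (p i) - (y (p i))^-1))) *
    (pair_sign w * (vdm (fun i => y (p i) + (y (p i))^-1) * vdm (fun i => y (p i) + (y (p i))^-1))).
  rewrite prod_pairsS -vdm_sqr; congr (_ * _).
    by rewrite -big_split; apply: eq_bigr => i _; rewrite l0 r0 lS rS pair_factor0 ?y0.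
  apply: eq_bigr => i _; apply: eq_bigr => j _.
  by rewrite !lS !rS pair_factor ?y0.
rewrite /D0 alt_cdiff0 //.
have WW : (\prod_i (y (p i) - (y (p i))^-1)^-1) * \prod_i (y (p i) - (y (p i))^-1) = 1.
  by rewrite -big_split big1 // => i _ /=; rewrite mulVf // (quad_regular Q).
rewrite -[vdm (fun i => (y \o p) i + ((y \o p) i)^-1)]/(vdm (fun i => y (p i) + (y (p i))^-1)).
rewrite -[\prod_i ((y \o p) i - ((y \o p) i)^-1)]/(\prod_i (y (p i) - (y (p i))^-1)).
set V := vdm _; set P := \prod_(x <- xs) _.
set r := rev_sign K (w.+1 + w.+1); set s := pair_sign w; set u := (-1) ^+ w.
set Z := \prod_i (y (p i) - (y (p i))^-1) in WW *.
set Zi := \prod_i (y (p i) - (y (p i))^-1)^-1 in WW *.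
transitivity (Zi * Z * (P * (r * (-1 - 1) * u * s * (Z * Z * (V * V))))); first by ring.
rewrite WW.
transitivity (rev_sign K w * rev_sign K w *
   (P * (r * (-1 - 1) * u * s * (Z * Z * (V * V))))); last by ring.
by rewrite rev_sign_sqr.
Qed.

Let mom0 a b : pairmom A B W ord0 a b = M%:R * (-1) ^+ b.
Proof.
rewrite /pairmom (eq_bigr (fun=> (-1) ^+ b)) => [|j _]; last by rewrite expr1n !mul1r.
by rewrite sumr_const card_ord mulr_natl.
Qed.

Let momS i a b : pairmom A B W (lift ord0 i) a b = kap y a b.
Proof. by []. Qed.

Lemma minus_identity xs t : (size xs + (w.+1 + w.+1) < M.-1)%N ->
  chain (w.+1 + w.+1) (fun b => t ^+ count odd b - t ^+ count (predC odd) b) xs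
    (nseq (w.+1 + w.+1) 0%N) =
  transfer w.+1 (@kminus K w.+1) (t :: xs) (nseq w.+1 0%N).
Proof.
move=> hM; have hM' : (w.+1 + w.+1 < M)%N by lia.
have nS : nseq w.+1 0%N = rcons (nseq w 0%N) 0%N by rewrite -cats1 -(nseqD w 1) addn1.
have tr ys : (size ys + (w.+1 + w.+1) < M)%N ->
    lam A B W ys (shv 0 (nseq (w.+1 + w.+1) 0%N)) =
    C * (transfer w.+1 (@kminus K w.+1) ys (nseq w.+1 0%N) * \sum_p D0 p * D0 p).
  move=> h; rewrite lam_minus transfer_minus ?size_nseq ?partition_nseq0 -?nS // => j.
  by rewrite nth_nseq if_same.
have hM1 : (size xs + (w.+1 + w.+1) < M)%N by lia.
have par i a b a' b' : (a <= M)%N -> (b <= M)%N -> (a' <= M)%N -> (b' <= M)%N ->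
    odd a = odd a' -> odd b = odd b' -> (odd a != odd b -> (a < b)%N = (a' < b')%N) ->
    pairmom A B W i a b = pairmom A B W i a' b'.
  case: (unliftP ord0 i) => [k ->|->]; first by rewrite !momS; exact: kap_parity.
  by move=> _ _ _ _ _ ob _; rewrite !mom0 -signr_odd ob signr_odd.
have sh i a b : pairmom A B W i a.+1 b.+1 = e i * pairmom A B W i a b.
  case: (unliftP ord0 i) => [k ->|->]; first by rewrite !momS (kapSS Q) mul1r.
  by rewrite !mom0 /e eqxx exprS mulrCA.
have H := @lam_last K char0 w.+1 _ A B W M e xs t isT hM1 par sh.
have hM2 : (size (t :: xs) + (w.+1 + w.+1) < M)%N by rewrite /=; lia.
rewrite (tr _ hM2) (tr [::] hM') [transfer _ _ [::] _]/transfer eqxx mul1r in H.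
have nz : C * (\sum_p D0 p * D0 p) != 0 by rewrite mulf_neq0 // norm_minus.
apply: (mulfI nz); rewrite -[RHS]mulrA [X in _ = _ * X]mulrC H; congr (_ * _).
apply: (@eq_chain _ _ _ _ _ _ 0) => [|||b _ _ _]; rewrite ?size_nseq ?partition_nseq0 //.
  by move=> j; rewrite nth_nseq if_same.
(* The shift factors multiply to [-1], contributed by the pair [(1, -1)]. *)
by rewrite big_ord_recl big1_eq mulr1 mulN1r.
Qed.

End Minus.
End Identities.

(** * Semistandard tableaux as chains of vertical strips *)

Section Chains.
Variable m : nat.
Implicit Types (n k : nat) (a : seq nat) (c : 'I_m).

(** [b i c] tells whether letter [i] occurs in column [c], so this is the part of column [c] filled
    by the first [k] letters. *)
Definition mu n (b : {ffun 'I_n -> {ffun 'I_m -> bool}}) k c : nat :=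
  (\sum_(i < n | (i < k)%N) b i c)%N.

Definition height n a (b : {ffun 'I_n -> {ffun 'I_m -> bool}}) k : seq nat :=
  fseq (fun c : 'I_m => nth 0 a c + mu b k c)%N.

Definition ballot n a (b : {ffun 'I_n -> {ffun 'I_m -> bool}}) : bool :=
  [forall k : 'I_n.+1, is_partition (height a b k)].

Lemma mu_fcons n s (b : {ffun 'I_n -> {ffun 'I_m -> bool}}) k c :
  mu (fcons s b) k.+1 c = (s c + mu b k c)%N.
Proof.
rewrite /mu big_mkcond big_ord_recl /= fcons0; congr addn; rewrite [RHS]big_mkcond.
by apply: eq_bigr => i _; rewrite fconsS /= /bump leq0n add1n ltnS.
Qed.

Lemma mu0 n (b : {ffun 'I_n -> {ffun 'I_m -> bool}}) c : mu b 0 c = 0%N.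
Proof. by rewrite /mu big1. Qed.

Lemma height0 n a (b : {ffun 'I_n -> {ffun 'I_m -> bool}}) : size a = m -> height a b 0 = a.
Proof.
by move=> sa; rewrite -[RHS](fseq_nth sa); apply: eq_map => c; rewrite mu0 addn0.
Qed.

Lemma height_fcons n a s (b : {ffun 'I_n -> {ffun 'I_m -> bool}}) k :
  height a (fcons s b) k.+1 = height (fseq (fun c => nth 0 a c + s c)%N) b k.
Proof. by apply: eq_map => c; rewrite mu_fcons nth_fseq addnA. Qed.

Lemma ballot_fcons n a s (b : {ffun 'I_n -> {ffun 'I_m -> bool}}) : size a = m ->
  is_partition a -> ballot a (fcons s b) = ballot (fseq (fun c => nth 0 a c + s c)%N) b.
Proof.
move=> sa pa.
rewrite /ballot (forall_ordS n.+1 (fun k => is_partition (height a (fcons s b) k))).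
by rewrite height0 // pa; apply: eq_forallb => k; rewrite height_fcons.
Qed.

Lemma sum_ballot (K : fieldType) n (x : 'I_n -> K) (Phi : seq nat -> K) a :
  size a = m -> is_partition a ->
  \sum_(b : {ffun 'I_n -> {ffun 'I_m -> bool}} | ballot a b)
     (\prod_i x i ^+ (\sum_c b i c)) * Phi (height a b n) =
  chain m Phi [seq x i | i <- enum 'I_n] a.
Proof.
elim: n x a => [|n IH] x a sa pa.
  have b0 : ({ffun 'I_0 -> {ffun 'I_m -> bool}}) by exact: [ffun => [ffun => false]].
  rewrite enum_ord0 (big_pred1 b0) => [|b]; first by rewrite big_ord0 mul1r height0.
  have -> : b = b0 by apply/ffunP => -[].
  by rewrite /= eqxx; apply/forallP => -[[|//] h]; rewrite height0.
rewrite enum_ordSl /= -map_comp big_up [LHS]big_mkcond sum_ffunS; apply: eq_bigr => s _ /=.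
set a1 := fseq _; have sa1 : size a1 = m by rewrite size_fseq.
have e1 : (sumn a1 - sumn a)%N = (\sum_c s c)%N.
  by rewrite sumn_fseq big_split /= -(sumn_nth sa) addKn.
case: ifPn => pa1; last first.
  rewrite big1 // => b _; rewrite ballot_fcons // ifN //; apply: contra pa1 => /forallP/(_ ord0).
  by rewrite height0.
rewrite -(IH (fun i => x (lift ord0 i)) a1 sa1 pa1) e1 mulr_sumr [RHS]big_mkcond.
apply: eq_bigr => b _; rewrite ballot_fcons // -/a1; case: ifP => // _.
rewrite big_ord_recl fcons0 height_fcons -mulrA; congr (_ * (_ * _)).
by apply: eq_bigr => i _; rewrite fconsS.
Qed.

Lemma leq_mu n (b : {ffun 'I_n -> {ffun 'I_m -> bool}}) k k' c :
  (k <= k')%N -> (mu b k c <= mu b k' c)%N.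
Proof.
move=> h; rewrite /mu big_mkcond [X in (_ <= X)%N]big_mkcond; apply: leq_sum => i _.
by case: ifP => // h1; rewrite (leq_trans h1 h).
Qed.

Lemma mu_S n (b : {ffun 'I_n -> {ffun 'I_m -> bool}}) (i : 'I_n) c :
  mu b i.+1 c = (mu b i c + b i c)%N.
Proof.
rewrite /mu (bigD1 i) //= addnC; congr (_ + _)%N; apply: eq_bigl => j.
by rewrite -val_eqE /=; lia.
Qed.

Lemma mu_le n (b : {ffun 'I_n -> {ffun 'I_m -> bool}}) k c : (mu b k c <= n)%N.
Proof.
suff : (mu b k c <= \sum_(i < n) 1)%N by rewrite sum1_card card_ord.
rewrite /mu big_mkcond; apply: leq_sum => i _.
by case: ifP => // _; case: (b i c).
Qed.

Lemma mu_inj n (b b' : {ffun 'I_n -> {ffun 'I_m -> bool}}) :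
  (forall k c, (k <= n)%N -> mu b k c = mu b' k c) -> b = b'.
Proof.
move=> H; apply/ffunP => i; apply/ffunP => c.
have := H i.+1 c (ltn_ord i); rewrite !mu_S H; last exact: ltnW.
by move/addnI; case: (b i c); case: (b' i c).
Qed.

End Chains.

(** Turns a comparison with a count into a test of the predicate; heights of columns and entries of
    tableaux are both read off in this way. *)
Lemma sum_downclosed N (P : pred nat) r : (forall i, P i.+1 -> P i) -> (forall i, P i -> i < N)%N ->
  (r < \sum_(i < N) P i)%N = P r.
Proof.
move=> dc bd; pose s := fseq (fun i : 'I_N => P i : nat).
have ns i : nth 0%N s i = P i.
  case: (ltnP i N) => h; first by rewrite -[i]/(val (Ordinal h)) nth_fseq.
  rewrite nth_default ?size_fseq //; case e: (P i) => //; have := bd _ e; lia.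
have ps : is_partition s.
  by apply/partitionP => j; rewrite !ns; have := dc j; case: (P j.+1) => // ->.
have -> : (\sum_(i < N) P i)%N = len s.
  rewrite /len /s /fseq count_map -sum1_count big_enum_cond [RHS]big_mkcond /=.
  by apply: eq_bigr => i _; case: (P i).
by rewrite ltn_len // ns; case: (P r).
Qed.

Lemma eq_ltn (x y : nat) : (forall r, (r < x) = (r < y))%N -> x = y.
Proof. by move=> H; case: (ltngtP x y) => // h; have := H _; [move/(_ x)|move/(_ y)]; rewrite h ltnn. Qed.

(** * Semistandard tableaux coded by their columns *)

Section Tableaux.
Variables (n0 m : nat) (l : seq nat).
Let n := n0.+1.
Hypotheses (sl : size l = n) (pl : is_partition l) (hd : (head 0 l <= m)%N).
Implicit Types (t : {ffun cell l -> 'I_n}) (b : {ffun 'I_n -> {ffun 'I_m -> bool}}).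
Implicit Types (u v : cell l) (c : 'I_m).

Definition colm u : 'I_m := widen_ord hd (val u).2.

Lemma colmE u : colm u = cell_col u :> nat. Proof. by []. Qed.

Lemma cell_lt u : (cell_col u < nth 0 l (cell_row u))%N.
Proof. exact: valP u. Qed.

Lemma cell_row_lt u : (cell_row u < n)%N.
Proof. by rewrite -sl; exact: ltn_ord. Qed.

Lemma cellP r (c : nat) : (c < nth 0 l r)%N -> exists u, cell_row u = r /\ cell_col u = c.
Proof.
move=> h; have hr : (r < size l)%N.
  by rewrite ltnNge; apply: contraTN h => h; rewrite nth_default.
have hc : (c < head 0%N l)%N.
  by rewrite -nth0; apply: leq_trans h (partition_le pl (leq0n r)).
have P : ((Ordinal hc : nat) < nth 0 l (Ordinal hr))%N by [].
by exists (Sub (Ordinal hr, Ordinal hc) P).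
Qed.

Lemma cell_inj u v : cell_row u = cell_row v -> cell_col u = cell_col v -> u = v.
Proof.
case: u v => -[r c] p [[r' c'] p'] /= e e'; apply: val_inj => /=.
by congr pair; apply: val_inj.
Qed.

Lemma semistandard_col t u v : semistandard t -> cell_col u = cell_col v ->
  (cell_row u < cell_row v)%N -> (t u < t v)%N.
Proof.
by move=> /forallP/(_ u)/forallP/(_ v)/andP[_ /implyP H] e h; apply: H; rewrite e eqxx.
Qed.

Lemma semistandard_row t u v : semistandard t -> cell_row u = cell_row v ->
  (cell_col u < cell_col v)%N -> (t u <= t v)%N.
Proof.
by move=> /forallP/(_ u)/forallP/(_ v)/andP[/implyP H _] e h; apply: H; rewrite e eqxx.
Qed.

Definition enc t : {ffun 'I_n -> {ffun 'I_m -> bool}} :=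
  [ffun i => [ffun c => [exists u, (colm u == c) && (t u == i)]]].

Definition tabval b u : nat := (\sum_(k < n) (mu b k.+1 (colm u) <= cell_row u))%N.

Definition dect b : {ffun cell l -> 'I_n} := [ffun u => inord (tabval b u)].

(* The entry in row r and column c is the step at which the column height
   passes r. *)
Lemma dect_lt b u k : (k <= n)%N -> (cell_row u < mu b n (colm u))%N ->
  (dect b u < k)%N = (cell_row u < mu b k (colm u))%N.
Proof.
move=> hk hu; pose P k := (k < n)%N && (mu b k.+1 (colm u) <= cell_row u)%N.
have E : tabval b u = (\sum_(k < n) P k)%N.
  by apply: eq_bigr => i _; rewrite /P ltn_ord.
have S j : (j < tabval b u)%N = P j.
  rewrite E sum_downclosed // => [i|i]; last by case/andP.
  move=> /andP[h1 h2]; rewrite /P (ltnW h1) /=; apply: leq_trans h2; exact: leq_mu.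
have tn : (tabval b u < n)%N.
  by rewrite ltnS leqNgt S /P ltnSn /= -ltnNge.
rewrite ffunE inordK //; case: k hk => [|k] hk; first by rewrite mu0 !ltn0.
by rewrite ltnS leqNgt S /P hk /= -ltnNge.
Qed.

Section Encode.
Variable t : {ffun cell l -> 'I_n}.
Hypothesis st : semistandard t.

Lemma column_inj u v : cell_col u = cell_col v -> t u = t v -> u = v.
Proof.
move=> e et; apply: cell_inj => //.
by case: (ltngtP (cell_row u) (cell_row v)) => // h;
  [have := semistandard_col st e h | have := semistandard_col st (esym e) h]; rewrite et ltnn.
Qed.

(** Columns are strict, so a letter occupies at most one cell of a column and letters can be counted
    as cells. *)
Lemma mu_enc_card k c : mu (enc t) k c = #|[set u | (colm u == c) && (t u < k)%N]|.
Proof.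
rewrite -(card_in_imset (f := t)) => [|u v]; last first.
  rewrite !inE => /andP[/eqP eu _] /andP[/eqP ev _]; apply: column_inj.
  by rewrite -!colmE eu ev.
rewrite /mu -sum1_card big_mkcond [RHS]big_mkcond; apply: eq_bigr => i _; rewrite !ffunE.
have -> : (i \in [set t u | u in [set u | (colm u == c) && (t u < k)%N]]) =
    (i < k)%N && [exists u, (colm u == c) && (t u == i)].
  apply/imsetP/andP => [[u]|[h /existsP[u /andP[ec /eqP et]]]].
    by rewrite inE => /andP[ec h] ->; split=> //; apply/existsP; exists u; rewrite ec eqxx.
  by exists u => //; rewrite inE ec et.
by case: ifP => // _; case: [exists _, _].
Qed.

(** The cells of a column with entries below [k] form an initial segment, so their number decides
    which rows belong to it. *)
Lemma mu_enc_lt k c r :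
  (r < mu (enc t) k c)%N = [exists u, [&& cell_row u == r, colm u == c & (t u < k)%N]].
Proof.
rewrite mu_enc_card; set D := [set _ | _].
pose row u : 'I_n := Ordinal (cell_row_lt u).
have -> : #|D| = #|row @: D|.
  rewrite card_in_imset // => u v; rewrite !inE => /andP[/eqP eu _] /andP[/eqP ev _] er.
  by apply: cell_inj; [exact: (congr1 val er) | rewrite -!colmE eu ev].
pose P r := [exists u, [&& cell_row u == r, colm u == c & (t u < k)%N]].
rewrite -[RHS]/(P r) -(@sum_downclosed n P) => [|i /existsP[u /and3P[/eqP er /eqP ec h]]|i]; last 2 first.
- have hu := cell_lt u; rewrite er in hu.
  have [v [vr vc]] := cellP (leq_trans hu (partition_le pl (leqnSn i))).
  apply/existsP; exists v; rewrite vr eqxx -val_eqE /= -[val (val v).2]/(cell_col v) vc.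
  rewrite -[cell_col u]/(val (colm u)) ec eqxx /= (leq_trans _ h) // ltnS ltnW //.
  by apply: semistandard_col => //; rewrite er vr.
- by case/existsP => u /and3P[/eqP <- _ _]; exact: cell_row_lt.
congr (_ < _)%N; rewrite -sum1_card big_mkcond; apply: eq_bigr => i _.
have -> : (i \in row @: D) = P i.
  apply/imsetP/existsP => [[u]|[u /and3P[/eqP er ec h]]].
    by rewrite inE => /andP[ec h] ->; exists u; rewrite eqxx ec h.
  by exists u; [rewrite inE ec h | apply: val_inj].
by case: (P i).
Qed.

Lemma mu_enc_full c r : (r < mu (enc t) n c)%N = (c < nth 0 l r)%N.
Proof.
rewrite mu_enc_lt; apply/existsP/idP => [[u /and3P[/eqP <- /eqP <- _]]|h]; first exact: cell_lt.
by have [u [er ec]] := cellP h; exists u; rewrite er eqxx ltn_ord andbT -val_eqE /= -ec.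
Qed.

(** If a column had more entries below [k] than its left neighbour, the cell to the left of the
    first excess one would also have an entry below [k], since rows increase weakly. *)
Lemma ballot_enc : ballot (nseq m 0%N) (enc t).
Proof.
apply/forallP => k; apply: contraT => /fseq_partitionPn[c [c' [e]]].
rewrite !nth_nseq !if_same !add0n mu_enc_lt => /existsP[v /and3P[/eqP er /eqP ec h]].
have hv := cell_lt v; have ec' : cell_col v = c' by rewrite -ec.
rewrite ec' er in hv.
have lt : (c < nth 0 l (mu (enc t) k c))%N by apply: leq_trans hv; rewrite e.
have [u [ur uc]] := cellP lt.
suff : (mu (enc t) k c < mu (enc t) k c)%N by rewrite ltnn.
rewrite mu_enc_lt; apply/existsP; exists u; rewrite ur eqxx -val_eqE /= -[val (val u).2]/(cell_col u) uc eqxx /=.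
by apply: leq_ltn_trans h; apply: semistandard_row; rewrite ?ur ?er // uc ec' e.
Qed.

Lemma dectK : dect (enc t) = t.
Proof.
apply/ffunP => u; apply/eqP; rewrite -val_eqE eqn_leq.
have lt k : (k <= n)%N -> (dect (enc t) u < k)%N = (t u < k)%N.
  move=> hk; rewrite dect_lt //; last by rewrite mu_enc_full; exact: cell_lt.
  rewrite mu_enc_lt; apply/existsP/idP => [[v /and3P[/eqP er /eqP ec]]|h].
    by rewrite (@cell_inj v u) // -!colmE ec.
  by exists u; rewrite !eqxx.
by rewrite -ltnS lt ?ltn_ord // ltnSn /= -ltnS -lt ?ltn_ord.
Qed.

Lemma prod_enc (R : comNzRingType) (x : 'I_n -> R) :
  \prod_u x (t u) = \prod_i x i ^+ (\sum_c enc t i c).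
Proof.
rewrite (partition_big t xpredT) //=; apply: eq_bigr => i _.
rewrite (eq_bigr (fun=> x i)); last by move=> u /eqP->.
rewrite prodr_const; congr (_ ^+ _).
have -> : #|[pred u | t u == i]| = #|colm @: [set u | t u == i]|.
  rewrite card_in_imset; first by apply: eq_card => u; rewrite !inE.
  move=> u v; rewrite !inE => /eqP eu /eqP ev ec; apply: column_inj; last by rewrite eu.
  exact: (congr1 val ec).
rewrite -sum1_card big_mkcond; apply: eq_bigr => c _; rewrite !ffunE.
have -> : (c \in colm @: [set u | t u == i]) = [exists u, (colm u == c) && (t u == i)].
  apply/imsetP/existsP => [[u]|[u /andP[/eqP <- h]]].
    by rewrite inE => h ->; exists u; rewrite eqxx.
  by exists u; rewrite ?inE.
by case: [exists _, _].
Qed.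

End Encode.

Section Decode.
Variable b : {ffun 'I_n -> {ffun 'I_m -> bool}}.
Hypothesis bb : ballot (nseq m 0%N) b.
Hypothesis bl : forall c r, (r < mu b n c)%N = (c < nth 0 l r)%N.

Lemma row_lt_mu u : (cell_row u < mu b n (colm u))%N.
Proof. by rewrite bl; exact: cell_lt. Qed.

(** The ballot condition makes rows weakly increasing; columns are strict because a step adds at
    most one cell to a column. *)
Lemma semistandard_dect : semistandard (dect b).
Proof.
apply/forallP => u; apply/forallP => v; apply/andP; split; apply/implyP => /andP[/eqP e h].
  rewrite -ltnS dect_lt ?row_lt_mu // e.
  have : (dect b v < (dect b v).+1)%N by [].
  rewrite dect_lt ?row_lt_mu // => /leq_trans; apply.
  have hv : ((dect b v).+1 < n.+1)%N by rewrite ltnS ltn_ord.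
  have /forallP/(_ (inord (dect b v).+1)) := bb; rewrite (inordK hv) => /partition_le pp.
  have := pp (colm u) (colm v) (ltnW h).
  by rewrite !nth_fseq !nth_nseq !if_same !add0n.
rewrite dect_lt ?row_lt_mu //; last exact: ltnW.
have euv : colm u = colm v by apply: val_inj; exact: e.
have : (dect b v < (dect b v).+1)%N by [].
rewrite dect_lt ?row_lt_mu // mu_S euv.
by case: (b _ _) => /=; lia.
Qed.

Lemma encK : enc (dect b) = b.
Proof.
apply: mu_inj => k c hk.
suff H r : (r < mu (enc (dect b)) k c)%N = (r < mu b k c)%N.
  exact: eq_ltn.
rewrite mu_enc_lt ?semistandard_dect //; apply/existsP/idP => [[u /and3P[/eqP <- /eqP <-]]|h].
  by rewrite dect_lt ?row_lt_mu.
have hr : (c < nth 0 l r)%N by rewrite -bl; apply: leq_trans h (leq_mu _ _ hk).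
have [u [er ec]] := cellP hr; have ecm : colm u = c by apply: val_inj.
by exists u; rewrite er ecm !eqxx dect_lt ?row_lt_mu // ecm er.
Qed.

End Decode.

(** Says that the final column heights are conjugate to [l] without forming the conjugate. *)
Definition fits b : bool := [forall c, forall r : 'I_n, (r < mu b n c)%N == (c < nth 0 l r)%N].

Lemma fitsP b : reflect (forall c r, (r < mu b n c)%N = (c < nth 0 l r)%N) (fits b).
Proof.
apply: (iffP forallP) => [H c r|H c]; last by apply/forallP => r; rewrite H.
case: (ltnP r n) => hr; first by have /forallP/(_ (Ordinal hr))/eqP := H c.
by rewrite nth_default ?sl // ltn0 ltnNge (leq_trans (mu_le _ _ _) hr).
Qed.

Lemma schur_ballot : schur n l =
  \sum_(b : {ffun 'I_n -> {ffun 'I_m -> bool}} | ballot (nseq m 0%N) b && fits b)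
     \prod_i 'X_i ^+ (\sum_c b i c).
Proof.
rewrite /schur (reindex_onto dect enc) => [|t st]; last exact: dectK.
apply: eq_big => [b|b /andP[st /eqP e]]; last by rewrite (prod_enc st (fun i => 'X_i : {mpoly int[n]})) e.
apply/andP/andP => [[st /eqP e]|[bb /fitsP bl]].
  by rewrite -e ballot_enc //; split=> //; apply/fitsP => c r; rewrite mu_enc_full.
by rewrite semistandard_dect // encK.
Qed.

End Tableaux.

Lemma odd_cols_conj l mu : is_partition l -> is_partition mu ->
  (forall c r, (c < nth 0 l r) = (r < nth 0 mu c))%N -> odd_cols l = count odd mu.
Proof.
move=> pl pm H; have cl j : col_len l j = nth 0%N mu j.
  by apply: eq_ltn => r; rewrite ltn_col_len // H.
have hl : head 0%N l = len mu by apply: eq_ltn => c; rewrite -nth0 H ltn_len.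
rewrite /odd_cols hl; transitivity (\sum_(j < len mu) odd (nth 0 mu j))%N.
  rewrite -sum1_card big_mkcond; apply: eq_bigr => j _; rewrite inE cl.
  by case: (odd _).
have -> : count odd mu = (\sum_(0 <= j < size mu) odd (nth 0 mu j))%N.
  rewrite -sum1_count (big_nth 0%N) [LHS]big_mkcond; apply: eq_bigr => j _.
  by case: (odd _).
rewrite (big_cat_nat (n := len mu)) ?len_size //= big_mkord.
rewrite [X in _ = (_ + X)%N](_ : _ = 0%N) ?addn0 //; rewrite big_nat big1 // => j /andP[h _].
have := ltn_len j pm; rewrite ltnNge h /= => /esym/negbT.
by rewrite -eqn0Ngt => /eqP->.
Qed.

(** * Sums of Schur polynomials as chains of strips *)

Section SchurSum.
Variables (n0 w : nat).
Let n := n0.+1.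
Let m := (2 * w)%N.
Implicit Type b : {ffun 'I_n -> {ffun 'I_m -> bool}}.

Definition final b : seq nat := height (nseq m 0%N) b n.

Definition conj b : n.-tuple 'I_m.+1 := [tuple inord (col_len (final b) r) | r < n].

Lemma nth_final b (c : 'I_m) : nth 0%N (final b) c = mu b n c.
Proof. by rewrite nth_fseq nth_nseq if_same. Qed.

Lemma partition_final b : ballot (nseq m 0%N) b -> is_partition (final b).
Proof. by move/forallP/(_ ord_max). Qed.

Lemma nth_conj b c r : ballot (nseq m 0%N) b ->
  (c < nth 0 (map val (conj b)) r)%N = (r < nth 0 (final b) c)%N.
Proof.
move=> bb; case: (ltnP r n) => hr; last first.
  have -> : nth 0%N (map val (conj b)) r = 0%N by rewrite nth_default // size_map size_tuple.
  rewrite ltn0; apply/esym/negbTE; rewrite -leqNgt.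
  case: (ltnP c m) => hc; last by rewrite nth_default ?size_fseq.
  by rewrite -[c]/(val (Ordinal hc)) nth_final; apply: leq_trans (mu_le _ _ _) hr.
rewrite (nth_map ord0) ?size_tuple //= (nth_map (Ordinal hr)) ?size_tuple ?card_ord //.
rewrite [nth _ (enum _) _](_ : _ = Ordinal hr) ?inordK ?ltn_col_len ?partition_final //.
  by rewrite ltnS (leq_trans (count_size _ _)) // size_fseq.
by apply: val_inj; rewrite /= nth_enum_ord.
Qed.

Lemma partition_conj b : ballot (nseq m 0%N) b -> is_partition (map val (conj b)).
Proof.
move=> bb; apply/partitionP => r; rewrite leqNgt; apply/negP => h.
have := nth_conj (nth 0%N (map val (conj b)) r) r.+1 bb; rewrite h => /esym h1.
by have := nth_conj (nth 0%N (map val (conj b)) r) r bb; rewrite ltnn (ltnW h1).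
Qed.

(** Arrays are sorted by the conjugate of their final shape; odd columns of [l] are odd rows of that
    shape. *)
Lemma schur_sum_ballot c : schur_sum n w c =
  \sum_(b : {ffun 'I_n -> {ffun 'I_m -> bool}} |
          ballot (nseq m 0%N) b && (count odd (final b) == c))
     \prod_i 'X_i ^+ (\sum_c b i c).
Proof.
rewrite (partition_big conj (fun l => is_partition (map val l) && (odd_cols (map val l) == c))) /=.
  apply: eq_bigr => l /andP[pl /eqP ol].
  have hl r : (nth 0 (map val l) r <= m)%N.
    case: (ltnP r n) => h; last by rewrite nth_default ?size_map ?size_tuple.
    by rewrite (nth_map ord0) ?size_tuple // -ltnS; exact: ltn_ord.
  have hd : (head 0 (map val l) <= m)%N by rewrite -nth0.
  have sl : size (map val l) = n by rewrite size_map size_tuple.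
  rewrite (schur_ballot sl pl hd); apply: eq_bigl => b.
  case bb: (ballot _ b) => //=.
  apply/(fitsP sl)/andP => [bl|[_ /eqP <-] c' r]; last first.
    by rewrite nth_conj // nth_final.
  have sc : size (map val (conj b)) = n by rewrite size_map size_tuple.
  have e : conj b = l.
    apply: val_inj; apply: (inj_map val_inj); apply: (@eq_from_nth _ 0%N).
      exact: etrans sc (esym sl).
    move=> r _; apply: eq_ltn => c'; rewrite nth_conj //.
    case: (ltnP c' m) => h; first by rewrite -[c']/(val (Ordinal h)) nth_final bl.
    rewrite [nth _ (final b) _]nth_default ?size_fseq // ltn0; apply/esym/negbTE.
    by rewrite -leqNgt; exact: leq_trans (hl r) h.
  split; last by rewrite e.
  by rewrite -ol -e (odd_cols_conj (mu := final b)) ?partition_conj ?partition_final // => c' r; rewrite nth_conj.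
move=> b /andP[bb /eqP <-]; rewrite partition_conj //=.
by rewrite (odd_cols_conj (mu := final b)) ?partition_conj ?partition_final // => c' r; rewrite nth_conj.
Qed.

Lemma schur_sum_chain (K : fieldType) (phi : {rmorphism {mpoly int[n]} -> K}) c :
  phi (schur_sum n w c) =
  chain m (fun a => (count odd a == c)%:R) [seq phi 'X_i | i <- enum 'I_n] (nseq m 0%N).
Proof.
rewrite -sum_ballot ?size_nseq ?partition_nseq0 // schur_sum_ballot raddf_sum /=.
rewrite big_mkcondr; apply: eq_bigr => b _; rewrite rmorph_prod -/(final b).
under eq_bigr do rewrite rmorphXn.
by case: eqP; rewrite ?mulr1 ?mulr0.
Qed.

End SchurSum.

(** * The first step and comparison of coefficients *)

Section Columns.
Implicit Types (w k j : nat).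

Lemma size_colpart k w : (k <= w)%N -> size (colpart k w) = w.
Proof. by move=> h; rewrite size_cat !size_nseq subnKC. Qed.

Lemma nth_colpart k w j : nth 0%N (colpart k w) j = (j < k)%N.
Proof. by rewrite nth_cat size_nseq !nth_nseq; case: (ltnP j k) => //; rewrite if_same. Qed.

Lemma partition_colpart k w : is_partition (colpart k w).
Proof. by apply/partitionP => j; rewrite !nth_colpart; case: (ltnP j k); case: ltnP; lia. Qed.

Lemma len_colpart k w : len (colpart k w) = k.
Proof. by apply: eq_ltn => j; rewrite ltn_len ?partition_colpart // nth_colpart; case: (j < k)%N. Qed.

Lemma sumn_colpart k w : sumn (colpart k w) = k.
Proof. by rewrite sumn_cat !sumn_nseq mul1n mul0n addn0. Qed.

Lemma colpart_len w b : size b = w -> is_partition b -> (forall j, nth 0 b j <= 1)%N ->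
  b = colpart (len b) w.
Proof.
move=> sb pb hb; have lb : (len b <= w)%N by rewrite -sb len_size.
apply: (@eq_from_nth _ 0%N) => [|j _]; first by rewrite size_colpart.
by rewrite nth_colpart ltn_len //; have := hb j; case: (nth _ b j) => [|[]].
Qed.

Lemma perm_up_zero w : perm_eq (up w (nseq w 0%N)) [seq colpart k w | k <- iota 0 w.+1].
Proof.
have z j : nth 0%N (nseq w 0%N) j = 0%N by rewrite nth_nseq if_same.
apply: uniq_perm; first exact: uniq_up.
  rewrite map_inj_in_uniq ?iota_uniq // => k k' _ _ /(congr1 len).
  by rewrite !len_colpart.
move=> b; apply/idP/mapP => [|[k]].
  rewrite mem_up => /and3P[/eqP sb pb vs]; exists (len b).
    by rewrite mem_iota /= add0n ltnS -sb len_size.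
  apply: colpart_len => // j; have := vstripP (size_nseq w 0%N) sb vs j; rewrite z; lia.
rewrite mem_iota /= add0n ltnS => h ->; rewrite mem_up size_colpart // eqxx partition_colpart /=.
apply/(vstripP (size_nseq w 0%N) (size_colpart h)) => j; rewrite z nth_colpart.
by case: (j < k)%N.
Qed.

Lemma perm_down_colpart k w : (k <= w)%N ->
  perm_eq (down w (colpart k w)) [seq colpart j w | j <- iota 0 k.+1].
Proof.
move=> h; apply: uniq_perm; first exact: uniq_down.
  rewrite map_inj_in_uniq ?iota_uniq // => j j' _ _ /(congr1 len).
  by rewrite !len_colpart.
move=> b; apply/idP/mapP => [|[j]].
  rewrite mem_down => /and3P[/eqP sb pb vs]; exists (len b).
    rewrite mem_iota /= add0n ltnS -(len_colpart k w).
    by apply: (vstrip_len sb) vs; rewrite ?size_colpart ?partition_colpart.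
  apply: colpart_len => // i; have := vstripP sb (size_colpart h) vs i; rewrite nth_colpart.
  by case: (i < k)%N; lia.
rewrite mem_iota /= add0n ltnS => hj ->; have hw := leq_trans hj h.
rewrite mem_down size_colpart // eqxx partition_colpart /=.
apply/(vstripP (size_colpart hw) (size_colpart h)) => i; rewrite !nth_colpart.
by case: (ltnP i j); case: (ltnP i k); lia.
Qed.

Variable K : fieldType.

Lemma transfer_first w (ker : K -> seq nat -> seq nat -> seq nat -> K) t xs :
  transfer w ker (t :: xs) (nseq w 0%N) =
  \sum_(j < w.+1) (\sum_(k < w.+1 | (j <= k)%N) ker t (nseq w 0%N) (colpart k w) (colpart j w)) *
     transfer w ker xs (colpart j w).
Proof.
have E N (F : nat -> K) : \sum_(k <- iota 0 N) F k = \sum_(k < N) F k.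
  by rewrite -(big_mkord xpredT) /index_iota subn0.
rewrite /transfer -/transfer (perm_big _ (perm_up_zero w)) big_map E.
transitivity (\sum_(k < w.+1) \sum_(j < w.+1 | (j <= k)%N)
    ker t (nseq w 0%N) (colpart k w) (colpart j w) * transfer w ker xs (colpart j w)).
  apply: eq_bigr => k _; rewrite (perm_big _ (perm_down_colpart (ltn_ord k : (k <= w)%N))) big_map.
  rewrite E (big_ord_widen w.+1 (fun j => ker t (nseq w 0%N) (colpart k w) (colpart j w) *
     transfer w ker xs (colpart j w)) (ltn_ord k)).
  by apply: eq_bigl => j; rewrite ltnS.
rewrite (exchange_big_dep xpredT) //=; apply: eq_bigr => j _.
by rewrite mulr_suml.
Qed.

Lemma wt_colpart t k j w : (j <= k)%N ->
  wt t (nseq w 0%N) (colpart k w) (colpart j w) = t ^+ (2 * k - j) :> K.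
Proof. by move=> h; rewrite /wt !sumn_colpart sumn_nseq mul0n subn0. Qed.

Lemma len_nseq0 w : len (nseq w 0%N) = 0%N.
Proof. by rewrite /len count_nseq mul0n. Qed.

Lemma sum_ends w (j : nat) (G : nat -> K) : (j < w)%N ->
  (forall k, (j < k)%N -> (k < w)%N -> G k = 0) ->
  \sum_(k < w.+1 | (j <= k)%N) G k = G j + G w.
Proof.
move=> h H; rewrite big_mkcond big_ord_recr /= (ltnW h); congr (_ + _).
rewrite (bigD1 (Ordinal h)) //= leqnn big1 ?addr0 // => k ne.
case: ifP => // le; apply: H (ltn_ord k); rewrite ltn_neqAle le andbT.
by move: ne; rewrite -val_eqE /= eq_sym.
Qed.

Lemma sum_last w (G : nat -> K) : \sum_(k < w.+1 | (w <= k)%N) G k = G w.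
Proof.
rewrite big_mkcond big_ord_recr /= leqnn big1 ?add0r // => k _.
by rewrite leqNgt ltn_ord.
Qed.

(** A middle column of length strictly between [j] and [w] is a non-full peak, with coefficient 0.
    Lengths [j] and [w] remain and give [t^j] and [t^(2w-j)]; ending at [(1^w)] is a full rise and
    counts twice. *)
Lemma plus_first_step w t xs : (0 < w)%N ->
  transfer w (@kplus K w) (t :: xs) (nseq w 0%N) =
  \sum_(j < w) (t ^+ j + t ^+ (2 * w - j)) * transfer w (@kplus K w) xs (colpart j w) +
  2 * t ^+ w * transfer w (@kplus K w) xs (colpart w w).
Proof.
move=> w0; rewrite transfer_first big_ord_recr /=; congr (_ + _).
  apply: eq_bigr => j _; congr (_ * _); have hj := ltn_ord j.
  rewrite (@sum_ends w j (fun k => kplus w t (nseq w 0%N) (colpart k w) (colpart j w))) //.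
    rewrite /kplus /peak /full_rise !wt_colpart //; last exact: ltnW.
    rewrite !len_colpart len_nseq0 !ltnn ?(gtn_eqF hj) ?(ltn_eqF hj) !andbF !subr0 !addr0 !mul1r.
    by congr (_ ^+ _ + _); lia.
  move=> k h1 h2; rewrite /kplus /peak /full_rise !len_colpart len_nseq0 h1 h2.
  by rewrite (leq_ltn_trans (leq0n _) h1) (gtn_eqF h1) /= subrr addr0 mul0r.
congr (_ * _).
rewrite (@sum_last w (fun k => kplus w t (nseq w 0%N) (colpart k w) (colpart w w))).
rewrite /kplus /peak /full_rise !wt_colpart // !len_colpart len_nseq0 ltnn !andbF w0 !eqxx /= subr0.
by congr (_ * _ ^+ _); lia.
Qed.

(** The intermediate lengths cancel again; the full peak now has coefficient [-1], and ending at
    [(1^w)] has coefficient 0. *)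
Lemma minus_first_step w t xs : (0 < w)%N ->
  transfer w (@kminus K w) (t :: xs) (nseq w 0%N) =
  \sum_(j < w) (t ^+ j - t ^+ (2 * w - j)) * transfer w (@kminus K w) xs (colpart j w).
Proof.
move=> w0; rewrite transfer_first big_ord_recr /= -[RHS]addr0; congr (_ + _).
  apply: eq_bigr => j _; congr (_ * _); have hj := ltn_ord j.
  rewrite (@sum_ends w j (fun k => kminus w t (nseq w 0%N) (colpart k w) (colpart j w))) //.
    rewrite /kminus /peak !wt_colpart //; last exact: ltnW.
    rewrite !len_colpart len_nseq0 !ltnn !andbF hj subr0 mul1r w0 /= sub0r mulN1r.
    by congr (_ ^+ _ - _); lia.
  move=> k h1 h2; rewrite /kminus /peak !len_colpart len_nseq0 h1 h2.
  by rewrite (leq_ltn_trans (leq0n _) h1) /= subrr mul0r.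
rewrite (@sum_last w (fun k => kminus w t (nseq w 0%N) (colpart k w) (colpart w w))).
by rewrite /kminus /peak !len_colpart len_nseq0 ltnn andbF subrr !mul0r.
Qed.

Lemma chain_sum m I (r : seq I) (f : I -> K) (Phi : I -> seq nat -> K) xs a :
  chain m (fun b => \sum_(i <- r) f i * Phi i b) xs a = \sum_(i <- r) f i * chain m (Phi i) xs a.
Proof.
elim: xs a => [//|x xs IH] a /=.
under eq_bigr do rewrite IH mulr_sumr.
rewrite exchange_big; apply: eq_bigr => i _ /=; rewrite mulr_sumr.
by apply: eq_bigr => b _; rewrite mulrCA.
Qed.

Lemma chain_odd m (f : nat -> K) xs :
  chain m (fun b => f (count odd b)) xs (nseq m 0%N) =
  \sum_(c < m.+1) f c * chain m (fun b => (count odd b == c)%:R) xs (nseq m 0%N).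
Proof.
rewrite -(chain_sum _ _ (fun c : 'I_m.+1 => f c) (fun (c : 'I_m.+1) b => (count odd b == c)%:R)).
apply: (@eq_chain _ _ _ _ _ _ 0) => [|||b sb _ _]; rewrite ?size_nseq ?partition_nseq0 //.
  by move=> j; rewrite nth_nseq if_same.
have h : (count odd b < m.+1)%N by rewrite ltnS -sb count_size.
rewrite (bigD1 (Ordinal h)) //= eqxx mulr1 big1 ?addr0 // => c ne.
rewrite (_ : _ == _ = false) ?mulr0 //; apply: contraNF ne => /eqP e.
by rewrite -val_eqE /= e.
Qed.

Hypothesis char0 : forall n, n.+1%:R != 0 :> K.

(** In characteristic 0 the natural numbers supply more roots than a nonzero polynomial can have. *)
Lemma poly_ext (p q : {poly K}) : (forall t, p.[t] = q.[t]) -> p = q.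
Proof.
move=> H; apply/eqP; rewrite -subr_eq0; apply/negPn/negP => nz.
pose rs := [seq i%:R : K | i <- iota 0 (size (p - q))].
suff : (size rs < size (p - q)%R)%N by rewrite size_map size_iota ltnn.
apply: max_poly_roots => //.
  by apply/allP => x _; rewrite rootE hornerD hornerN H subrr.
rewrite map_inj_uniq ?iota_uniq // => i j.
wlog le : i j / (i <= j)%N.
  by move=> G e; case: (leqP i j) => h; [apply: G | apply/esym; apply: G => //; exact: ltnW].
move/eqP; rewrite eq_sym -subr_eq0 -natrB //; case e: (j - i)%N => [|d]; first by move=> _; lia.
by rewrite (negbTE (char0 d)).
Qed.

Lemma coef_pair (e : K) m (S : nat -> K) k : (k <= m)%N ->
  (\sum_(c < m.+1) S c *: ('X^c + e *: 'X^(m - c)))`_k = S k + e * S (m - k)%N.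
Proof.
move=> h; rewrite coef_sum (eq_bigr (fun c : 'I_m.+1 =>
   (if c == k :> nat then S c else 0) + (if c == (m - k)%N :> nat then e * S c else 0))).
  rewrite big_split /= -!big_mkcond /=.
  have hk : (k < m.+1)%N by []. have hk' : (m - k < m.+1)%N by rewrite ltnS leq_subr.
  by rewrite (big_pred1 (Ordinal hk)) // (big_pred1 (Ordinal hk')).
move=> c _; rewrite coefZ coefD coefZ !coefXn mulrDr; congr (_ + _).
  by rewrite eq_sym; case: eqP; rewrite ?mulr1 ?mulr0.
have -> : (k == (m - c)%N) = (c == (m - k)%N :> nat) by have := ltn_ord c; lia.
by case: eqP => _; rewrite ?mulr1 ?mulr0 // mulrC.
Qed.

(** The exponents [2w - j] exceed [w], so they stay out of the range of [k]; [g] is 2 on the first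
    component and 0 on the second. *)
Lemma coef_half (e g : K) w (F : nat -> K) k : (k <= w)%N ->
  (\sum_(j < w) F j *: ('X^j + e *: 'X^(2 * w - j)) + (g * F w) *: 'X^w)`_k =
  if k == w then g * F w else F k.
Proof.
move=> h; rewrite coefD coef_sum coefZ coefXn.
rewrite (eq_bigr (fun j : 'I_w => if j == k :> nat then F j else 0)); last first.
  move=> j _; rewrite coefZ coefD coefZ !coefXn; have hj := ltn_ord j.
  rewrite (_ : (k == (2 * w - j)%N) = false) ?mulr0 ?addr0; last by lia.
  by rewrite eq_sym; case: eqP; rewrite ?mulr1 ?mulr0.
rewrite -big_mkcond /=; case: eqP => [e1|ne].
  rewrite mulr1 big_pred0 ?add0r // => j; rewrite e1; have := ltn_ord j; lia.
have lt : (k < w)%N by lia.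
by rewrite mulr0 addr0 (big_pred1 (Ordinal lt)).
Qed.

End Columns.

(** * Marked up-down tableaux *)

Section Marked.
Variables (n w : nat) (mu nu : seq nat).
Implicit Type T : udtab n w mu nu.

Lemma tab_wf T i : (i <= 2 * n)%N -> size (tab T i) = w /\ is_partition (tab T i).
Proof.
move=> h; have /and5P[/eqP sT /allP aT _ _ _] := udtabP T.
by have /aT/andP[/eqP -> ->] : tab T i \in udseq T by rewrite mem_nth // sT ltnS.
Qed.

Lemma ell_le T i : (i <= 2 * n)%N -> (ell T i <= w)%N.
Proof. by move=> h; have [s _] := tab_wf T h; rewrite -{2}s len_size. Qed.

Lemma ell_mid T (j : 'I_n) :
  [/\ ell T (2 * j) <= ell T (2 * j).+1, ell T (2 * j).+2 <= ell T (2 * j).+1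
    & ell T (2 * j).+1 <= w]%N.
Proof.
have hj := ltn_ord j; have /and5P[_ _ _ _ /forallP/(_ j)/andP[v1 v2]] := udtabP T.
have [s0 p0] := @tab_wf T (2 * j)%N ltac:(lia).
have [s1 p1] := @tab_wf T (2 * j).+1 ltac:(lia).
have [s2 p2] := @tab_wf T (2 * j).+2 ltac:(lia).
by split; [exact: (vstrip_len s0 s1) | exact: (vstrip_len s2 s1) | apply: ell_le; lia].
Qed.

Section Products.
Variable R : comNzRingType.

(** A non-full peak lies outside [Eset] and makes its factor 0; an element of [Eset] gives 2, the
    choice of marking it or not. *)
Lemma prod_plus T :
  \prod_(j < n) (1 - (length_peak T j && (ell T (2 * j).+1 < w)%N)%:R + (j \in Eset T)%:R) =
  (T \in UDhat n w mu nu)%:R * 2 ^+ #|Eset T| :> R.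
Proof.
case: (boolP (T \in UDhat n w mu nu)); rewrite inE; [move=> /forallP H | move=> /forallPn[j]].
  rewrite mul1r -prodr_const [RHS]big_mkcond; apply: eq_bigr => j _.
  have /implyP := H j; have [_ _ h] := ell_mid T j.
  case: (length_peak T j) => [/(_ isT)/eqP e|_] /=.
    by rewrite e ltnn subr0; case: (j \in _); rewrite ?addr0.
  by rewrite subr0; case: (j \in _); rewrite ?addr0.
rewrite negb_imply => /andP[pk ne]; rewrite mul0r (bigD1 j) //=.
have [_ _ h] := ell_mid T j; rewrite pk ltn_neqAle ne h /= subrr add0r.
have -> : j \in Eset T = false.
  rewrite inE; move: pk; rewrite /length_peak => /andP[_ lt].
  by rewrite (gtn_eqF lt) andbF.
by rewrite mul0r.
Qed.

(** An element of [Eset] makes its factor 0. If there is none, a tableau starting below length [w]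
    is below [w] at all even indices, so every middle partition of length [w] is a full peak, with
    factor [-1]. *)
Lemma prod_minus T : (len mu < w)%N ->
  \prod_(j < n) ((ell T (2 * j).+1 < w)%N%:R - (length_peak T j)%:R) =
  ((T \in UDhat n w mu nu) && (Eset T == set0))%:R * (-1) ^+ npeaks T :> R.
Proof.
move=> hmu; have [E0|/set0Pn[j jE]] := eqVneq (Eset T) set0; last first.
  rewrite andbF mul0r (bigD1 j) //=; move: jE; rewrite inE => /and3P[_ /eqP e1 /eqP e2].
  by rewrite /length_peak e1 e2 ltnn andbF subrr mul0r.
have nE (j : 'I_n) : j \in Eset T = false by rewrite E0 inE.
have lt j : (j <= n)%N -> (ell T (2 * j) < w)%N.
  elim: j => [_|j IH hj].
    by rewrite muln0 /ell /tab; have /and5P[_ _ /eqP -> _ _] := udtabP T.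
  have := IH (ltnW hj); have := nE (Ordinal hj); have [h1 h2 h3] := ell_mid T (Ordinal hj).
  rewrite inE /= in h1 h2 h3 *; rewrite mulnS add2n; lia.
rewrite andbT; case: (boolP (T \in UDhat n w mu nu)); rewrite inE; [move=> /forallP H | move=> /forallPn[j]].
  rewrite mul1r /npeaks -prodr_const [RHS]big_mkcond; apply: eq_bigr => j _; rewrite inE.
  have /implyP := H j; have [h1 h2 h3] := ell_mid T j; have := nE j; rewrite inE.
  have := lt j (ltnW (ltn_ord j)).
  case pk: (length_peak T j) => l0 nEj; first by move=> /(_ isT)/eqP e; rewrite e ltnn sub0r.
  move=> _; rewrite subr0 (_ : _ < _ = true)%N //.
  by move: pk nEj; rewrite /length_peak; lia.
rewrite negb_imply => /andP[pk ne]; rewrite mul0r (bigD1 j) //=.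
by have [_ _ h] := ell_mid T j; rewrite pk ltn_neqAle ne h /= subrr mul0r.
Qed.

End Products.

Lemma sum_subsets (V : zmodType) (A : {set udtab n w mu nu})
    (E : udtab n w mu nu -> {set 'I_n}) (F : udtab n w mu nu -> V) :
  \sum_(TS : marked n w mu nu | (TS.1 \in A) && (TS.2 \subset E TS.1)) F TS.1 =
  \sum_(T in A) F T *+ 2 ^ #|E T|.
Proof.
rewrite -(pair_big_dep (fun T => T \in A) (fun T (S : {set 'I_n}) => S \subset E T) (fun T _ => F T)) /=.
apply: eq_bigr => T _; rewrite sumr_const -card_powerset; congr (_ *+ _).
by apply: eq_card => S; rewrite !inE.
Qed.

Lemma sum_MUDstar :
  \sum_(TS in MUDstar n w mu nu) omega TS.1 =
  \sum_T ((T \in UDhat n w mu nu)%:R * 2 ^+ #|Eset T|) * omega T.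
Proof.
rewrite (eq_bigl (fun TS : marked n w mu nu => (TS.1 \in UDhat n w mu nu) && (TS.2 \subset Eset TS.1))).
  rewrite (sum_subsets _ (fun T => Eset T) (fun T => omega T)) big_mkcond.
  apply: eq_bigr => T _; case: ifP => _; rewrite ?mul0r // mul1r -natrX mulr_natl //.
by move=> TS; rewrite inE.
Qed.

Lemma card_min_set (E : {set 'I_n}) : E != set0 -> #|E :\: min_set E| = #|E|.-1.
Proof.
case/set0Pn => i0 i0E; case: (arg_minnP (fun i : 'I_n => i : nat) i0E) => i iE imin.
have -> : min_set E = [set i].
  apply/setP => j; rewrite !inE; apply/andP/eqP => [[jE /forallP H]|->].
    apply: val_inj; apply/eqP; rewrite eqn_leq imin // andbT.
    by have /implyP := H i; apply.
  by split=> //; apply/forallP => k; apply/implyP; exact: imin.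
by rewrite [in RHS](cardsD1 i) (_ : i \in E).
Qed.

Let hat := UDhat n w mu nu.

(** The factor 2 restores the choice at the minimum of [Eset], which is never marked. *)
Lemma sum_MUD1 : 2 * (\sum_(TS in MUD1 n w mu nu) omega TS.1) =
  \sum_T ((T \in hat) && (Eset T != set0))%:R * 2 ^+ #|Eset T| * omega T.
Proof.
pose A := [set T in hat | Eset T != set0].
rewrite (eq_bigl (fun TS : marked n w mu nu => (TS.1 \in A) &&
    (TS.2 \subset Eset TS.1 :\: min_set (Eset TS.1)))).
  rewrite (sum_subsets _ (fun T => Eset T :\: min_set (Eset T)) (fun T => omega T)) big_mkcond mulr_sumr.
  apply: eq_bigr => T _; rewrite !inE; case: (boolP (_ && _)) => [/andP[_ h]|_]; last first.
    by rewrite !mul0r mulr0.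
  rewrite mul1r card_min_set // -[omega T *+ _]mulr_natl natrX mulrA -exprS prednK //.
  by rewrite card_gt0.
by move=> TS; rewrite !inE andbA.
Qed.

Lemma sum_MUD0 (p : bool) (D : {set marked n w mu nu}) :
  D = [set TS | [&& TS.1 \in hat, Eset TS.1 == set0, odd (npeaks TS.1) == p & TS.2 == set0]] ->
  2 * (\sum_(TS in D) omega TS.1) =
  \sum_T ((T \in hat) && (Eset T == set0))%:R * (1 + (-1) ^+ p * (-1) ^+ npeaks T) * omega T.
Proof.
move=> ->; pose A := [set T in hat | (Eset T == set0) && (odd (npeaks T) == p)].
rewrite (eq_bigl (fun TS : marked n w mu nu => (TS.1 \in A) && (TS.2 \subset set0))).
  rewrite (sum_subsets _ (fun T => set0) (fun T => omega T)) big_mkcond mulr_sumr.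
  apply: eq_bigr => T _; rewrite !inE cards0 expn0 mulr1n -(signr_odd _ (npeaks T)).
  case: [forall j, _] => /=; last by rewrite !mul0r mulr0.
  case: (Eset T == set0) => /=; last by rewrite !mul0r mulr0.
  by rewrite mul1r -signr_addb; case: (odd _); case: (p); rewrite /= ?addrN ?mul0r ?mulr0.
by move=> TS; rewrite !inE subset0 -!andbA.
Qed.

Let plus := \sum_T ((T \in hat)%:R * 2 ^+ #|Eset T|) * omega T.
Let minus := \sum_T (((T \in hat) && (Eset T == set0))%:R * (-1) ^+ npeaks T) * omega T.

(** Tableaux with nonempty [Eset] occur only in [plus]; the others have weight 1 in [plus] and a
    sign in [minus], which combine to twice a parity indicator. *)
Lemma sum_MUD_parity p (D : {set marked n w mu nu}) :
  D = [set TS | [&& TS.1 \in hat, Eset TS.1 == set0, odd (npeaks TS.1) == p & TS.2 == set0]] ->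
  2 * (\sum_(TS in MUD1 n w mu nu :|: D) omega TS.1) = plus + (-1) ^+ p * minus.
Proof.
move=> eD.
have -> : \sum_(TS in MUD1 n w mu nu :|: D) omega TS.1 =
    \sum_(TS in MUD1 n w mu nu) omega TS.1 + \sum_(TS in D) omega TS.1.
  rewrite big_mkcond [X in _ = X + _]big_mkcond [X in _ = _ + X]big_mkcond -big_split /=.
  apply: eq_bigr => TS _; rewrite eD !inE; case: (Eset TS.1 == set0); rewrite /= ?andbF ?orbF.
    by rewrite add0r.
  by rewrite addr0.
rewrite mulrDr sum_MUD1 (sum_MUD0 eD) -big_split /plus /minus mulr_sumr -big_split /=.
apply: eq_bigr => T _; case: (T \in hat) => /=; last by rewrite !mul0r mulr0 !addr0.
by have [->|_] := eqVneq (Eset T) set0; rewrite /= ?cards0 ?expr0; ring.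
Qed.

Lemma sum_MUDee :
  2 * (\sum_(TS in MUDee n w mu nu) omega TS.1) = plus + minus.
Proof.
rewrite (@sum_MUD_parity false) ?expr0 ?mul1r //.
by apply/setP => TS; rewrite !inE eqbF_neg.
Qed.

Lemma sum_MUDeo :
  2 * (\sum_(TS in MUDeo n w mu nu) omega TS.1) = plus - minus.
Proof.
rewrite (@sum_MUD_parity true) ?expr1 ?mulN1r //.
by apply/setP => TS; rewrite !inE eqb_id.
Qed.

End Marked.

(** * Comparing coefficients of the extra variable *)

Section Comparison.
Variables (n0 : nat).
Let n := n0.+1.
Variables (K : fieldType) (phi : {rmorphism {mpoly int[n]} -> K}).
Hypothesis char0 : forall n, n.+1%:R != 0 :> K.
Hypothesis roots : forall N, exists z : K, N.+1.-primitive_root z.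
Let xs := [seq phi 'X_i | i <- enum 'I_n].

Lemma nth_xs (i : 'I_n) : nth 0 xs i = phi 'X_i.
Proof. by rewrite (nth_map i) ?size_enum_ord // nth_ord_enum. Qed.

Lemma transfer_stat w (k : K -> seq nat -> seq nat -> seq nat -> K) a
    (g : udtab n w a (nseq w 0%N) -> int) : size a = w -> is_partition a ->
  (forall T, tab_weight (fun i => k (nth 0 xs i)) T = (g T)%:~R * phi (omega T)) ->
  transfer w k xs a = phi (\sum_T (g T)%:~R * omega T).
Proof.
move=> sa pa H; have sx : size xs = n by rewrite size_map size_enum_ord.
have := sum_updown k xs sa pa; rewrite sx => <-; rewrite raddf_sum; apply: eq_bigr => T _ /=.
by rewrite H rmorphM rmorph_int.
Qed.

Lemma phi_omega w a nu (T : udtab n w a nu) (h : 'I_n -> K) (k : K -> seq nat -> seq nat -> seq nat -> K) :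
  (forall (i : 'I_n) x, k x (tab T (2 * i)) (tab T (2 * i).+1) (tab T (2 * i).+2) =
     h i * wt x (tab T (2 * i)) (tab T (2 * i).+1) (tab T (2 * i).+2)) ->
  tab_weight (fun i => k (nth 0 xs i)) T = (\prod_i h i) * phi (omega T).
Proof.
move=> H; rewrite /tab_weight /omega rmorph_prod -big_split; apply: eq_bigr => i _ /=.
by rewrite H nth_xs rmorphXn.
Qed.

Lemma transfer_kplus w a : size a = w -> is_partition a ->
  transfer w (@kplus K w) xs a =
  phi (\sum_(T : udtab n w a (nseq w 0%N))
         ((T \in UDhat n w a (nseq w 0%N))%:R * 2 ^+ #|Eset T|) * omega T).
Proof.
move=> sa pa; rewrite (@transfer_stat w (@kplus K w) a
  (fun T => (T \in UDhat n w a (nseq w 0%N))%:R * 2 ^+ #|Eset T|)) // => [|T].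
  by congr (phi _); apply: eq_bigr => T _; rewrite intrM rmorphXn /= !rmorph_nat.
rewrite (@phi_omega _ _ _ T (fun j => 1 - (length_peak T j && (ell T (2 * j).+1 < w)%N)%:R +
   (j \in Eset T)%:R)).
  by rewrite prod_plus rmorphM rmorphXn /= !rmorph_nat.
by move=> i x; rewrite /kplus inE.
Qed.

Lemma transfer_kminus w a : size a = w -> is_partition a -> (len a < w)%N ->
  transfer w (@kminus K w) xs a =
  phi (\sum_(T : udtab n w a (nseq w 0%N))
    (((T \in UDhat n w a (nseq w 0%N)) && (Eset T == set0))%:R * (-1) ^+ npeaks T) * omega T).
Proof.
move=> sa pa la; rewrite (@transfer_stat w (@kminus K w) a
  (fun T => ((T \in UDhat n w a (nseq w 0%N)) && (Eset T == set0))%:R * (-1) ^+ npeaks T)) // => [|T].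
  by congr (phi _); apply: eq_bigr => T _; rewrite intrM rmorphXn /= !rmorph_nat rmorphN1.
rewrite (@phi_omega _ _ _ T (fun j => (ell T (2 * j).+1 < w)%N%:R - (length_peak T j)%:R)) //.
by rewrite prod_minus // rmorphM rmorphXn /= !rmorph_nat rmorphN1.
Qed.

Lemma quadrature_exists N : exists M (y : 'I_M -> K), (N < M)%N /\ quadrature y.
Proof.
have [z pz] := roots (2 * (2 * N.+1)).-1; rewrite prednK ?muln_gt0 // in pz.
by exists (2 * N.+1)%N, (fun j => z ^+ (2 * j).+1); split; [lia | exact: root_quadrature].
Qed.

Lemma chain_schur w (e t : K) :
  chain (w + w) (fun b => t ^+ count odd b + e * t ^+ count (predC odd) b) xs (nseq (w + w) 0%N) =
  (\sum_(c < (2 * w).+1) phi (schur_sum n w c) *: ('X^c + e *: 'X^(2 * w - c))).[t].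
Proof.
have -> : (w + w)%N = (2 * w)%N by rewrite mul2n addnn.
rewrite horner_sum.
transitivity (chain (2 * w) (fun b => t ^+ count odd b + e * t ^+ (2 * w - count odd b))
   xs (nseq (2 * w) 0%N)).
  apply: (@eq_chain _ _ _ _ _ _ 0) => [|||b sb _ _]; rewrite ?size_nseq ?partition_nseq0 //.
    by move=> j; rewrite nth_nseq if_same.
  by rewrite -sb -(count_predC odd b) addKn.
rewrite (chain_odd (2 * w) (fun c => t ^+ c + e * t ^+ (2 * w - c))).
by apply: eq_bigr => c _; rewrite (schur_sum_chain w phi) !hornerE mulrC.
Qed.

(** At [k = w] both sides double: the left because [2w - k = k], the right because of the full rise
    in the first step. *)
Lemma compare_plus w k : (0 < w)%N -> (k <= w)%N ->
  phi (schur_sum n w k) + phi (schur_sum n w (2 * w - k)) =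
  (if k == w then 2 else 1) * transfer w (@kplus K w) xs (colpart k w).
Proof.
move=> w0 kw.
have [M [y [hM Q]]] := quadrature_exists (size xs + (w + w)).+1.
have hM1 : (size xs + (w + w) < M.-1)%N by move: (size xs) hM => s; lia.
have E : \sum_(c < (2 * w).+1) phi (schur_sum n w c) *: ('X^c + 1 *: 'X^(2 * w - c)) =
   \sum_(j < w) transfer w (@kplus K w) xs (colpart j w) *: ('X^j + 1 *: 'X^(2 * w - j)) +
   (2 * transfer w (@kplus K w) xs (colpart w w)) *: 'X^w.
  apply: (poly_ext char0) => t; rewrite -chain_schur.
  transitivity (transfer w (@kplus K w) (t :: xs) (nseq w 0%N)).
    rewrite -(plus_identity char0 Q) //.
    apply: (@eq_chain _ _ _ _ _ _ 0) => [|||b sb _ _]; rewrite ?size_nseq ?partition_nseq0 ?mul1r //.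
    by move=> j; rewrite nth_nseq if_same.
  rewrite plus_first_step // !hornerE horner_sum; congr (_ + _); last by ring.
  by apply: eq_bigr => j _; rewrite !hornerE mulrC.
have := congr1 (fun p : {poly K} => p`_k) E.
rewrite (coef_pair 1 (fun c => phi (schur_sum n w c))); last by lia.
rewrite (coef_half 1 2 (fun j => transfer w (@kplus K w) xs (colpart j w))) // mul1r => ->.
by case: eqP => [->|]; rewrite ?mul1r.
Qed.

Lemma compare_minus w k : (k < w)%N ->
  phi (schur_sum n w k) - phi (schur_sum n w (2 * w - k)) =
  transfer w (@kminus K w) xs (colpart k w).
Proof.
case: w => // w kw.
have [M [y [hM Q]]] := quadrature_exists (size xs + (w.+1 + w.+1)).+1.
have hM1 : (size xs + (w.+1 + w.+1) < M.-1)%N by move: (size xs) hM => s; lia.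
have E : \sum_(c < (2 * w.+1).+1) phi (schur_sum n w.+1 c) *: ('X^c + (-1) *: 'X^(2 * w.+1 - c)) =
   \sum_(j < w.+1) transfer w.+1 (@kminus K w.+1) xs (colpart j w.+1) *:
      ('X^j + (-1) *: 'X^(2 * w.+1 - j)) +
   (0 * transfer w.+1 (@kminus K w.+1) xs (colpart w.+1 w.+1)) *: 'X^(w.+1).
  apply: (poly_ext char0) => t; rewrite -chain_schur.
  transitivity (transfer w.+1 (@kminus K w.+1) (t :: xs) (nseq w.+1 0%N)).
    rewrite -(minus_identity char0 Q) //.
    apply: (@eq_chain _ _ _ _ _ _ 0) => [|||b sb _ _]; rewrite ?size_nseq ?partition_nseq0 ?mulN1r //.
    by move=> j; rewrite nth_nseq if_same.
  rewrite minus_first_step // mul0r scale0r addr0 horner_sum.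
  by apply: eq_bigr => j _; rewrite !hornerE mulrC mulN1r.
have := congr1 (fun p : {poly K} => p`_k) E.
rewrite (coef_pair (-1) (fun c => phi (schur_sum n w.+1 c))); last by lia.
rewrite (coef_half (-1) 0 (fun j => transfer w.+1 (@kminus K w.+1) xs (colpart j w.+1))) ?(ltnW kw) //.
by rewrite mulN1r (ltn_eqF kw).
Qed.

Hypothesis phi_inj : injective phi.

Let cancel2 p q : 2 * phi p = phi q -> forall r, 2 * r = q -> p = r.
Proof.
move=> e r er; apply: phi_inj; apply: (mulfI (char0 1)).
by rewrite [LHS]e -er rmorphM rmorph_nat.
Qed.

Lemma schur_sum_MUDee w k : (k < w)%N ->
  schur_sum n w k = \sum_(TS in MUDee n w (colpart k w) (nseq w 0%N)) omega TS.1.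
Proof.
move=> kw; apply: cancel2 (sum_MUDee _ _ _ _); have k_w := ltnW kw.
rewrite rmorphD -transfer_kplus -?transfer_kminus ?size_colpart ?partition_colpart ?len_colpart //.
rewrite -compare_minus //; have := compare_plus (leq_ltn_trans (leq0n k) kw) k_w.
by rewrite (ltn_eqF kw) mul1r => <-; ring.
Qed.

Lemma schur_sum_MUDeo w k : (k < w)%N ->
  schur_sum n w (2 * w - k) = \sum_(TS in MUDeo n w (colpart k w) (nseq w 0%N)) omega TS.1.
Proof.
move=> kw; apply: cancel2 (sum_MUDeo _ _ _ _); have k_w := ltnW kw.
rewrite rmorphB -transfer_kplus -?transfer_kminus ?size_colpart ?partition_colpart ?len_colpart //.
rewrite -compare_minus //; have := compare_plus (leq_ltn_trans (leq0n k) kw) k_w.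
by rewrite (ltn_eqF kw) mul1r => <-; ring.
Qed.

Lemma up0 : perm_eq (up 0 [::]) [:: [::]].
Proof.
apply: uniq_perm; rewrite ?uniq_up // => b; rewrite mem_up inE size_eq0.
by case: eqP => [->|//]; apply/forallP => -[].
Qed.

Lemma down0 : perm_eq (down 0 [::]) [:: [::]].
Proof.
apply: uniq_perm; rewrite ?uniq_down // => b; rewrite mem_down inE size_eq0.
by case: eqP => [->|//]; apply/forallP => -[].
Qed.

Lemma schur_sum_MUDstar w :
  schur_sum n w w = \sum_(TS in MUDstar n w (nseq w 1%N) (nseq w 0%N)) omega TS.1.
Proof.
apply: phi_inj; rewrite sum_MUDstar.
have cw : nseq w 1%N = colpart w w by rewrite /colpart subnn cats0.
rewrite -transfer_kplus ?size_nseq // cw ?partition_colpart //.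
(* The integration argument needs at least one pair; for [w = 0] every shape is empty and the
   recursion is computed directly. *)
case: (posnP w) => [->|w0]; last first.
  apply: (mulfI (char0 1)); have := compare_plus w0 (leqnn w); rewrite eqxx => <-.
  by rewrite (_ : 2 * w - w = w)%N; [ring | lia].
rewrite (schur_sum_chain 0 phi) muln0 /= -/xs.
elim: xs => [|x ys IH] //=.
rewrite !(perm_big _ up0) !big_seq1 (perm_big _ down0) big_seq1 -IH.
by rewrite /kplus /wt /peak /full_rise /= subr0 addr0 !expr0 !mul1r.
Qed.

End Comparison.

(** * A field with roots of unity containing the integral polynomials *)

Lemma tofrac_mpoly_char0 n d : d.+1%:R != 0 :> {fraction {mpoly algC[n]}}.
Proof.
rewrite -(rmorph_nat (@FracField.tofrac {mpoly algC[n]})) tofrac_eq0.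
by rewrite -mpolyC_nat mpolyC_eq0 Num.Theory.pnatr_eq0.
Qed.

Lemma tofrac_mpoly_roots n N : exists z : {fraction {mpoly algC[n]}}, N.+1.-primitive_root z.
Proof.
have [z pz] := C_prim_root_exists (ltn0Sn N).
pose f : {rmorphism algC -> {fraction {mpoly algC[n]}}} :=
  @FracField.tofrac {mpoly algC[n]} \o @mpolyC n algC.
by exists (f z); rewrite fmorph_primitive_root.
Qed.

Theorem theorem7p15 (n w : nat) (hn : (1 <= n)%N) :
  (forall k : nat, (k < w)%N ->
     schur_sum n w k
       = \sum_(TS in MUDee n w (colpart k w) (nseq w 0%N)) omega TS.1
     /\
     schur_sum n w (2 * w - k)
       = \sum_(TS in MUDeo n w (colpart k w) (nseq w 0%N)) omega TS.1)
  /\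
  schur_sum n w w
    = \sum_(TS in MUDstar n w (nseq w 1%N) (nseq w 0%N)) omega TS.1.
Proof.
case: n hn => // n0 _.
pose phi : {rmorphism {mpoly int[n0.+1]} -> {fraction {mpoly algC[n0.+1]}}} :=
  @FracField.tofrac {mpoly algC[n0.+1]} \o map_mpoly intr.
have phi_inj : injective phi.
  move=> p q e; apply/mpolyP => d.
  have {}e : map_mpoly (intr : int -> algC) p = map_mpoly intr q.
    by apply/eqP; rewrite -tofrac_eq; apply/eqP.
  have := congr1 (mcoeff d) e; rewrite !mcoeff_map_mpoly; exact: intr_inj.
have c0 := @tofrac_mpoly_char0 n0.+1; have rt := @tofrac_mpoly_roots n0.+1.
split; last exact: (schur_sum_MUDstar c0 rt phi_inj).
move=> k kw; split.
  exact: (schur_sum_MUDee c0 rt phi_inj kw).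
exact: (schur_sum_MUDeo c0 rt phi_inj kw).
Qed.
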